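(* Let $X$ be a time-homogeneous Markov process in a locally compact metric space $\mathbb{X}$ whose law depends on a parameter $\theta\in\Theta=(\theta_1,\theta_2)\subset\mathbb{R}$, with transition probability density $p_h(\theta;x,y)$ with respect to a $\sigma$-finite measure $\lambda$, where $h>0$ is fixed. Fix $x\in\mathbb{X}$ and $\theta_0\in\Theta$. With $\mathcal{E}_n$, $q_h$, $g_h$, $I_n$ as defined in the context, suppose the following. 1. The statistical experiment $\mathcal{E}_n$ is regular for every starting point in $\mathbb{X}$ and every $n\ge 1$; and $I_n(\theta_0)>0$ for all $n$ large enough. Put $r(n)=I_n(\theta_0)^{-1/2}$ for those $n$. 2. The sequence $r(n)\sum_{j=1}^n g_h(\theta_0;X_{h(j-1)},X_{hj})$ converges in law under $\mathsf{P}_x^{\theta_0}$ to the standard normal law $N(0,1)$ as $n\to\infty$. 3. The sequence $r^2(n)\sum_{j=1}^n g_h^2(\theta_0;X_{h(j-1)},X_{hj})$ converges to $1$ in $\mathsf{P}_x^{\theta_0}$-probability as $n\to\infty$. 4. There exists a constant $p>2$ such that $$\lim_{n\to\infty} r^p(n)\,\mathsf{E}_x^{\theta_0}\sum_{j=1}^n\left|g_h(\theta_0;X_{h(j-1)},X_{hj})\right|^p=0.$$ 5. For every $N>0$, $$\lim_{n\to\infty}\sup_{|v|<N} r^2(n)\,\mathsf{E}_x^{\theta_0}\sum_{j=1}^n\int_{\mathbb{X}}\Big(q_h(\theta_0+r(n)v;X_{h(j-1)},y)-q_h(\theta_0;X_{h(j-1)},y)\Big)^2\lambda(dy)=0.$$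 Then the family $\{\mathsf{P}_{x,n}^\theta,\ \theta\in\Theta\}$ has the LAN property at the point $\theta_0$ as $n\to\infty$.
   Context: $\mathsf{P}_x^\theta$ is the law of $X$ with $X_0=x$ under the parameter value $\theta$, and $\mathsf{E}_x^\theta$ the corresponding expectation. $\mathsf{P}_{x,n}^\theta$ is the law under $\mathsf{P}_x^\theta$ of the observation vector $X^n=(X_h,X_{2h},\dots,X_{nh})$, and $\mathcal{E}_n=(\mathbb{X}^n,\mathcal{B}(\mathbb{X}^n),\mathsf{P}^\theta_{x,n},\theta\in\Theta)$ is the statistical experiment generated by $X^n$ with $X_0=x$. It has the density $\prod_{j=1}^n p_h(\theta;y_{j-1},y_j)$ (with $y_0=x$) with respect to $\lambda^{\otimes n}$. Regularity. $\mathcal{E}_1$ is regular if for every $x\in\mathbb{X}$: (a) $\theta\mapsto p_h(\theta;x,y)$ is continuous for $\lambda$-a.a. $y$; (b) $\theta\mapsto\sqrt{p_h(\theta;x,\cdot)}$ is differentiable in $L_2(\mathbb{X},\lambda)$, i.e. there is $q_h(\theta;x,\cdot)\in L_2(\mathbb{X},\lambda)$ with $$\int_{\mathbb{X}}\Big(\tfrac{\sqrt{p_h(\theta+\delta;x,y)}-\sqrt{p_h(\theta;x,y)}}{\delta}-q_h(\theta;x,y)\Big)^2\lambda(dy)\to0,\quad \delta\to0;$$ (c) $\theta\mapsto q_h(\theta;x,\cdot)$ is continuous in $L_2(\mathbb{X},\lambda)$. Regularity of $\mathcal{E}_n$ is the same set of requirements (continuity in $\theta$ for a.a. points, $L_2$-differentiability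 of the square root of the density, $L_2$-continuity of its derivative) for the density of $\mathcal{E}_n$ with respect to $\lambda^{\otimes n}$. The functions $p_h,q_h$ are understood to be measurable, so that all the integrals below make sense. Put $g_h(\theta;x,y)=2q_h(\theta;x,y)/\sqrt{p_h(\theta;x,y)}$ where $p_h(\theta;x,y)\ne0$ and $g_h=0$ otherwise (the derivative of the log-likelihood); it satisfies $\mathsf{E}_x^\theta g_h(\theta;x,X_h)=0$. The Fisher information of $\mathcal{E}_n$ is $$I_n(\theta)=\sum_{k=1}^n\mathsf{E}_x^\theta\big(g_h(\theta;X_{h(k-1)},X_{hk})\big)^2=4\,\mathsf{E}_x^\theta\sum_{k=1}^n\int_{\mathbb{X}}\big(q_h(\theta;X_{h(k-1)},y)\big)^2\lambda(dy),$$ which is finite when $\mathcal{E}_n$ is regular. LAN property. The family $\{\mathsf{P}^\theta_{x,n},\theta\in\Theta\}$ has the LAN (local asymptotic normality) property at $\theta_0$ if for some sequence $r(n)>0$ and all $u\in\mathbb{R}$ (and $n$ large enough that $\theta_0+r(n)u\in\Theta$) $$Z_{n,\theta_0}(u):=\frac{d\mathsf{P}_{x,n}^{\theta_0+r(n)u}}{d\mathsf{P}_{x,n}^{\theta_0}}(X^n)=\exp\Big\{\Delta_n(\theta_0)u-\tfrac12u^2+\Psi_n(u,\theta_0)\Big\},$$ where $\Delta_n(\theta_0)$ does not depend on $u$, the law of $\Delta_n(\theta_0)$ under $\mathsf{P}_{x,n}^{\theta_0}$ converges weakly to $N(0,1)$, and $\Psi_n(u,\theta_0)\to0$ in $\mathsf{P}_{x,n}^{\theta_0}$-probability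 as $n\to\infty$. The derivative is understood as that of the absolutely continuous component, i.e. the ratio of the densities; $\Psi_n=-\infty$ is allowed where this ratio is $0$. *)

(* Defs.v *)
From HB Require Import structures.
From mathcomp Require Import all_boot all_order all_algebra.
From mathcomp Require Import all_classical all_reals all_analysis.
From mathcomp Require Import measurable_realfun.

Set Implicit Arguments.
Unset Strict Implicit.
Unset Printing Implicit Defensive.

Import Order.TTheory GRing.Theory Num.Theory.
Import numFieldTopology.Exports numFieldNormedType.Exports.

Local Open Scope classical_set_scope.
Local Open Scope ring_scope.

(* [measurableType] is built on [pointedType] whereas [metricType] is not, hence
   this join. *)
#[short(type="pointedMetricType")]
HB.structure Definition PointedMetric (K : numDomainType) :=
  {T of Pointed T & Metric K T}.

Notation borel E := (g_sigma_algebraType (@open E)).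

(* The endpoints may be infinite. *)
Definition open_interval (R : realType) (a b : \bar R) : set R :=
  [set t | (a < t%:E < b)%E].

Section product_measure.
Context d (T : measurableType d) (R : realType).
Variable lambda : {sigma_finite_measure set T -> \bar R}.

Definition tuple_rcons n (z : n.-tuple T * T) : n.+1.-tuple T :=
  [tuple of rcons z.1 z.2].

Lemma measurable_tuple_rcons n : measurable_fun setT (@tuple_rcons n).
Proof.
apply/measurable_fun_tnthP => i.
have [lt_in|le_ni] := ltnP i n.
- rewrite (_ : _ \o _ = (@tnth n T ^~ (Ordinal lt_in)) \o fst); last first.
    apply/funext => -[t y] /=.
    by rewrite (tnth_nth y) /= nth_rcons size_tuple lt_in (tnth_nth y).
  by apply: measurableT_comp => //; exact: measurable_tnth.
- rewrite (_ : _ \o _ = snd) //; apply/funext => -[t y] /=.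
  rewrite (tnth_nth y) /= nth_rcons size_tuple ltnNge le_ni /=.
  by rewrite (_ : i == n :> nat) // eqn_leq le_ni andbT -ltnS.
Qed.

HB.instance Definition _ n :=
  isMeasurableFun.Build _ _ _ _ (@tuple_rcons n) (@measurable_tuple_rcons n).

Section tuple_extend.
Context n (mu : {measure set (n.-tuple T) -> \bar R}).

Definition tuple_extend : set (n.+1.-tuple T) -> \bar R :=
  pushforward (mu \x lambda)%E (@tuple_rcons n).

Let mf : measurable_fun setT (@tuple_rcons n) := @measurable_tuple_rcons n.

Let tuple_extend0 : tuple_extend set0 = 0%E.
Proof. by rewrite /tuple_extend /pushforward preimage_set0 measure0. Qed.

Let tuple_extend_ge0 A : (0 <= tuple_extend A)%E.
Proof. exact: measure_ge0. Qed.

Let tuple_extend_sigma_additive : semi_sigma_additive tuple_extend.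
Proof.
move=> F mF tF mUF; rewrite /tuple_extend /pushforward preimage_bigcup.
apply: measure_semi_sigma_additive.
- by move=> k; rewrite -[X in measurable X]setTI; exact: mf.
- apply/trivIsetP => /= i j _ _ ij; rewrite -preimage_setI.
  by move/trivIsetP : tF => /(_ _ _ _ _ ij) ->//; rewrite preimage_set0.
- by rewrite -preimage_bigcup -[X in measurable X]setTI; exact: mf.
Qed.

HB.instance Definition _ := isMeasure.Build _ _ _ tuple_extend
  tuple_extend0 tuple_extend_ge0 tuple_extend_sigma_additive.

End tuple_extend.

(* lambda^{(x) n} on the product sigma-algebra of the n-tuples; only [lambda],
   the second factor of each step, has to be sigma-finite. *)
Fixpoint tuple_measure n : {measure set (n.-tuple T) -> \bar R} :=
  match n with
  | 0 => \d_([tuple] : 0.-tuple T)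
  | n'.+1 => tuple_extend (tuple_measure n')
  end.

End product_measure.

Section convergence.
Context d (T : nat -> measurableType d) (R : realType).
Variable P : forall n, probability (T n) R.

Definition cvg_in_law (Y : forall n, T n -> R) (nu : probability (measurableTypeR R) R) :=
  forall phi : R -> R, continuous phi -> (exists M, forall z, `|phi z| <= M) ->
    ('E_(P n)[phi \o Y n] @[n --> \oo] --> 'E_nu[phi])%E.

Definition cvg_in_probability (Y : forall n, T n -> \bar R) (c : R) :=
  forall e : R, 0 < e ->
    (P n [set w | e%:E <= `|Y n w - c%:E|] @[n --> \oo] --> 0)%E.

End convergence.

(* [P n t], t in Theta, is the law of the n-th experiment, and [f n t] its
   density with respect to a measure which does not depend on t.  [Psi] may take
   the value -oo, and expeR -oo = 0.  The likelihood
   ratio f n t' / f n t is 0 where f n t vanishes, which is a P n t-null set. *)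
Definition LAN d (T : nat -> measurableType d) (R : realType) (Theta : set R)
    (P : forall n, R -> probability (T n) R) (f : forall n, R -> T n -> R)
    (theta0 : R) : Prop :=
  exists (r : nat -> R) (Delta : forall n, T n -> R)
         (Psi : forall n, R -> T n -> \bar R),
  [/\ forall n, 0 < r n,
      forall n, measurable_fun setT (Delta n),
      cvg_in_law (fun n => P n theta0) Delta (normal_prob 0 1) &
      forall u : R,
      [/\ \forall n \near \oo, Theta (theta0 + r n * u),
          \forall n \near \oo, {ae P n theta0, forall y,
            ((f n (theta0 + r n * u) y / f n theta0 y)%:E =
             expeR ((Delta n y * u - u ^+ 2 / 2)%:E + Psi n u y))%E},
          forall n, measurable_fun setT (Psi n u) &
          cvg_in_probability (fun n => P n theta0) (fun n => Psi n u) 0]].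

(* [q] is the L2(mu)-derivative of the square root of the density [f]. *)
Record regular d (T : measurableType d) (R : realType)
    (mu : {measure set T -> \bar R}) (Theta : set R) (f q : R -> T -> R)
    : Prop := {
  regular_continuous : {ae mu, forall y, forall t, Theta t ->
    {for t, continuous (fun t' => f t' y)}} ;
  regular_L2 : forall t, Theta t -> q t \in Lfun mu 2%:E ;
  regular_derivative : forall t, Theta t ->
    (\int[mu]_y (((Num.sqrt (f (t + dt) y) - Num.sqrt (f t y)) / dt
                   - q t y) ^+ 2)%:E @[dt --> 0%R^'] --> 0)%E ;
  regular_derivative_continuous : forall t, Theta t ->
    (\int[mu]_y ((q t' y - q t y) ^+ 2)%:E @[t' --> t] --> 0)%E
}.

Section markov_model.
Context (R : realType) (E : pointedMetricType R).
Context dO (Omega : measurableType dO).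
Variable Theta : set R.
Variable P : R -> E -> probability Omega R.
Variable X : R -> {mfun Omega >-> borel E}.

Definition past (s : R) : set (set Omega) :=
  <<s [set A | exists u B, [/\ 0 <= u <= s, measurable B & A = X u @^-1` B] ]>>.

(* [P t x] is the law under the parameter t for the starting point x; only the
   times s >= 0 and the parameters t in Theta matter.  The transition
   probabilities over a time s are (y, B) |-> P t y (X s @^-1` B). *)
Record markov_family : Prop := {
  markov_start : forall t x, Theta t -> P t x (X 0 @^-1` [set x]) = 1%E ;
  markov_kernel : forall t s (B : set (borel E)), Theta t -> 0 <= s ->
    measurable B ->
    measurable_fun setT (fun y : borel E => P t y (X s @^-1` B)) ;
  markov_property : forall t x s s' A (B : set (borel E)), Theta t ->
    0 <= s -> 0 <= s' -> past s A -> measurable B ->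
    P t x (A `&` X (s + s') @^-1` B) =
    (\int[P t x]_(w in A) P t (X s w) (X s' @^-1` B))%E
}.

Definition jointly_measurable (f : R -> E -> E -> R) :=
  forall t, Theta t ->
  measurable_fun setT (fun z : borel E * borel E => f t z.1 z.2).

Variable lambda : {sigma_finite_measure set (borel E) -> \bar R}.
Variable h : R.

Record transition_density (p : R -> E -> E -> R) : Prop := {
  transition_density_ge0 : forall t x y, Theta t -> 0 <= p t x y ;
  transition_density_measurable : jointly_measurable p ;
  transition_densityE : forall t x (B : set (borel E)), Theta t ->
    measurable B ->
    P t x (X h @^-1` B) = (\int[lambda]_(y in B) (p t x y)%:E)%E
}.

Definition sample (k : nat) : {mfun Omega >-> borel E} := X (h * k%:R).

Definition observation n (w : Omega) : n.-tuple (borel E) :=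
  [tuple sample i.+1 w | i < n].

Lemma measurable_observation n : measurable_fun setT (@observation n).
Proof.
apply/measurable_fun_tnthP => i.
rewrite (_ : _ \o _ = sample i.+1) //.
by apply/funext => w /=; rewrite tnth_mktuple.
Qed.

HB.instance Definition _ n :=
  isMeasurableFun.Build _ _ _ _ (@observation n) (@measurable_observation n).

Definition observation_law (x : E) n (t : R)
  : probability (n.-tuple (borel E)) R := distribution (P t x) (@observation n).

Variables p q : R -> E -> E -> R.

Definition observation_density (x : E) n (t : R) (y : n.-tuple (borel E)) : R :=
  \prod_(j < n) p t (nth x (x :: y) j) (tnth y j).

Definition experiment_regular (x : E) n : Prop :=
  exists qn : R -> n.-tuple (borel E) -> R,
    regular (tuple_measure lambda n) Theta (@observation_density x n) qn.

Definition score (t : R) (x y : E) : R :=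
  if p t x y == 0 then 0 else 2 * q t x y / Num.sqrt (p t x y).

Definition score_step (t : R) (j : nat) (w : Omega) : R :=
  score t (sample j w) (sample j.+1 w).

Definition fisher (x : E) n (t : R) : \bar R :=
  (\sum_(j < n) 'E_(P t x)[fun w => (score_step t j w ^+ 2)%R])%E.

(* The information is finite for a regular experiment. *)
Definition fisher_rate (x : E) n (t : R) : R :=
  (Num.sqrt (fine (fisher x n t)))^-1.

End markov_model.

(* Main.v *)
Require Import Defs.
From HB Require Import structures.
From mathcomp Require Import all_boot all_order all_algebra.
From mathcomp Require Import all_classical all_reals all_analysis.
From mathcomp Require Import measurable_realfun.
From mathcomp Require Import ring lra.

Set Implicit Arguments.
Unset Strict Implicit.
Unset Printing Implicit Defensive.

Import Order.TTheory GRing.Theory Num.Theory.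
Import numFieldTopology.Exports numFieldNormedType.Exports.

Local Open Scope classical_set_scope.
Local Open Scope ring_scope.

(** The likelihood ratio of n observations is a product over the n transitions of the
    chain.  Write [s t y z] for the square root of [p t y z] ([rootp]), put c = r(n) u
    and
      xi(y, z) = s (theta0 + c) y z / s theta0 y z - 1,
    so that the ratio is the product of the (1 + xi)^2 and its logarithm the sum of the
    2 ln (1 + xi), wherever all |xi| < 1.  Since 2 ln (1 + x) = 2 x - x^2 + O(|x|^3)
    ([ln1D_expansion]), it is enough to know that max |xi| tends to 0 and to find the
    limits of the sums of xi and of xi^2.  Compare xi with eta = (u / 2) r(n) g, where g
    is the score, and put zeta = xi - eta.  Given the present state y, the second moment
    of zeta is at most the squared L2 norm D(y) of
      s (theta0 + c) y - s theta0 y - c q theta0 y      ([sq_zeta_le]).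

    - The expectation of the sum of the D(X_j) tends to 0.  Indeed D(y) is at most a
      lower limit of averages over a uniform grid of points v in [0, 1] of
      c^2 |q (theta0 + v c) y - q theta0 y|^2 ([sq_taylor]), and Fatou's lemma reduces
      the claim to the assumption on the increments of q ([integral_remainder_le]).
    - Hence the sum of zeta^2 tends to 0 in L1.  So the sum of xi^2 has the same limit
      u^2 / 4 as the sum of eta^2, and max |xi| tends to 0 because max |eta| does, by
      the moment condition of order a > 2 ([max_xi_cvg]).
    - The conditional mean of xi is - H / 2, where H(y) is the squared L2 norm of
      s (theta0 + c) y - s theta0 y, because the roots have norm one; that of g is 0
      because a curve on the unit sphere is orthogonal to its derivative
      ([ip_derive_unit]).  So the sum of the zeta + H / 2 is a martingale, and its second
      moment is at most the expectation of the sum of the zeta^2 ([centered_sum_sq]).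
    - The sum of the H(X_j) tends to u^2 / 4: by the first step it may be replaced by
      the sum of the c^2 |q theta0|^2, which are the conditional means of eta^2 since q
      vanishes where the density does ([sq_derive_support]); the sum of the eta^2 minus
      their conditional means tends to 0 in L1, by truncation and the moment condition
      ([cond_square_L1]).

    Adding up, the log-likelihood ratio is
      2 sum eta + 2 sum zeta - sum xi^2 + o(1) = u r(n) sum g - u^2 / 4 - u^2 / 4 + o(1)
    ([log_ratio_cvg]).  The rate r(n) tends to 0, so that theta0 + r(n) u lies in the
    parameter set for n large: the moment sums of order a increase with n and do not all
    vanish, so that the moment condition forces r(n)^a to tend to 0 ([rate_cvg0]).

    Convergence in probability is expressed as convergence along a filter on the pairs
    (n, omega) ([in_prob]), to which the calculus of limits applies.  Sums of squares are
    compared through |x^2 - y^2| <= (1 + c) (x - y)^2 + y^2 / c for every c > 0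
    ([young_sqr], [cvg_young]). *)

(** * Measures given by a density, and disintegration of an integral *)

Section density_measure.
Context d (T : measurableType d) (R : realType).
Variables (mu : {measure set T -> \bar R}) (k : T -> R).
Hypothesis k0 : forall x, 0 <= k x.
Hypothesis mk : measurable_fun setT k.
Local Open Scope ereal_scope.

(** The measure with density [k] with respect to [mu].  The two proofs are arguments so
    that the measure structure can be attached to the set function. *)
Definition density_measure of (forall x, (0 <= k x)%R) &
  measurable_fun setT k := fun A : set T => \int[mu]_(x in A) (k x)%:E.

Local Notation dm := (density_measure k0 mk).

Let dm0 : dm set0 = 0.
Proof. by rewrite /density_measure integral_set0. Qed.

Let dm_ge0 A : 0 <= dm A.
Proof. by apply: integral_ge0 => x _; rewrite lee_fin. Qed.

Let dm_sigma_additive : semi_sigma_additive dm.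
Proof.
move=> F mF tF mUF; rewrite /density_measure ge0_integral_bigcup//.
- by apply: is_cvg_ereal_nneg_natsum => n _; apply: integral_ge0 => x _; rewrite lee_fin.
- by apply/measurable_EFinP; exact: measurable_funTS.
- by move=> x _; rewrite lee_fin.
Qed.

HB.instance Definition _ := isMeasure.Build _ _ _ dm dm0 dm_ge0 dm_sigma_additive.

Import HBNNSimple.

(** By approximation of [f] with simple functions. *)
Lemma integral_density_measure (f : T -> \bar R) :
  (forall x, 0 <= f x) -> measurable_fun setT f ->
  \int[dm]_x f x = \int[mu]_x (f x * (k x)%:E).
Proof.
move=> f0 mf.
pose g := nnsfun_approx measurableT mf.
have kfin x : (k x)%:E \is a fin_num by [].
have dmind A : measurable A -> \int[dm]_x (\1_A x)%:E = \int[mu]_x ((\1_A x * k x)%:E).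
  move=> mA; rewrite integral_indic// setIT /= /density_measure [LHS]integral_mkcond.
  apply: eq_integral => x _; rewrite patchE indicE.
  by case: ifP; rewrite ?mul1r ?mul0r.
have -> : \int[dm]_x f x = limn (fun n => \int[dm]_x (g n x)%:E).
  rewrite -monotone_convergence//.
  - by apply: eq_integral => x _; apply/esym/cvg_lim => //; exact: cvg_nnsfun_approx.
  - by move=> n; exact/measurable_EFinP.
  - by move=> n x _; rewrite lee_fin.
  - by move=> y /= _ a b ab; rewrite lee_fin; exact/lefP/nd_nnsfun_approx.
have -> : \int[mu]_x (f x * (k x)%:E) = limn (fun n => \int[mu]_x (g n x * k x)%:E).
  rewrite -monotone_convergence//.
  - apply: eq_integral => x _; apply/esym/cvg_lim => //.
    under eq_fun do rewrite EFinM.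
    by apply: cvgeZr => //; exact: cvg_nnsfun_approx.
  - by move=> n; apply/measurable_EFinP; exact: measurable_funM.
  - by move=> n x _; rewrite lee_fin mulr_ge0.
  - move=> y /= _ a b ab; rewrite lee_fin ler_wpM2r//.
    exact/lefP/nd_nnsfun_approx.
congr (limn _); apply/funext => n.
transitivity (\sum_(r \in range (g n))
    \int[dm]_x (r * \1_(g n @^-1` [set r]) x)%:E).
  under eq_integral do rewrite fimfunE -fsumEFin//.
  rewrite ge0_integral_fsum//.
  - by move=> y; exact/measurable_EFinP/measurable_funM.
  - by move=> y x _; rewrite nnfun_muleindic_ge0.
transitivity (\sum_(r \in range (g n))
    \int[mu]_x (r * \1_(g n @^-1` [set r]) x * k x)%:E).
  apply: eq_fsbigr => r; rewrite inE => -[t _ <-].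
  have r0 : (0 <= g n t)%R by [].
  under [LHS]eq_integral do rewrite EFinM.
  under [RHS]eq_integral do rewrite -mulrA EFinM.
  rewrite ge0_integralZl//.
  - rewrite ge0_integralZl//.
    + by rewrite dmind.
    + by apply/measurable_EFinP; exact: measurable_funM.
    + by move=> x _; rewrite lee_fin mulr_ge0.
  - exact/measurable_EFinP.
rewrite -ge0_integral_fsum//.
- apply: eq_integral => x _; rewrite fsumEFin//; congr (_%:E).
  by rewrite [in RHS]fimfunE mulr_fsuml.
- by move=> y; apply/measurable_EFinP; apply: measurable_funM => //; exact: measurable_funM.
- by move=> y x _; rewrite EFinM mule_ge0 ?(EFinM, nnfun_muleindic_ge0)// lee_fin.
Qed.

End density_measure.

Section disintegration.
Context d0 d1 d2 (Om : measurableType d0) (T1 : measurableType d1)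
  (T2 : measurableType d2) (R : realType).
Variables (P : probability Om R) (la : {sigma_finite_measure set T2 -> \bar R}).
Variables (U : {mfun Om >-> T1}) (V : {mfun Om >-> T2}) (k : T1 -> T2 -> R).
Hypothesis k0 : forall x y, 0 <= k x y.
Hypothesis mk : measurable_fun setT (fun z : T1 * T2 => k z.1 z.2).
Local Open Scope ereal_scope.
(* [k (U w)] is the density of the conditional law of [V] given [U]. *)
Hypothesis disint : forall A B, measurable A -> measurable B ->
  P (U @^-1` A `&` V @^-1` B) =
  \int[P]_(w in U @^-1` A) \int[la]_(y in B) (k (U w) y)%:E.

(** The laws of (U, V) and of the measure with density [k] with respect to the product of
    the law of [U] and [la] agree on rectangles, hence coincide. *)
Lemma integral_disintegration (f : T1 * T2 -> \bar R) :
  (forall z, 0 <= f z) ->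
  measurable_fun setT f ->
  \int[P]_w f (U w, V w) = \int[P]_w \int[la]_y (f (U w, y) * (k (U w) y)%:E).
Proof.
move=> f0 mf.
pose W w := (U w, V w).
have mW : measurable_fun setT W by exact/measurable_fun_pair.
pose Wm : {mfun Om >-> (T1 * T2)%type} := HB.pack W (isMeasurableFun.Build _ _ _ _ _ mW).
have k0' (z : T1 * T2) : (0 <= k z.1 z.2)%R by [].
pose P1 : probability T1 R := distribution P U.
pose m2 : {measure set (T1 * T2) -> \bar R} := @density_measure _ _ R (P1 \x la) _ k0' mk.
have m12 A : measurable A -> distribution P Wm A = m2 A.
  move=> mA.
  pose C : set (set (T1 * T2)) :=
   [set C | exists A, measurable A /\ exists B, measurable B /\ C = A `*` B].
  apply: (measure_unique C (fun=> setT)) => //.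
  - rewrite measurable_prod_measurableType //; congr (<<s _ >>).
    rewrite predeqE; split => [[A' mA' [B mB <-]]|[A' [mA' [B [mB ->]]]]].
      by exists A'; split => //; exists B.
    by exists A' => //; exists B.
  - move=> /= _ _ [X1 [mX1 [X2 [mX2 ->]]]] [Y1 [mY1 [Y2 [mY2 ->]]]].
    rewrite -setXI; exists (X1 `&` Y1); split; first exact: measurableI.
    by exists (X2 `&` Y2); split => //; exact: measurableI.
  - by move=> n; exists setT; split => //; exists setT; split => //; rewrite setXTT.
  - by rewrite bigcup_const//; exists 0%N.
  - move=> _ [A1 [mA1 [A2 [mA2 ->]]]].
    transitivity (P (U @^-1` A1 `&` V @^-1` A2)); first by [].
    rewrite disint//.
    rewrite -[RHS]/(\int[P1 \x la]_(z in A1 `*` A2) (k z.1 z.2)%:E).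
    have mkA : measurable_fun setT
        ((fun z : T1 * T2 => (k z.1 z.2)%:E) \_ (A1 `*` A2)).
      apply/(measurable_restrictT _ _).1; first exact: measurableX.
      by apply: measurable_funTS; exact/measurable_EFinP.
    have kA0 z : 0 <= ((fun z : T1 * T2 => (k z.1 z.2)%:E) \_ (A1 `*` A2)) z.
      by rewrite patchE; case: ifP => // _; rewrite lee_fin.
    rewrite [RHS]integral_mkcond fubini_tonelli1//.
    rewrite ge0_integral_distribution.
    + rewrite integral_mkcond; apply: eq_integral => w _.
      rewrite patchE; case: ifPn => wA.
        rewrite /= /fubini_F [LHS]integral_mkcond; apply: eq_integral => y _.
        by rewrite !patchE in_setX /= (_ : (U w \in A1) = true)//; rewrite inE in wA *.
      transitivity (0 : \bar R) => //; apply/esym; apply: integral0_eq => y _.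
      rewrite patchE in_setX /= ifF//; apply/negP => /andP[/set_mem UA _].
      by move/negP: wA; apply; rewrite inE.
    + exact: measurable_fun_fubini_tonelli_F.
    + by move=> z; exact: integral_ge0.
  - move=> n; exact: (le_lt_trans (probability_le1 _ measurableT) (ltry _)).
transitivity (\int[distribution P Wm]_z f z).
  by rewrite ge0_integral_distribution.
rewrite (@eq_measure_integral _ _ _ setT m2); last by move=> A mA _; exact: m12.
have mfk : measurable_fun setT (fun z => f z * (k z.1 z.2)%:E).
  by apply: emeasurable_funM => //; exact/measurable_EFinP.
have fk0 z : 0 <= f z * (k z.1 z.2)%:E by rewrite mule_ge0// lee_fin.
rewrite integral_density_measure// fubini_tonelli1//.
rewrite ge0_integral_distribution//.
- exact: (measurable_fun_fubini_tonelli_F _ _ fk0).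
- by move=> x; exact: integral_ge0.
Qed.
End disintegration.

(** * Convergence in probability as convergence along a filter *)

Section in_prob.
Context d (Om : measurableType d) (R : realType).
Variable P : probability Om R.

(** The sets of pairs (n, w) which hold outside an exceptional event whose probability
    tends to 0: [Y z @[z --> in_prob] --> c] says that Y(n, .) converges to [c] in
    probability. *)
Definition in_prob : set_system (nat * Om) := [set S | exists B : nat -> set Om,
  (P (B n) @[n --> \oo] --> 0)%E /\
  \forall n \near \oo, measurable (B n) /\ forall w, ~ B n w -> S (n, w)].

Global Instance in_prob_filter : Filter in_prob.
Proof.
split.
- exists (fun=> set0); split; last by near=> n; split.
  by under eq_fun do rewrite measure0; exact: cvg_cst.
- move=> S1 S2 [B1 [cB1 nB1]] [B2 [cB2 nB2]].
  exists (fun n => B1 n `|` B2 n); split.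
    have c12 : (P (B1 n) + P (B2 n) @[n --> \oo] --> 0)%E.
      by rewrite -[X in _ --> X]add0e; apply: cvgeD.
    apply: (squeeze_cvge _ (cvg_cst 0%E) c12).
    near=> n; rewrite measure_ge0/=; apply: measureU2.
      by have [] : measurable (B1 n) /\ forall w, ~ B1 n w -> S1 (n, w) by near: n.
    by have [] : measurable (B2 n) /\ forall w, ~ B2 n w -> S2 (n, w) by near: n.
  near=> n.
  have [m1 H1] : measurable (B1 n) /\ forall w, ~ B1 n w -> S1 (n, w) by near: n.
  have [m2 H2] : measurable (B2 n) /\ forall w, ~ B2 n w -> S2 (n, w) by near: n.
  split; first exact: measurableU.
  move=> w nB; split; [apply: H1 => B|apply: H2 => B]; apply: nB; [by left|by right].
- move=> S1 S2 S12 [B [cB nB]]; exists B; split => //.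
  near=> n; have [m1 H1] : measurable (B n) /\ forall w, ~ B n w -> S1 (n, w) by near: n.
  by split => // w /H1 /S12.
Unshelve. all: by end_near. Qed.

Lemma near_in_prob (S : nat -> set Om) :
  (\forall n \near \oo, forall w, S n w) -> \forall z \near in_prob, S z.1 z.2.
Proof.
move=> nS; exists (fun=> set0); split.
  by under eq_fun do rewrite measure0; exact: cvg_cst.
by near=> n; split => // w _; move: w; near: n.
Unshelve. all: by end_near. Qed.

(** An almost sure property holds along [in_prob]. *)
Lemma as_near_in_prob (A : set Om) (S : nat -> set Om) :
  measurable A -> P A = 1%E -> (forall n, A `<=` S n) ->
  \forall z \near in_prob, S z.1 z.2.
Proof.
move=> mA PA AS; exists (fun=> ~` A); split.
  rewrite (_ : (fun=> _) = fun=> 0%E); first exact: cvg_cst.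
  by apply/funext => n; rewrite probability_setC// PA subee.
by near=> n; split => [|w /contrapT /AS //]; exact: measurableC.
Unshelve. all: by end_near. Qed.

Lemma in_prob_cvg0 (C : nat -> set Om) :
  (\forall n \near \oo, measurable (C n)) ->
  (\forall z \near in_prob, ~ C z.1 z.2) -> (P (C n) @[n --> \oo] --> 0)%E.
Proof.
move=> mC [B [cB nB]].
apply: (squeeze_cvge _ (cvg_cst 0%E) cB).
near=> n; rewrite measure_ge0/=.
have [m1 H1] : measurable (B n) /\ forall w, ~ B n w -> ~ C n w by near: n.
apply: le_measure; rewrite ?inE//; first by near: n.
by move=> w Cw; apply: contrapT => /H1.
Unshelve. all: by end_near. Qed.

(** Markov's inequality: convergence to 0 in L1 implies convergence in probability. *)
Lemma in_prob_markov (Z : nat -> Om -> \bar R) :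
  (\forall n \near \oo, measurable_fun setT (Z n)) ->
  (\forall n \near \oo, forall w, 0 <= Z n w)%E ->
  (\int[P]_w Z n w @[n --> \oo] --> 0)%E ->
  forall e : R, 0 < e -> \forall z \near in_prob, (Z z.1 z.2 < e%:E)%E.
Proof.
move=> mZ Z0 cZ e e0; exists (fun n => [set w | (e%:E <= Z n w)%E]); split.
  have ce : ((e^-1)%:E * \int[P]_w Z n w @[n --> \oo] --> 0)%E.
    by rewrite -[X in _ --> X](mule0 (e^-1)%:E); exact: cvgeZl.
  apply: (squeeze_cvge _ (cvg_cst 0%E) ce).
  near=> n; rewrite measure_ge0/=.
  rewrite -(@lee_pmul2l _ e%:E)// ?lte_fin// muleA -EFinM divff ?gt_eqF// mul1e.
  have mZn : measurable_fun setT (Z n) by near: n.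
  have mA : measurable [set w | (e%:E <= Z n w)%E].
    by rewrite -[X in measurable X]setTI; exact: emeasurable_fun_c_infty.
  have Z0n w : (0 <= Z n w)%E by move: w; near: n.
  have := @le_integral_abse _ _ _ P setT measurableT (Z n) e mZn e0.
  rewrite setTI; under eq_integral do rewrite gee0_abs//.
  by under eq_set do rewrite gee0_abs//.
near=> n; split=> [|w /= /negP]; last by rewrite -ltNge.
rewrite -[X in measurable X]setTI; apply: emeasurable_fun_c_infty => //.
by near: n.
Unshelve. all: by end_near. Qed.

Lemma in_prob_cvg_L1 (Y : nat * Om -> R) :
  (\forall n \near \oo, measurable_fun setT (fun w => Y (n, w))) ->
  (\int[P]_w `|Y (n, w)|%:E @[n --> \oo] --> 0)%E ->
  Y z @[z --> in_prob] --> 0.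
Proof.
move=> mY cY; apply/cvgrPdist_lt => e e0.
have := @in_prob_markov (fun n w => `|Y (n, w)|%:E) _ _ cY e e0.
have mN : \forall n \near \oo, measurable_fun setT (fun w => `|Y (n, w)|%:E).
  near=> n; apply/measurable_EFinP; apply: measurableT_comp => //.
  by near: n.
have N0 : \forall n \near \oo, forall w, (0 <= `|Y (n, w)|%:E)%E.
  by near=> n => w; rewrite lee_fin.
move=> /(_ mN N0); apply: filterS => -[n w]; rewrite lte_fin sub0r normrN.
by [].
Unshelve. all: by end_near. Qed.

Lemma cvg_in_probability_cvg (Y : nat -> Om -> R) (c : R) :
  (\forall n \near \oo, measurable_fun setT (Y n)) ->
  cvg_in_probability (fun=> P) (fun n w => (Y n w)%:E) c ->
  Y z.1 z.2 @[z --> in_prob] --> c.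
Proof.
move=> mY cY; apply/cvgrPdist_lt => e e0.
exists (fun n => [set w | (e%:E <= `|(Y n w)%:E - c%:E|)%E]); split; first exact: cY.
near=> n; split; last first.
  by move=> w /= /negP; rewrite -ltNge lte_fin distrC.
have mYn : measurable_fun setT (Y n) by near: n.
rewrite -[X in measurable X]setTI; apply: emeasurable_fun_c_infty => //.
apply: measurableT_comp => //; apply/measurable_EFinP.
exact: measurable_funB.
Unshelve. all: by end_near. Qed.

End in_prob.

(** * Square-integrable functions *)

Section young.
Context (R : realType).
Implicit Types (x y c : R).

Lemma young_mul x y c : 0 < c -> `|x * y| <= (c * x ^+ 2 + c^-1 * y ^+ 2) / 2.
Proof.
move=> c0; rewrite -subr_ge0.
have -> : (c * x ^+ 2 + c^-1 * y ^+ 2) / 2 - `|x * y| =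
    c^-1 * (c * `|x| - `|y|) ^+ 2 / 2.
  rewrite normrM -(real_normK (num_real x)) -(real_normK (num_real y)).
  by field; rewrite gt_eqF.
by rewrite divr_ge0// mulr_ge0 ?sqr_ge0// invr_ge0 ltW.
Qed.

Lemma young_sqr x y c : 0 < c ->
  `|x ^+ 2 - y ^+ 2| <= (1 + c) * (x - y) ^+ 2 + c^-1 * y ^+ 2.
Proof.
move=> c0.
have -> : x ^+ 2 - y ^+ 2 = (x - y) ^+ 2 + 2 * ((x - y) * y) by ring.
apply: (le_trans (ler_normD _ _)); rewrite ger0_norm ?sqr_ge0// normrM.
have := young_mul (x - y) y c0; rewrite (ger0_norm (ler0n _ 2)); lra.
Qed.

Lemma cvg_subr0 (T : Type) (F : set_system T) {FF : Filter F} (f g : T -> R) (l : R) :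
  f z - g z @[z --> F] --> (0 : R) -> g z @[z --> F] --> l -> f z @[z --> F] --> l.
Proof. exact: cvg_sub0. Qed.

Lemma cvg_subr0l (T : Type) (F : set_system T) {FF : Filter F} (f g : T -> R) (l : R) :
  f z - g z @[z --> F] --> (0 : R) -> f z @[z --> F] --> l -> g z @[z --> F] --> l.
Proof.
move=> fg fl; apply: cvg_subr0 fl.
rewrite (_ : (fun z => g z - f z) = (fun z => - (f z - g z))).
  by rewrite -[X in _ --> X]oppr0; apply: cvgN.
by apply/funext => z; rewrite opprB.
Qed.

(** For fixed [c] the bound tends to [b / c], which is small when [c] is large. *)
Lemma cvg_young (T : Type) (F : set_system T) {FF : Filter F}
    (S A B : T -> R) (b K : R) :
  (forall c, 0 < c -> \forall z \near F, `|S z| <= (K + c) * A z + c^-1 * B z) ->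
  A z @[z --> F] --> (0 : R) -> B z @[z --> F] --> b ->
  S z @[z --> F] --> (0 : R).
Proof.
move=> H cA cB; apply/cvgr0Pnorm_lt => e e0.
pose c := 2 * (`|b| + 1) / e.
have c0 : 0 < c by rewrite divr_gt0// mulr_gt0// ltr_wpDl.
have cM : (K + c) * A z + c^-1 * B z @[z --> F] --> (K + c) * 0 + c^-1 * b.
  by apply: cvgD; apply: cvgMr.
have lt_e : (K + c) * 0 + c^-1 * b < e.
  rewrite mulr0 add0r /c invf_div mulrAC ltr_pdivrMr ?mulr_gt0 ?ltr_wpDl//.
  rewrite ltr_pM2l//; have := ler_norm b; have := normr_ge0 b; lra.
have nlt : \forall z \near F, (K + c) * A z + c^-1 * B z < e by exact: cvgr_lt cM _ lt_e.
have nH := H c c0.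
near=> z; apply: (@le_lt_trans _ _ ((K + c) * A z + c^-1 * B z)); by near: z.
Unshelve. all: by end_near. Qed.

End young.

Section L2.
Context d (T : measurableType d) (R : realType) (mu : {measure set T -> \bar R}).
Implicit Types f g w : T -> R.

Lemma integrableZl_EFin c f : mu.-integrable setT (EFin \o f) ->
  mu.-integrable setT (EFin \o (fun x => c * f x)).
Proof.
by move=> If; rewrite (_ : _ \o _ = fun x => c%:E * (f x)%:E)%E; [exact: integrableZl|].
Qed.

Lemma integrableD_EFin f g : mu.-integrable setT (EFin \o f) ->
  mu.-integrable setT (EFin \o g) ->
  mu.-integrable setT (EFin \o (fun x => f x + g x)).
Proof.
move=> If Ig; rewrite (_ : _ \o _ = fun x => (f x)%:E + (g x)%:E)%E//.
exact: integrableD.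
Qed.

(** The square-integrable functions, as functions and not as classes; [sq] is the
    squared norm and [ip] the inner product. *)
Definition L2 f := measurable_fun setT f /\
  mu.-integrable setT (fun x => (f x ^+ 2)%:E).

Definition sq f := \int[mu]_x (f x ^+ 2).
Definition ip f g := \int[mu]_x (f x * g x).

Lemma L2_integrableM f g : L2 f -> L2 g ->
  mu.-integrable setT (fun x => (f x * g x)%:E).
Proof.
move=> [mf If] [mg Ig].
have I : mu.-integrable setT (fun x => (f x ^+ 2)%:E + (g x ^+ 2)%:E)%E.
  exact: integrableD.
apply: (le_integrable _ _ _ I) => //.
  by apply/measurable_EFinP; exact: measurable_funM.
move=> x _ /=; rewrite lee_fin [leRHS]ger0_norm ?addr_ge0 ?sqr_ge0//.
have := @young_mul R (f x) (g x) 1 ltr01; rewrite invr1 !mul1r => /le_trans; apply.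
have := sqr_ge0 (f x); have := sqr_ge0 (g x); lra.
Qed.

Lemma L2Z a f : L2 f -> L2 (fun x => a * f x).
Proof.
move=> [mf If]; split; first exact: measurable_funM.
under eq_fun do rewrite exprMn EFinM.
exact: integrableZl.
Qed.

Lemma L2D f g : L2 f -> L2 g -> L2 (fun x => f x + g x).
Proof.
move=> Lf Lg; split; first by apply: measurable_funD; [exact: Lf.1|exact: Lg.1].
rewrite (_ : (fun=> _) = (fun x => (f x ^+ 2)%:E + (g x ^+ 2)%:E + 2%:E * (f x * g x)%:E)%E).
  apply: integrableD => //; last by apply: integrableZl => //; exact: L2_integrableM.
  by apply: integrableD => //; [exact: Lf.2|exact: Lg.2].
by apply/funext => x; rewrite -EFinM -!EFinD; congr (_%:E); ring.
Qed.

Lemma L2B f g : L2 f -> L2 g -> L2 (fun x => f x - g x).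
Proof.
move=> Lf Lg; have := L2D Lf (L2Z (-1) Lg).
by under eq_fun do rewrite mulN1r.
Qed.

Lemma sq_ge0 f : 0 <= sq f.
Proof. by apply: Rintegral_ge0 => x _; exact: sqr_ge0. Qed.

Lemma sqE f : sq f = ip f f. Proof. by []. Qed.

Lemma ipC f g : ip f g = ip g f.
Proof. by apply: eq_Rintegral => x _; rewrite mulrC. Qed.

Lemma ip_eq0 f g : (forall x, f x * g x = 0) -> ip f g = 0.
Proof.
move=> fg; transitivity (\int[mu]_(x in setT) (0 : R)).
  by apply: eq_Rintegral => x _.
by rewrite Rintegral_cst// mul0r.
Qed.

Lemma ipDl f g w : L2 f -> L2 g -> L2 w -> ip (fun x => f x + g x) w = ip f w + ip g w.
Proof.
move=> Lf Lg Lw; rewrite /ip -RintegralD//; try exact: L2_integrableM.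
by apply: eq_Rintegral => x _; rewrite mulrDl.
Qed.

Lemma ipZl a f w : L2 f -> L2 w -> ip (fun x => a * f x) w = a * ip f w.
Proof.
move=> Lf Lw; rewrite /ip -RintegralZl//; try exact: L2_integrableM.
by apply: eq_Rintegral => x _; rewrite mulrA.
Qed.

Lemma ipBl f g w : L2 f -> L2 g -> L2 w -> ip (fun x => f x - g x) w = ip f w - ip g w.
Proof.
move=> Lf Lg Lw; rewrite /ip -RintegralB//; try exact: L2_integrableM.
by apply: eq_Rintegral => x _; rewrite mulrBl.
Qed.

Lemma sqB f g : L2 f -> L2 g -> sq (fun x => f x - g x) = sq f + sq g - 2 * ip f g.
Proof.
move=> Lf Lg; have Lfg := L2B Lf Lg.
rewrite sqE ipBl// !(ipC _ (fun x => _ - _)) !ipBl// (ipC g f) -!sqE; ring.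
Qed.

Lemma sqD f g : L2 f -> L2 g -> sq (fun x => f x + g x) = sq f + sq g + 2 * ip f g.
Proof.
move=> Lf Lg; have Lfg := L2D Lf Lg.
rewrite sqE ipDl// !(ipC _ (fun x => _ + _)) !ipDl// (ipC g f) -!sqE; ring.
Qed.

Lemma L2_sqE f : L2 f -> (sq f)%:E = (\int[mu]_x (f x ^+ 2)%:E)%E.
Proof. by move=> Lf; rewrite [LHS]fineK//; apply: integrable_fin_num => //; exact: Lf.2. Qed.

Lemma L2_fin f : measurable_fun setT f ->
  (\int[mu]_x (f x ^+ 2)%:E < +oo)%E -> L2 f.
Proof.
move=> mf foo; split => //; apply/integrableP; split.
  by apply/measurable_EFinP; exact: measurable_funX.
by under eq_integral do rewrite gee0_abs ?lee_fin ?sqr_ge0//.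
Qed.

Lemma ip_young f g c : L2 f -> L2 g -> 0 < c ->
  `|ip f g| <= (c * sq f + c^-1 * sq g) / 2.
Proof.
move=> Lf Lg c0; apply: (le_trans (le_normr_Rintegral _ _)) => //.
  exact: L2_integrableM.
have If := integrableZl_EFin c Lf.2; have Ig := integrableZl_EFin c^-1 Lg.2.
have Ifg := integrableZl_EFin 2^-1 (integrableD_EFin If Ig).
rewrite /sq -!RintegralZl//; [|exact: Lg.2|exact: Lf.2].
rewrite -RintegralD// mulrC -RintegralZl//; last exact: integrableD_EFin.
apply: le_Rintegral => //.
  exact/integrable_norm/L2_integrableM.
by move=> x _; rewrite [leRHS]mulrC; exact: young_mul.
Qed.

Lemma sq_young f g c : L2 f -> L2 g -> 0 < c ->
  `|sq f - sq g| <= (1 + c) * sq (fun x => f x - g x) + c^-1 * sq g.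
Proof.
move=> Lf Lg c0.
have -> : sq f - sq g = sq (fun x => f x - g x) + 2 * ip (fun x => f x - g x) g.
  by rewrite sqB// ipBl// -sqE; ring.
apply: (le_trans (ler_normD _ _)); rewrite ger0_norm ?sq_ge0// normrM.
have := ip_young (L2B Lf Lg) Lg c0; rewrite (ger0_norm (ler0n _ 2)); lra.
Qed.

Lemma L2_Lfun f : f \in Lfun mu 2%:E -> L2 f.
Proof.
move=> Lf; split; last exact: Lfun2_integrable_sqr.
by move: Lf; rewrite inE => /andP[]; rewrite inE.
Qed.

End L2.

Lemma integral_sum_EFin d (T : measurableType d) (R : realType)
    (mu : {measure set T -> \bar R}) n (F : nat -> T -> R) :
  (forall j, measurable_fun setT (F j)) -> (forall j w, 0 <= F j w) ->
  (\int[mu]_w (\sum_(j < n) F j w)%:E = \sum_(j < n) \int[mu]_w (F j w)%:E)%E.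
Proof.
move=> mF F0; under eq_integral do rewrite -sumEFin.
rewrite ge0_integral_sum//.
- by move=> j; exact/measurable_EFinP.
- by move=> j w _; rewrite lee_fin.
Qed.

(** * Mean value inequality and lower limits *)

Section calculus.
Context (R : realType).
Implicit Types (F G : R -> R) (e s t : R).

Lemma is_derive1_cvg F t l :
  (F (t + h) - F t) / h @[h --> 0^'] --> l -> is_derive t 1 F l.
Proof.
move=> cF.
have cF' : h^-1 *: ((F \o shift t) (h *: 1) - F t) @[h --> 0^'] --> l.
  apply: cvg_trans cF; apply: near_eq_cvg; near=> h.
  by rewrite /= [h *: 1]mulr1 [h + t]addrC [_ *: _]mulrC.
by apply: DeriveDef; [exact: cvgP cF'|exact/cvg_lim].
Unshelve. all: by end_near. Qed.

(** Uniform continuity on the unit segment; the second point need not lie in it. *)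
Lemma segment_unif_continuous G e : 0 < e ->
  (forall s, s \in `[0, 1] -> {for s, continuous G}) ->
  \forall m \near \oo, forall s t, s \in `[0, 1] ->
    `|t - s| <= m.+1%:R^-1 -> `|G t - G s| <= e.
Proof.
move=> e0 cG.
have /compact_near_coveringP/(_ nat \oo (fun m s => forall t,
    `|t - s| <= m.+1%:R^-1 -> `|G t - G s| <= e)) := @segment_compact R 0 1.
move=> /(_ (@eventually_filter)) H; apply: filterS (H _) => {H}.
- by move=> /= m Pm s t s01; apply: Pm; rewrite /= in s01 *.
- move=> s s01.
  have e20 : 0 < e / 2 by rewrite divr_gt0.
  have /cvgrPdist_lt /(_ _ e20) /nbhs_ballP[dlt /= dlt0 Hd] := cG s s01.
  have dlt2 : 0 < dlt / 2 by rewrite divr_gt0.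
  near=> s' m => /= t ts.
  have ss' : `|s - s'| < dlt / 2.
    by near: s'; exact: nbhsx_ballx.
  have md : m.+1%:R^-1 < dlt / 2.
    by near: m; exact: near_infty_natSinv_lt (PosNum dlt2).
  have /Hd h1 : ball s dlt s' by rewrite /ball/= (lt_trans ss')// ltr_pdivrMr// ltr_pMr// ltr1n.
  have /Hd h2 : ball s dlt t.
    rewrite /ball/= distrC (le_lt_trans (ler_distD s' _ _))// [dlt]splitr.
    by rewrite ltrD// ?(le_lt_trans ts)// distrC.
  rewrite (le_trans (ler_distD (G s) _ _))// [leRHS]splitr.
  by rewrite distrC lerD// ltW.
Unshelve. all: by end_near. Qed.

Lemma mean_value F F' a b : a < b ->
  (forall s, s \in `[a, b] -> is_derive s 1 F (F' s)) ->
  exists2 c, c \in `[a, b] & F b - F a = F' c * (b - a).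
Proof.
move=> ab dF.
have cF : {within `[a, b], continuous F}.
  by apply: derivable_within_continuous => s sx; have [] := dF s sx.
have [c cab E] := @MVT R F F' a b ab (fun s sab => dF s (subset_itv_oo_cc sab)) cF.
by exists c => //; exact: subset_itv_oo_cc cab.
Qed.

(** Only an upper bound [G] of the derivative has to be continuous: the mean value
    inequality is applied on each interval of the grid. *)
Lemma increment_le_mean F F' G e : 0 < e ->
  (forall s, s \in `[0, 1] -> is_derive s 1 F (F' s)) ->
  (forall s, s \in `[0, 1] -> {for s, continuous G}) ->
  (forall s, s \in `[0, 1] -> F' s <= G s) ->
  \forall m \near \oo,
    F 1 - F 0 <= m.+1%:R^-1 * (\sum_(k < m.+1) G (k%:R / m.+1%:R)) + e.
Proof.
move=> e0 dF cG F'G.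
near=> m.
have Gm : forall s t, s \in `[0, 1] ->
    `|t - s| <= m.+1%:R^-1 -> `|G t - G s| <= e.
  by near: m; exact: segment_unif_continuous.
pose x k : R := k%:R / m.+1%:R.
have m0 : 0 < m.+1%:R :> R by rewrite ltr0n.
have x01 k : (k <= m.+1)%N -> x k \in `[0, 1].
  by move=> km; rewrite in_itv/= divr_ge0//= ler_pdivrMr// mul1r ler_nat.
have x_sub s k : (k < m.+1)%N -> s \in `[x k, x k.+1] -> s \in `[0, 1].
  move=> km; rewrite !in_itv/= => /andP[s1 s2].
  have := x01 _ km; have := x01 _ (ltnW km); rewrite !in_itv/= => /andP[a1 _] /andP[_ a2].
  by rewrite (le_trans a1)//= (le_trans s2).
have dx k : x k.+1 - x k = m.+1%:R^-1.
  by rewrite /x -mulrBl -natrB// subSnn mul1r.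
have xlt k : x k < x k.+1 by rewrite -subr_gt0 dx invr_gt0.
have step (k : 'I_m.+1) : F (x k.+1) - F (x k) <= m.+1%:R^-1 * (G (x k) + e).
  have [c cx E] := mean_value (xlt k) (fun s sx => dF s (x_sub s k (ltn_ord k) sx)).
  rewrite E dx mulrC ler_pM2l ?invr_gt0//.
  have c01 : c \in `[0, 1] by apply: (x_sub _ k) => //; exact: cx.
  apply: (le_trans (F'G _ c01)); rewrite -lerBlDl.
  apply: (le_trans (ler_norm _)); apply: Gm; first exact: x01 (ltnW (ltn_ord k)).
  have /andP[cx1 cx2] : x k <= c <= x k.+1 by have := cx; rewrite in_itv.
  by rewrite ger0_norm ?subr_ge0// -(dx k) lerD2r.
have -> : F 1 - F 0 = \sum_(k < m.+1) (F (x k.+1) - F (x k)).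
  rewrite -(big_mkord xpredT (fun k => F (x k.+1) - F (x k))) telescope_sumr//.
  by rewrite /x divff ?gt_eqF// mul0r.
apply: (le_trans (ler_sum _ (fun k _ => step k))).
rewrite -mulr_sumr big_split/= mulrDr lerD2l sumr_const card_ord.
by rewrite -[X in _ * X]mulr_natr mulrCA mulVf ?gt_eqF// mulr1.
Unshelve. all: by end_near. Qed.

Lemma le_limn_einf (L : R) (u : nat -> R) :
  (forall e, 0 < e -> \forall m \near \oo, L <= u m + e) ->
  (L%:E <= limn_einf (EFin \o u))%E.
Proof.
move=> H; apply/lee_subgt0Pr => e e0; have := H e e0; case=> N _ HN.
rewrite limn_einf_lim; apply: lime_ge; first exact: is_cvg_einfs.
exists N => // n /= Nn; apply: le_ereal_inf_tmp => _ [m /= nm <-].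
by rewrite -EFinB lee_fin lerBlDr HN//= (leq_trans Nn).
Qed.

Lemma limn_einf_le (M : \bar R) (u : nat -> \bar R) :
  (forall m, u m <= M)%E -> (limn_einf u <= M)%E.
Proof.
move=> uM; rewrite limn_einf_lim; apply: lime_le; first exact: is_cvg_einfs.
apply: nearW => n; apply: le_trans (uM n).
by apply: ereal_inf_lbound; exists n => /=.
Qed.

End calculus.

(** * Differentiable curves of square-integrable functions *)

Section L2_curve.
Context d (T : measurableType d) (R : realType) (mu : {measure set T -> \bar R}).
(* [q] is the L2-derivative of the curve [s], and is continuous in L2. *)
Variables (Theta : set R) (s q : R -> T -> R).
Hypothesis oTheta : open Theta.
Hypothesis Ls : forall t, Theta t -> L2 mu (s t).
Hypothesis Lq : forall t, Theta t -> L2 mu (q t).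
Hypothesis ds : forall t, Theta t ->
  sq mu (fun y => (s (t + h) y - s t y) / h - q t y) @[h --> 0^'] --> (0 : R).
Hypothesis cq : forall t, Theta t ->
  sq mu (fun y => q t' y - q t y) @[t' --> t] --> (0 : R).

Lemma near_Theta_dnbhs t : Theta t -> \forall h \near (0 : R)^', Theta (t + h).
Proof.
move=> Tt.
have cD : t + h @[h --> (0 : R)] --> t.
  by rewrite -[X in _ --> X]addr0; apply: cvgD; [exact: cvg_cst|exact: cvg_id].
have nT : nbhs t Theta by exact: open_nbhs_nbhs.
by apply: cvg_within; exact: cD nT.
Qed.

(** A curve differentiable in L2 is weakly differentiable. *)
Lemma ip_is_derive t (w : T -> R) : Theta t -> L2 mu w ->
  is_derive t 1 (fun t' => ip mu (s t') w) (ip mu (q t) w).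
Proof.
move=> Tt Lw; apply: is_derive1_cvg.
apply/subr_cvg0; apply: (@cvg_young _ _ _ _ _
  (fun h => sq mu (fun y => (s (t + h) y - s t y) / h - q t y))
  (fun=> sq mu w) (sq mu w) 0) => //; [|exact: ds|exact: cvg_cst].
move=> c c0; near=> h.
have Tth : Theta (t + h) by near: h; exact: near_Theta_dnbhs.
have LB := L2B (Ls Tth) (Ls Tt).
have -> : (fun y => (s (t + h) y - s t y) / h - q t y) =
    (fun y => h^-1 * (s (t + h) y - s t y) - q t y).
  by apply/funext => y; rewrite mulrC.
rewrite -(ipBl (Ls Tth) (Ls Tt) Lw) mulrC -(ipZl _ LB Lw).
have LZ := L2Z h^-1 LB.
rewrite -(ipBl LZ (Lq Tt) Lw).
apply: (le_trans (ip_young (L2B LZ (Lq Tt)) Lw c0)).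
rewrite add0r ler_pdivrMr// mulr_natr mulr2n ler_wpDl//.
by rewrite addr_ge0// mulr_ge0 ?sq_ge0// ltW// invr_gt0.
Unshelve. all: by end_near. Qed.

Lemma ball_Theta t : Theta t -> exists2 e, 0 < e & forall u, u \in `]t - e, t + e[ -> Theta u.
Proof.
move=> Tt; have /nbhs_ballP[e /= e0 He] : nbhs t Theta by exact: open_nbhs_nbhs.
exists e => // u; rewrite in_itv/= => /andP[u1 u2]; apply: He.
by rewrite /ball/= ltr_norml; apply/andP; split; lra.
Qed.

Lemma ip_derive_max t (w : T -> R) : Theta t -> L2 mu w ->
  (forall u, Theta u -> ip mu (s u) w <= ip mu (s t) w) -> ip mu (q t) w = 0.
Proof.
move=> Tt Lw wmax; have [e e0 He] := ball_Theta Tt.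
have tin : t \in `]t - e, t + e[ by rewrite in_itv/=; apply/andP; split; lra.
have D1 := ip_is_derive Tt Lw.
have D0 : is_derive t 1 (fun t' => ip mu (s t') w) 0.
  apply: (@derive1_at_max _ _ (t - e) (t + e)) => //; first lra.
    by move=> u /He Tu; have [] := ip_is_derive Tu Lw.
  by move=> u /He; exact: wmax.
by rewrite -(@derive_val _ _ _ _ _ _ _ D1) (@derive_val _ _ _ _ _ _ _ D0).
Qed.

Lemma ip_derive_min t (w : T -> R) : Theta t -> L2 mu w ->
  (forall u, Theta u -> ip mu (s t) w <= ip mu (s u) w) -> ip mu (q t) w = 0.
Proof.
move=> Tt Lw wmin.
have Lw' := L2Z (-1) Lw.
have E u : Theta u -> ip mu (s u) (fun x => -1 * w x) = - ip mu (s u) w.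
  by move=> Tu; rewrite ipC (ipZl _ Lw (Ls Tu)) ipC mulN1r.
have : ip mu (q t) (fun x => -1 * w x) = 0.
  by apply: ip_derive_max => // u Tu; rewrite !E// lerN2 wmin.
by rewrite ipC (ipZl _ Lw (Lq Tt)) ipC mulN1r => /eqP; rewrite oppr_eq0 => /eqP.
Qed.

(** The inner product of s(u) with s(t) is maximal at u = t. *)
Lemma ip_derive_unit t : Theta t -> (forall u, Theta u -> sq mu (s u) = 1) ->
  ip mu (q t) (s t) = 0.
Proof.
move=> Tt s1; apply: (ip_derive_max Tt (Ls Tt)) => u Tu.
rewrite -sqE s1//; apply: (le_trans (ler_norm _)).
apply: (le_trans (ip_young (Ls Tu) (Ls Tt) ltr01)).
by rewrite invr1 !mul1r !s1//; lra.
Qed.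

Lemma L2_bounded_mul f (b : T -> R) : measurable_fun setT b ->
  (forall x, `|b x| <= 1) -> L2 mu f -> L2 mu (fun x => b x * f x).
Proof.
move=> mb b1 [mf If]; split; first exact: measurable_funM.
apply: (le_integrable _ _ _ If) => //.
  by apply/measurable_EFinP; apply: measurable_funX; exact: measurable_funM.
move=> x _; rewrite !abse_EFin lee_fin !normrX normrM exprMn.
by rewrite ler_piMl ?exprn_ge0// expr_le1.
Qed.

Lemma measurable_fun_eq0 (f : T -> R) : measurable_fun setT f ->
  measurable_fun setT (fun x => (f x == 0)%:R : R).
Proof.
move=> mf; rewrite (_ : (fun x => _) = \1_(f @^-1` [set 0])).
  apply: measurable_indic; rewrite -[X in measurable X]setTI; exact: mf.
apply/funext => x; rewrite indicE; congr ((nat_of_bool _)%:R); apply/esym.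
by apply/idP/eqP => [/set_mem//|fx]; exact/mem_set.
Qed.

(** Where a nonnegative curve vanishes at time [t], it is minimal, so that its
    derivative vanishes there almost everywhere.  This is tested against the positive
    and the negative part of [q t] restricted to the zero set of [s t]. *)
Lemma sq_derive_support t : Theta t -> (forall u x, Theta u -> 0 <= s u x) ->
  sq mu (q t) = sq mu (fun x => (s t x != 0)%:R * q t x).
Proof.
move=> Tt s0.
have [mq _] := Lq Tt; have [ms _] := Ls Tt.
pose Z x : R := (s t x == 0)%:R.
have mZ : measurable_fun setT Z by exact: measurable_fun_eq0.
have Z1 x : `|Z x| <= 1 by rewrite /Z; case: eqP; rewrite ?normr1// normr0.
have LZ := L2_bounded_mul mZ Z1.
have zero w : L2 mu w -> (forall x, 0 <= w x) -> ip mu (q t) (fun x => Z x * w x) = 0.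
  move=> Lw w0; apply: ip_derive_min => //; first exact: LZ.
  move=> u Tu; rewrite [leLHS](_ : _ = 0).
    by apply: Rintegral_ge0 => x _; rewrite !mulr_ge0// ?s0// /Z.
  by apply: ip_eq0 => x; rewrite /Z; case: eqP => [->|_]; rewrite ?mul0r// mulr0.
have Lpos : L2 mu (fun x => Num.max (q t x) 0).
  split; first exact: measurable_funrpos.
  apply: (le_integrable _ _ _ (Lq Tt).2) => //.
    by apply/measurable_EFinP; apply: measurable_funX; exact: measurable_funrpos.
  move=> x _; rewrite !abse_EFin lee_fin !normrX.
  rewrite ler_sqr ?nnegrE//; case: (leP (q t x) 0) => // _; by rewrite normr0.
have := zero _ Lpos; rewrite -/(ip _ _ _) => /(_ _) h1.
have {}h1 : ip mu (q t) (fun x => Z x * Num.max (q t x) 0) = 0.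
  by apply: h1 => x; rewrite le_max lexx orbT.
have Lneg : L2 mu (fun x => Num.max (q t x) 0 - q t x).
  exact: (L2B Lpos (Lq Tt)).
have h2 : ip mu (q t) (fun x => Z x * (Num.max (q t x) 0 - q t x)) = 0.
  by apply: zero => // x; rewrite subr_ge0 le_max lexx.
have h : ip mu (q t) (fun x => Z x * q t x) = 0.
  have -> : (fun x => Z x * q t x) = (fun x => Z x * Num.max (q t x) 0 -
      Z x * (Num.max (q t x) 0 - q t x)).
    by apply/funext => x; ring.
  by rewrite ipC (ipBl (LZ _ Lpos) (LZ _ Lneg) (Lq Tt)) !(ipC _ _ (q t)) h1 h2 subr0.
have LZq := LZ _ (Lq Tt).
have -> : (fun x => (s t x != 0)%:R * q t x) = (fun x => q t x - Z x * q t x).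
  by apply/funext => x; rewrite /Z; case: eqP => _ /=; ring.
rewrite (sqB (Lq Tt) LZq) h mulr0 subr0.
suff -> : sq mu (fun x => Z x * q t x) = 0 by rewrite addr0.
rewrite -h; apply: eq_Rintegral => x _.
by rewrite /Z; case: eqP => _; rewrite ?mul1r// !mul0r expr0n mulr0.
Qed.

Lemma sq_derive_continuous t0 t : Theta t0 -> Theta t ->
  sq mu (fun y => q t' y - q t0 y) @[t' --> t] --> sq mu (fun y => q t y - q t0 y).
Proof.
move=> Tt0 Tt; apply/subr_cvg0.
apply: (@cvg_young _ _ _ _ _ (fun t' => sq mu (fun y => q t' y - q t y))
  (fun=> sq mu (fun y => q t y - q t0 y)) _ 1); [|exact: cq|exact: cvg_cst].
have nT : nbhs t Theta by exact: open_nbhs_nbhs.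
move=> c c0; near=> t'.
have Tt' : Theta t' by near: t'; exact: nT.
have -> : (fun y => q t' y - q t y) =
    (fun y => (q t' y - q t0 y) - (q t y - q t0 y)).
  by apply/funext => y; ring.
by apply: sq_young => //; apply: L2B; exact: Lq.
Unshelve. all: by end_near. Qed.

(** First-order Taylor formula with integral remainder, with a Riemann sum in place of
    the integral.  With D the remainder, F is the inner product with D of the curve minus
    its tangent, so that F 1 - F 0 is the squared norm of D, and the derivative of F is
    at most half the sum of this squared norm and of the integrand. *)
Lemma sq_taylor (t0 a e : R) : 0 < e -> (forall u, u \in `[0, 1] -> Theta (t0 + u * a)) ->
  \forall m \near \oo,
    sq mu (fun y => s (t0 + a) y - s t0 y - a * q t0 y) <=
    m.+1%:R^-1 * (\sum_(k < m.+1)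
      a ^+ 2 * sq mu (fun y => q (t0 + k%:R / m.+1%:R * a) y - q t0 y)) + e.
Proof.
move=> e0 HT.
have Tt0 : Theta t0 by rewrite -[t0]addr0 -(mul0r a); apply: HT; rewrite in_itv/= lexx ler01.
have Tt1 : Theta (t0 + a) by rewrite -(mul1r a); apply: HT; rewrite in_itv/= lexx ler01.
pose D y := s (t0 + a) y - s t0 y - a * q t0 y.
have LD : L2 mu D by exact: (L2B (L2B (Ls Tt1) (Ls Tt0)) (L2Z a (Lq Tt0))).
pose N u := sq mu (fun y => q (t0 + u * a) y - q t0 y).
pose F u := ip mu (s (t0 + u * a)) D - u * (a * ip mu (q t0) D).
pose F' u := ip mu (q (t0 + u * a)) D * a - a * ip mu (q t0) D.
pose G u := (a ^+ 2 * N u + sq mu D) / 2.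
have F'G u : u \in `[0, 1] -> F' u <= G u.
  move=> /HT Tu.
  have LB := L2B (Lq Tu) (Lq Tt0).
  rewrite /F' [X in X - _]mulrC -mulrBr -(ipBl (Lq Tu) (Lq Tt0) LD).
  rewrite -(ipZl _ LB LD); apply: (le_trans (ler_norm _)).
  apply: (le_trans (ip_young (L2Z a LB) LD ltr01)).
  rewrite invr1 !mul1r /G /N.
  rewrite [X in X + _](_ : _ = a ^+ 2 * sq mu (fun y => q (t0 + u * a) y - q t0 y))//.
  rewrite /sq -RintegralZl//; last exact: LB.2.
  by apply: eq_Rintegral => y _; rewrite exprMn.
have e20 : 0 < e / 2 by rewrite divr_gt0.
have := @increment_le_mean _ F F' G (e / 2) e20 _ _ F'G.
have FD : F 1 - F 0 = sq mu D.
  rewrite /F mul1r mul0r mul1r mul0r addr0 subr0 sqE {3}/D.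
  rewrite (ipBl (L2B (Ls Tt1) (Ls Tt0)) (L2Z a (Lq Tt0)) LD).
  rewrite (ipBl (Ls Tt1) (Ls Tt0) LD) (ipZl a (Lq Tt0) LD); ring.
rewrite FD => H.
have {}H : \forall m \near \oo, sq mu D <=
    m.+1%:R^-1 * (\sum_(k < m.+1) G (k%:R / m.+1%:R)) + e / 2.
  apply: H => u /HT Tu.
    have lin : is_derive u 1 (fun v : R => t0 + v * a) a.
      apply: is_derive1_cvg; apply: cvg_near_cst; near=> h => /=.
      rewrite opprD addrACA subrr add0r -mulrBl addrAC subrr add0r mulrC mulKf//.
      by near: h; exact: nbhs_dnbhs_neq.
    have D1 := @is_derive1_comp R (fun t => ip mu (s t) D) (fun v => t0 + v * a)
      u _ _ (ip_is_derive Tu LD) lin.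
    have lin2 : is_derive u 1 (fun v : R => v * (a * ip mu (q t0) D)) (a * ip mu (q t0) D).
      apply: is_derive1_cvg; apply: cvg_near_cst; near=> h => /=.
      by rewrite -mulrBl addrAC subrr add0r mulrC mulKf//; near: h; exact: nbhs_dnbhs_neq.
    exact: is_deriveB.
  have clin : t0 + v * a @[v --> u] --> t0 + u * a.
    by apply: cvgD; [exact: cvg_cst|apply: cvgMl; exact: cvg_id].
  have cN : N v @[v --> u] --> N u.
    exact: (cvg_comp _ _ clin (sq_derive_continuous Tt0 Tu)).
  apply: cvgMl; apply: cvgD; last exact: cvg_cst.
  by apply: cvgMr.
apply: filterS H => m Hm.
have m0 : (m.+1%:R : R) != 0 by rewrite pnatr_eq0.
have EG : m.+1%:R^-1 * (\sum_(k < m.+1) G (k%:R / m.+1%:R)) =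
    (m.+1%:R^-1 * (\sum_(k < m.+1) a ^+ 2 * N (k%:R / m.+1%:R)) + sq mu D) / 2.
  rewrite /G -mulr_suml big_split/= sumr_const card_ord -[_ *+ m.+1]mulr_natr.
  by field.
suff : sq mu D <=
  m.+1%:R^-1 * (\sum_(k < m.+1) a ^+ 2 * N (k%:R / m.+1%:R)) + e by [].
move: Hm; rewrite EG.
move: (sq mu D) (m.+1%:R^-1 * \sum_(k < m.+1) a ^+ 2 * N _) => x y; lra.
Unshelve. all: by end_near. Qed.

End L2_curve.

(** * One step of the chain and martingale sums *)

Lemma measurable_fun_integral_snd d1 d2 (T1 : measurableType d1)
    (T2 : measurableType d2) (R : realType)
    (la : {sigma_finite_measure set T2 -> \bar R}) (f : T1 * T2 -> \bar R) :
  measurable_fun setT f -> (forall z, 0 <= f z)%E ->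
  measurable_fun setT (fun x => \int[la]_y f (x, y))%E.
Proof.
move=> mf f0; exact: (measurable_fun_fubini_tonelli_F _ mf f0).
Qed.

Lemma measurable_fun_Rintegral d1 d2 (T1 : measurableType d1)
    (T2 : measurableType d2) (R : realType)
    (la : {sigma_finite_measure set T2 -> \bar R}) (f : T1 * T2 -> R) :
  measurable_fun setT f -> measurable_fun setT (fun x => \int[la]_y f (x, y)).
Proof.
move=> mf; have mEf : measurable_fun setT (EFin \o f) by exact/measurable_EFinP.
rewrite (_ : (fun=> _) = fine \o (fun x => \int[la]_y (EFin \o f)^\+ (x, y)
    - \int[la]_y (EFin \o f)^\- (x, y))%E).
  apply: measurableT_comp => //; apply: emeasurable_funB.
    apply: (@measurable_fun_integral_snd _ _ _ _ _ la (EFin \o f)^\+%E) => //.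
    exact: measurable_funepos.
  apply: (@measurable_fun_integral_snd _ _ _ _ _ la (EFin \o f)^\-%E) => //.
  exact: measurable_funeneg.
apply/funext => x; rewrite /Rintegral integralE/=.
by congr (fine (_ - _)%E); apply: eq_integral => y _; rewrite ?funeposE ?funenegE.
Qed.

Lemma measurable_fun_comp2 d0 d1 d2 d3 (T : measurableType d0)
    (T1 : measurableType d1) (T2 : measurableType d2) (T3 : measurableType d3)
    (f : T1 -> T2 -> T3) (a : T -> T1) (b : T -> T2) :
  measurable_fun setT (fun z => f z.1 z.2) ->
  measurable_fun setT a -> measurable_fun setT b ->
  measurable_fun setT (fun z => f (a z) (b z)).
Proof.
move=> mf ma mb.
exact: (@measurableT_comp _ _ _ _ _ _ (fun z => f z.1 z.2) _ (fun z => (a z, b z))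
  mf (measurable_fun_pair ma mb)).
Qed.

Section markov_step.
Context (R : realType) (E : pointedMetricType R).
Context dO (Omega : measurableType dO).
Variables (Theta : set R) (P : R -> E -> probability Omega R).
Variable X : R -> {mfun Omega >-> borel E}.
Variable lambda : {sigma_finite_measure set (borel E) -> \bar R}.
Variables (h : R) (p : R -> E -> E -> R).
Hypothesis h0 : 0 < h.
Hypothesis mkv : markov_family Theta P X.
Hypothesis pd : transition_density Theta P X lambda h p.
Variables (t : R) (x : E).
Hypothesis Tt : Theta t.

(** The events which generate [past X s]. *)
Definition past_gen (s : R) : set (set Omega) :=
  [set A | exists u B, [/\ 0 <= u <= s, measurable B & A = X u @^-1` B] ].

Lemma past_gen_measurable s : past_gen s `<=` measurable.
Proof.
move=> A [u [B [_ mB ->]]]; rewrite -[X in measurable X]setTI.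
exact: (measurable_funP (X u)).
Qed.

(* [Omega] with the sigma-algebra of the past before [s]. *)
Local Notation F s := (g_sigma_algebraType (past_gen s)).

Lemma measurable_past s (A : set Omega) : (@measurable _ (F s)) A -> measurable A.
Proof.
apply: smallest_sub; first exact: sigma_algebra_measurable.
exact: past_gen_measurable.
Qed.

(** The identity of [Omega], as a random variable with values in the past. *)
Definition past_id s : Omega -> F s := id.

Lemma measurable_past_id s : measurable_fun setT (@past_id s).
Proof. by move=> _ A mA; rewrite setTI; exact: measurable_past mA. Qed.

HB.instance Definition _ s :=
  isMeasurableFun.Build _ _ _ _ (@past_id s) (@measurable_past_id s).

Lemma measurable_X_past u s : 0 <= u <= s ->
  measurable_fun setT (X u : F s -> borel E).
Proof.
move=> us _ B mB; rewrite setTI; apply: sub_sigma_algebra.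
by exists u, B.
Qed.

Lemma p_ge0 y z : 0 <= p t y z.
Proof. exact: (transition_density_ge0 pd). Qed.

Lemma measurable_p :
  measurable_fun setT (fun z : borel E * borel E => p t z.1 z.2).
Proof. exact: (transition_density_measurable pd). Qed.

(** Conditionally on the past before [s], the state at time [s + h] has the density
    [p t (X s w)]. *)
Lemma markov_step_integral s (f : F s * borel E -> \bar R) : 0 <= s ->
  (forall z, 0 <= f z)%E -> measurable_fun setT f ->
  (\int[P t x]_w f (w, X (s + h) w) =
   \int[P t x]_w \int[lambda]_y (f (w, y) * (p t (X s w) y)%:E))%E.
Proof.
move=> s0 f0 mf.
have mXs : measurable_fun setT (X s : F s -> borel E).
  by apply: measurable_X_past; rewrite s0 lexx.
apply: (@integral_disintegration _ _ _ Omega (F s) (borel E) R (P t x) lambda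
  (@past_id s) (X (s + h)) (fun w y => p t (X s w) y) _ _ _ f f0 mf).
- by move=> *; exact: p_ge0.
- apply: (@measurable_fun_comp2 _ _ _ _ (F s * borel E)%type (borel E) (borel E) _
    (p t) (fun z => X s z.1) snd) => //; first exact: measurable_p.
  exact: measurableT_comp.
- move=> A B mA mB; rewrite /= (markov_property mkv) ?(ltW h0)//.
  by apply: eq_integral => w _; rewrite (transition_densityE pd).
Qed.

(** The integrability of [f (w, X (s + h) w)] is not needed: its positive and negative
    parts have the same integral, possibly infinite. *)
Lemma markov_step_centered s (f : F s * borel E -> R) : 0 <= s ->
  measurable_fun setT f ->
  (forall w, lambda.-integrable setT (fun y => (f (w, y) * p t (X s w) y)%:E)) ->
  (forall w, \int[lambda]_y (f (w, y) * p t (X s w) y) = 0) ->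
  \int[P t x]_w f (w, X (s + h) w) = 0.
Proof.
move=> s0 mf Ip Ip0; rewrite /Rintegral.
have mEf : measurable_fun setT (EFin \o f) by exact/measurable_EFinP.
have EP : (\int[P t x]_w (fun w => (f (w, X (s + h) w))%:E)^\+ w =
    \int[P t x]_w \int[lambda]_y ((EFin \o f)^\+ (w, y) * (p t (X s w) y)%:E))%E.
  rewrite -(markov_step_integral s0 (fun z => funepos_ge0 (EFin \o f) z) (measurable_funepos mEf)).
  by apply: eq_integral => w _; rewrite !funeposE.
have EN : (\int[P t x]_w (fun w => (f (w, X (s + h) w))%:E)^\- w =
    \int[P t x]_w \int[lambda]_y ((EFin \o f)^\- (w, y) * (p t (X s w) y)%:E))%E.
  rewrite -(markov_step_integral s0 (fun z => funeneg_ge0 (EFin \o f) z) (measurable_funeneg mEf)).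
  by apply: eq_integral => w _; rewrite !funenegE.
rewrite integralE EP EN.
have -> : (\int[P t x]_w \int[lambda]_y ((EFin \o f)^\+ (w, y) * (p t (X s w) y)%:E) =
    \int[P t x]_w \int[lambda]_y ((EFin \o f)^\- (w, y) * (p t (X s w) y)%:E))%E.
  apply: eq_integral => w _.
  pose g y := (f (w, y) * p t (X s w) y)%:E.
  have gP y : ((EFin \o f)^\+ (w, y) * (p t (X s w) y)%:E = g^\+ y)%E.
    by rewrite !funeposE /g /= -!EFin_max -EFinM maxr_pMl ?p_ge0// mul0r.
  have gN y : ((EFin \o f)^\- (w, y) * (p t (X s w) y)%:E = g^\- y)%E.
    by rewrite !funenegE /g /= -!EFin_max -EFinM maxr_pMl ?p_ge0// mul0r mulNr.
  under eq_integral do rewrite gP.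
  under [RHS]eq_integral do rewrite gN.
  have fP := integrable_pos_fin_num measurableT (Ip w).
  have fN := integrable_neg_fin_num measurableT (Ip w).
  have := Ip0 w; rewrite /Rintegral integralE fineB// => /subr0_eq eqPN.
  by rewrite -[LHS]fineK// -[RHS]fineK//; congr EFin.
set I := (\int[_]_w _)%E; case: I => //= r; by rewrite subrr.
Qed.

Local Notation Q := (P t x).
Local Notation Xn := (sample X h).
(** The square root of the transition density, of norm one in L2 for every state. *)
Definition rootp (y z : E) : R := Num.sqrt (p t y z).
Local Notation rp := rootp.

Lemma rootpK y z : rp y z * rp y z = p t y z.
Proof. by rewrite -expr2 sqr_sqrtr ?p_ge0. Qed.

Lemma measurable_rootp :
  measurable_fun setT (fun z : borel E * borel E => rp z.1 z.2).
Proof.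
have msq : measurable_fun setT (@Num.sqrt R).
  by apply: continuous_measurable_fun; exact: sqrt_continuous.
exact: (measurableT_comp msq measurable_p).
Qed.

Lemma integral_rootp_sqr y : (\int[lambda]_z (rp y z ^+ 2)%:E = 1)%E.
Proof.
under eq_integral do rewrite sqr_sqrtr ?p_ge0//.
by rewrite -(transition_densityE pd)// preimage_setT probability_setT.
Qed.

Lemma L2_rootp y : L2 lambda (rp y : borel E -> R).
Proof.
apply: L2_fin; last by rewrite integral_rootp_sqr ltry.
exact: (@measurable_fun_comp2 _ _ _ _ (borel E) (borel E) (borel E) _
  rp (cst y) id measurable_rootp).
Qed.

Lemma sq_rootp y : sq lambda (rp y : borel E -> R) = 1.
Proof. by rewrite /sq /Rintegral integral_rootp_sqr. Qed.

Lemma sampleS j w : Xn j.+1 w = X (h * j%:R + h) w.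
Proof. by rewrite /sample -{3}[h]mulr1 -mulrDr -natr1. Qed.

Lemma hn_ge0 j : 0 <= h * j%:R.
Proof. by rewrite mulr_ge0// ltW. Qed.

Lemma measurable_sample_past i n : (i <= n)%N ->
  measurable_fun setT (Xn i : F (h * n%:R) -> borel E).
Proof.
by move=> ij; apply: measurable_X_past; rewrite hn_ge0/= ler_wpM2l ?ler_nat// ltW.
Qed.

Lemma chain_integral (f : borel E -> borel E -> \bar R) j :
  (forall y z, 0 <= f y z)%E ->
  measurable_fun setT (fun z : borel E * borel E => f z.1 z.2) ->
  (\int[Q]_w f (Xn j w) (Xn j.+1 w) =
   \int[Q]_w \int[lambda]_y (f (Xn j w) y * (p t (Xn j w) y)%:E))%E.
Proof.
move=> f0 mf.
under eq_integral do rewrite sampleS.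
apply: (markov_step_integral (f := fun z => f (X (h * j%:R) z.1) z.2)) => //.
  exact: hn_ge0.
apply: (@measurable_fun_comp2 _ _ _ _ (F (h * j%:R) * borel E)%type (borel E) (borel E) _
    f (fun z => X (h * j%:R) z.1) snd) => //.
by apply: measurableT_comp => //; exact: (measurable_sample_past (leqnn j)).
Qed.

Section centering.
Variable phi : borel E -> borel E -> R.
Hypothesis mphi : measurable_fun setT (fun z : borel E * borel E => phi z.1 z.2).
Hypothesis L2phi : forall y, L2 lambda (fun z => phi y z * rp y z).

(** The mean of [phi y] under the transition probability from [y], written as an inner
    product of square-integrable functions. *)
Definition cond_mean (y : E) : R := ip lambda (fun z => phi y z * rp y z) (rp y).
Local Notation psi := (fun y z => phi y z - cond_mean y).

Lemma measurable_cond_mean : measurable_fun setT (cond_mean : borel E -> R).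
Proof.
rewrite (_ : cond_mean = fun y => \int[lambda]_z (phi y z * p t y z)).
  apply: (@measurable_fun_Rintegral _ _ (borel E) (borel E) R lambda
    (fun z => phi z.1 z.2 * p t z.1 z.2)).
  exact: measurable_funM mphi measurable_p.
apply/funext => y; apply: eq_Rintegral => z _.
by rewrite -mulrA rootpK.
Qed.

Lemma measurable_centered :
  measurable_fun setT (fun z : borel E * borel E => psi z.1 z.2).
Proof.
apply: measurable_funB => //; apply: measurableT_comp => //.
exact: measurable_cond_mean.
Qed.

Lemma L2_centered y : L2 lambda (fun z => psi y z * rp y z).
Proof.
have := L2B (L2phi y) (L2Z (cond_mean y) (L2_rootp y)).
by under eq_fun do rewrite -mulrBl.
Qed.

Lemma ip_centered y : ip lambda (fun z => psi y z * rp y z) (rp y) = 0.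
Proof.
have -> : (fun z => psi y z * rp y z) =
    (fun z => phi y z * rp y z - cond_mean y * rp y z).
  by apply/funext => z; rewrite mulrBl.
rewrite (ipBl (L2phi y) (L2Z (cond_mean y) (L2_rootp y)) (L2_rootp y)).
by rewrite (ipZl _ (L2_rootp y) (L2_rootp y)) -sqE sq_rootp mulr1 subrr.
Qed.

(** The conditional variance is at most the conditional second moment. *)
Lemma sq_centered y :
  sq lambda (fun z => psi y z * rp y z) <= sq lambda (fun z => phi y z * rp y z).
Proof.
have -> : (fun z => psi y z * rp y z) =
    (fun z => phi y z * rp y z - cond_mean y * rp y z).
  by apply/funext => z; rewrite mulrBl.
rewrite (sqB (L2phi y) (L2Z (cond_mean y) (L2_rootp y))).
rewrite [X in _ - 2 * X]ipC (ipZl _ (L2_rootp y) (L2phi y)) ipC -/(cond_mean y).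
have -> : sq lambda (fun z => cond_mean y * rp y z) = cond_mean y ^+ 2.
  rewrite sqE (ipZl _ (L2_rootp y) (L2Z _ (L2_rootp y))) ipC (ipZl _ (L2_rootp y) (L2_rootp y)).
  by rewrite -sqE sq_rootp mulr1 -expr2.
by have := sqr_ge0 (cond_mean y); lra.
Qed.

Lemma integral_sqr_step (f : borel E -> borel E -> R) j :
  measurable_fun setT (fun z : borel E * borel E => f z.1 z.2) ->
  (forall y, L2 lambda (fun z => f y z * rp y z)) ->
  (\int[Q]_w (f (Xn j w) (Xn j.+1 w) ^+ 2)%:E =
   \int[Q]_w (sq lambda (fun z => f (Xn j w) z * rp (Xn j w) z))%:E)%E.
Proof.
move=> mf Lf.
rewrite (@chain_integral (fun y z => (f y z ^+ 2)%:E)).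
- apply: eq_integral => w _; rewrite [RHS]fineK.
    by apply: eq_integral => z _; rewrite -EFinM exprMn expr2 [in RHS]expr2 rootpK -expr2.
  by apply: integrable_fin_num => //; exact: (Lf _).2.
- by move=> y z; rewrite lee_fin sqr_ge0.
- by apply/measurable_EFinP; exact: measurable_funX.
Qed.

(** The martingale of the sums of [phi] over the transitions, each term minus its
    conditional mean. *)
Definition centered_sum n w := \sum_(j < n) psi (Xn j w) (Xn j.+1 w).

Lemma measurable_centered_sum n :
  measurable_fun setT (centered_sum n : F (h * n%:R) -> R).
Proof.
apply: measurable_sum => j.
apply: (@measurable_fun_comp2 _ _ _ _ (F (h * n%:R)) (borel E) (borel E) _
    psi (Xn j) (Xn j.+1) measurable_centered); apply: measurable_sample_past => //.
exact: ltnW.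
Qed.

(** By orthogonality of the increments of the martingale. *)
Lemma centered_sum_sq n :
  (forall j : 'I_n, \int[Q]_w (phi (Xn j w) (Xn j.+1 w) ^+ 2)%:E < +oo)%E ->
  L2 Q (centered_sum n) /\
  ((sq Q (centered_sum n))%:E <=
    \sum_(j < n) \int[Q]_w (phi (Xn j w) (Xn j.+1 w) ^+ 2)%:E)%E.
Proof.
elim: n => [_|n IHn Hfin].
  rewrite big_ord0 (_ : centered_sum 0 = fun=> 0); last first.
    by apply/funext => w; rewrite /centered_sum big_ord0.
  have i0 : (\int[Q]_w (0 ^+ 2 : R)%:E = 0)%E.
    by rewrite expr0n/=; exact: integral0.
  split; first by apply: L2_fin => //; rewrite i0.
  by rewrite /sq /Rintegral i0.
have [LM IH] := IHn (fun j => Hfin (widen_ord (leqnSn n) j)).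
have Hn := Hfin ord_max.
pose ps w := psi (Xn n w) (Xn n.+1 w).
have Ecs : centered_sum n.+1 = fun w => centered_sum n w + ps w.
  by apply/funext => w; rewrite /centered_sum big_ord_recr.
have mps : measurable_fun setT ps.
  by apply: (@measurable_fun_comp2 _ _ _ _ Omega (borel E) (borel E) _
    psi (Xn n) (Xn n.+1) measurable_centered).
have leps : (\int[Q]_w (ps w ^+ 2)%:E <=
    \int[Q]_w (phi (Xn n w) (Xn n.+1 w) ^+ 2)%:E)%E.
  rewrite (integral_sqr_step n measurable_centered L2_centered).
  rewrite (integral_sqr_step n mphi L2phi).
  have msq (f : borel E -> borel E -> R) :
      measurable_fun setT (fun z : borel E * borel E => f z.1 z.2) ->
      measurable_fun setT (fun w => (sq lambda (fun z => f (Xn n w) z * rp (Xn n w) z))%:E).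
    move=> mf; apply/measurable_EFinP.
    apply: (@measurableT_comp _ _ _ _ _ _
      (fun y : borel E => sq lambda (fun z => f y z * rp y z)) _ (Xn n)) => //.
    apply: (@measurable_fun_Rintegral _ _ (borel E) (borel E) R lambda
      (fun z => (f z.1 z.2 * rp z.1 z.2) ^+ 2)).
    apply: measurable_funX; apply: measurable_funM => //.
    exact: measurable_rootp.
  apply: ge0_le_integral => //.
  - by move=> w _; rewrite lee_fin sq_ge0.
  - exact: (msq _ measurable_centered).
  - exact: (msq _ mphi).
  - by move=> w _; rewrite lee_fin sq_centered.
have Lps : L2 Q ps by apply: L2_fin => //; exact: le_lt_trans leps Hn.
have ip0 : ip Q (centered_sum n) ps = 0.
  rewrite /ip; under eq_Rintegral do rewrite /ps sampleS.
  apply: (@markov_step_centered (h * n%:R)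
    (fun z => centered_sum n z.1 * psi (Xn n z.1) z.2)).
  - exact: hn_ge0.
  - apply: measurable_funM.
      apply: (@measurableT_comp _ _ _ _ _ _ (centered_sum n : F (h * n%:R) -> R)) => //.
      exact: measurable_centered_sum.
    apply: (@measurable_fun_comp2 _ _ _ _ (F (h * n%:R) * borel E)%type
      (borel E) (borel E) _ psi (fun z => Xn n z.1) snd measurable_centered) => //.
    by apply: measurableT_comp => //; exact: measurable_sample_past.
  - move=> w /=.
    have := L2_integrableM (L2Z (centered_sum n w) (L2_centered (Xn n w))) (L2_rootp (Xn n w)).
    by under eq_fun do rewrite -!mulrA rootpK !mulrA.
  - move=> w /=.
    have := ipZl (centered_sum n w) (L2_centered (Xn n w)) (L2_rootp (Xn n w)).
    rewrite ip_centered mulr0 => ip0; rewrite -[RHS]ip0.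
    by apply: eq_Rintegral => z _; rewrite -!mulrA rootpK.
rewrite Ecs; split; first exact: L2D.
rewrite (sqD LM Lps) ip0 mulr0 addr0 EFinD big_ord_recr/=.
by apply: leeD => //; rewrite L2_sqE.
Qed.

End centering.

End markov_step.

(** * Second-order expansion of the logarithm; squares and their conditional means *)

Section log_expansion.
Context (R : realType).

(** The function inside the absolute value has the derivative [2 x^2 / (1 + x)]. *)
Lemma ln1D_expansion (x : R) : `|x| <= 2^-1 ->
  `|2 * ln (1 + x) - 2 * x + x ^+ 2| <= 4 * `|x| * x ^+ 2.
Proof.
move=> x2.
pose f (y : R) := 2 * ln (1 + y) - 2 * y + y ^+ 2.
pose f' (y : R) := 2 * y ^+ 2 / (1 + y).
have df (y : R) : `|y| <= 2^-1 -> is_derive y 1 f (f' y).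
  move=> y2.
  have y0 : 0 < 1 + y by move: y2; rewrite ler_norml => /andP[]; lra.
  have did := @is_derive_id R R y 1.
  have d1 : is_derive y 1 (fun z : R => 1 + z) 1.
    by have := is_deriveD (is_derive_cst (1 : R) y 1) did; rewrite add0r.
  have d2 := is_derive1_comp (is_derive1_ln y0) d1.
  have := is_deriveD (is_deriveB (is_deriveZ (2 : R) d2) (is_deriveZ (2 : R) did))
    (is_deriveX 2 did).
  move=> dd; apply: is_derive_eq dd _.
  rewrite /f' /GRing.scale/= !mulr1 expr1; field; lra.
have f0 : f 0 = 0 by rewrite /f addr0 ln1 !mulr0 subrr expr0n addr0.
have f'_le (c : R) : `|c| <= `|x| -> `|f' c| <= 4 * x ^+ 2.
  move=> cx; have c2 := le_trans cx x2.
  have c0 : 2^-1 <= 1 + c by move: c2; rewrite ler_norml => /andP[]; lra.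
  have c20 : 0 < 1 + c by lra.
  rewrite /f' ger0_norm; last by rewrite divr_ge0 ?(ltW c20)// mulr_ge0 ?sqr_ge0.
  rewrite ler_pdivrMr//.
  have : c ^+ 2 <= x ^+ 2 by rewrite -(real_normK (num_real c)) -(real_normK (num_real x)) lerXn2r.
  have := sqr_ge0 x; nra.
have main : exists2 c, `|c| <= `|x| & f x = f' c * x.
  have [xlt|xgt|->] := ltgtP x 0.
  - have [|c + E] := @mean_value R f f' x 0 xlt.
      move=> s; rewrite in_itv/= => /andP[s1 s2]; apply: df.
      by rewrite ler0_norm//; move: x2; rewrite ltr0_norm//; lra.
    rewrite in_itv/= => /andP[c1 c2]; exists c.
      by rewrite ler0_norm// ltr0_norm// lerN2.
    by move: E; rewrite f0 !sub0r mulrN => /oppr_inj.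
  - have [|c + E] := @mean_value R f f' 0 x xgt.
      move=> s; rewrite in_itv/= => /andP[s1 s2]; apply: df.
      by rewrite ger0_norm//; move: x2; rewrite gtr0_norm//; lra.
    rewrite in_itv/= => /andP[c1 c2]; exists c.
      by rewrite ger0_norm// gtr0_norm.
    by move: E; rewrite f0 !subr0.
  - by exists 0 => //; rewrite f0 mulr0.
have [c /f'_le cle] := main; rewrite /f => ->.
by rewrite normrM [leRHS]mulrAC ler_wpM2r.
Qed.

End log_expansion.

Section chain_law.
Context (R : realType) (E : pointedMetricType R).
Context dO (Omega : measurableType dO).
Variables (Theta : set R) (P : R -> E -> probability Omega R).
Variable X : R -> {mfun Omega >-> borel E}.
Variable lambda : {sigma_finite_measure set (borel E) -> \bar R}.
Variables (h : R) (p : R -> E -> E -> R).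
Hypothesis h0 : 0 < h.
Hypothesis mkv : markov_family Theta P X.
Hypothesis pd : transition_density Theta P X lambda h p.
Variables (t : R) (x : E).
Hypothesis Tt : Theta t.

Local Notation Q := (P t x).
Local Notation Xn := (sample X h).
Local Notation rp := (rootp p t).
Local Notation L2l := (L2 lambda).
Local Notation jm f := (measurable_fun setT (fun z : borel E * borel E => f z.1 z.2)).

Lemma measurable_step (f : borel E -> borel E -> R) j :
  jm f -> measurable_fun setT (fun w => f (Xn j w) (Xn j.+1 w)).
Proof.
by move=> mf; apply: (@measurable_fun_comp2 _ _ _ _ Omega (borel E) (borel E) _
    f (Xn j) (Xn j.+1) mf).
Qed.

Lemma measurable_integral_kernel (f : borel E -> borel E -> R) : jm f ->
  measurable_fun setT (fun y : borel E => \int[lambda]_z (f y z * p t y z)).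
Proof.
move=> mf; apply: (@measurable_fun_Rintegral _ _ (borel E) (borel E) R lambda
    (fun z => f z.1 z.2 * p t z.1 z.2)).
exact: measurable_funM mf (measurable_p pd Tt).
Qed.

Lemma integral_step (f : borel E -> borel E -> R) j : jm f ->
  (forall y z, 0 <= f y z) ->
  (forall y, lambda.-integrable setT (fun z => (f y z * p t y z)%:E)) ->
  (\int[Q]_w (f (Xn j w) (Xn j.+1 w))%:E =
   \int[Q]_w (\int[lambda]_z (f (Xn j w) z * p t (Xn j w) z))%:E)%E.
Proof.
move=> mf f0 If.
rewrite (chain_integral h0 mkv pd x Tt (f := fun y z => (f y z)%:E)).
- by apply: eq_integral => w _; rewrite [RHS]fineK// integrable_fin_num.
- by move=> y z; rewrite lee_fin.
- exact/measurable_EFinP.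
Qed.

Section truncation.
Variables (f : borel E -> borel E -> R) (c a : R).
Hypothesis mf : jm f.
Hypothesis Lf : forall y, L2l (fun z => f y z * rp y z).
Hypothesis c0 : 0 < c.
Hypothesis a2 : 2 < a.

(** The square of [f], set to 0 where |f| exceeds the level [c], and what it misses. *)
Definition trunc_sqr y z := if `|f y z| <= c then f y z ^+ 2 else 0.
Local Notation phi := trunc_sqr.
Definition tail_sqr y z := f y z ^+ 2 - phi y z.
Local Notation rho := tail_sqr.

Lemma trunc_sqr_ge0 y z : 0 <= phi y z.
Proof. by rewrite /phi; case: ifP => // _; exact: sqr_ge0. Qed.

Lemma trunc_sqr_le y z : phi y z <= f y z ^+ 2.
Proof. by rewrite /phi; case: ifP => // _; exact: sqr_ge0. Qed.

Lemma tail_sqr_ge0 y z : 0 <= rho y z.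
Proof. by rewrite subr_ge0 trunc_sqr_le. Qed.

Lemma trunc_sqr_sqr y z : phi y z ^+ 2 <= c ^+ 2 * f y z ^+ 2.
Proof.
rewrite /phi; case: ifPn => [fc|_]; last by rewrite expr0n mulr_ge0 ?sqr_ge0.
rewrite [leLHS]expr2 ler_wpM2r ?sqr_ge0//.
by rewrite -(real_normK (num_real (f y z))) lerXn2r ?nnegrE// ltW.
Qed.

Lemma tail_sqr_le y z : rho y z <= c `^ (2 - a) * `|f y z| `^ a.
Proof.
rewrite /rho /phi; case: ifPn => [_|].
  by rewrite subrr mulr_ge0 ?powR_ge0.
rewrite -ltNge subr0 => cf.
have f0 : 0 < `|f y z| := lt_trans c0 cf.
rewrite -(real_normK (num_real (f y z))) -powR_mulrn// -[X in X <= _]mul1r.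
have -> : `|f y z| `^ a = `|f y z| `^ (a - 2) * `|f y z| `^ 2.
  by rewrite -powRD ?subrK// (gt_eqF f0) implybT.
rewrite mulrA ler_wpM2r ?powR_ge0//.
rewrite -[2 - a]opprB powRN mulrC ler_pdivlMr ?powR_gt0// mul1r.
by rewrite ge0_ler_powR// ?nnegrE ?subr_ge0 ltW.
Qed.

Lemma measurable_trunc_sqr : jm phi.
Proof.
rewrite /trunc_sqr; apply: measurable_fun_ifT => //.
  by apply: measurable_fun_ler => //; exact: measurableT_comp.
exact: measurable_funX.
Qed.

Lemma measurable_tail_sqr : jm rho.
Proof. by apply: measurable_funB; [exact: measurable_funX|exact: measurable_trunc_sqr]. Qed.

Lemma measurable_section (g : borel E -> borel E -> R) y : jm g -> measurable_fun setT (g y).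
Proof.
move=> mg; exact: (@measurable_fun_comp2 _ _ _ _ (borel E) (borel E) (borel E) _
  g (cst y) id mg).
Qed.

Lemma L2_trunc_sqr y : L2l (fun z => phi y z * rp y z).
Proof.
have [_ If] := L2Z c (Lf y).
split.
  apply: measurable_funM; first exact: measurable_section measurable_trunc_sqr.
  exact: measurable_section (measurable_rootp pd Tt).
apply: (le_integrable _ _ _ If) => //.
  apply/measurable_EFinP; apply: measurable_funX; apply: measurable_funM.
    exact: measurable_section measurable_trunc_sqr.
  exact: measurable_section (measurable_rootp pd Tt).
move=> z _; rewrite !abse_EFin lee_fin !ger0_norm ?sqr_ge0// mulrA !exprMn.
by rewrite ler_wpM2r ?sqr_ge0// trunc_sqr_sqr.
Qed.

Lemma integrable_sqr_kernel y :
  lambda.-integrable setT (fun z => (f y z ^+ 2 * p t y z)%:E).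
Proof.
have [_ If] := Lf y.
rewrite (_ : (fun z => _) = fun z => ((f y z * rp y z) ^+ 2)%:E)//.
by apply/funext => z; rewrite exprMn [rp y z ^+ 2]expr2 (rootpK pd Tt).
Qed.

Let kernel_le (g1 : borel E -> borel E -> R) y : jm g1 ->
  (forall z, 0 <= g1 y z <= f y z ^+ 2) ->
  lambda.-integrable setT (fun z => (g1 y z * p t y z)%:E).
Proof.
move=> mg1 gf; apply: (le_integrable _ _ _ (integrable_sqr_kernel y)) => //.
  apply/measurable_EFinP; apply: measurable_funM; first exact: measurable_section.
  exact: measurable_section (measurable_p pd Tt).
move=> z _; have /andP[g0 gle] := gf z.
rewrite !abse_EFin lee_fin (ger0_norm (mulr_ge0 g0 (p_ge0 pd Tt _ _))).
rewrite (ger0_norm (mulr_ge0 (sqr_ge0 _) (p_ge0 pd Tt _ _))).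
by rewrite ler_wpM2r// (p_ge0 pd Tt).
Qed.

Lemma integrable_tail_kernel y :
  lambda.-integrable setT (fun z => (rho y z * p t y z)%:E).
Proof.
apply: kernel_le; first exact: measurable_tail_sqr.
by move=> z; rewrite tail_sqr_ge0/= lerBlDr lerDl trunc_sqr_ge0.
Qed.

(** The mean of the tail of the square under the transition probability from [y]. *)
Definition tail_kernel y := \int[lambda]_z (rho y z * p t y z).

Lemma sq_kernel_split y :
  sq lambda (fun z => f y z * rp y z) = cond_mean lambda p t phi y + tail_kernel y.
Proof.
rewrite /cond_mean /tail_kernel /ip -RintegralD//.
- apply: eq_Rintegral => z _; rewrite -mulrA (rootpK pd Tt) exprMn [rp y z ^+ 2]expr2.
  by rewrite (rootpK pd Tt) -mulrDl addrC subrK.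
- by apply: L2_integrableM; [exact: L2_trunc_sqr|exact: (L2_rootp pd Tt)].
- exact: integrable_tail_kernel.
Qed.

(** The sum of the squares minus their conditional means is a martingale [M] for the
    truncated squares, of second moment at most [c^2], plus the tails [A] minus the sum
    [B] of their conditional means, which have the same expectation. *)
Lemma cond_square_L1 n :
  (\int[Q]_w (\sum_(j < n) f (Xn j w) (Xn j.+1 w) ^+ 2)%:E <= 1)%E ->
  (\int[Q]_w (`|\sum_(j < n) (f (Xn j w) (Xn j.+1 w) ^+ 2 -
       sq lambda (fun z => f (Xn j w) z * rp (Xn j w) z))|)%:E <=
   c%:E + (2 * c `^ (2 - a))%:E *
      \int[Q]_w (\sum_(j < n) `|f (Xn j w) (Xn j.+1 w)| `^ a)%:E)%E.
Proof.
move=> sq1.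
pose M := centered_sum X lambda h p t phi n.
pose A w := \sum_(j < n) rho (Xn j w) (Xn j.+1 w).
pose B w := \sum_(j < n) tail_kernel (Xn j w).
have le_norm w : `|\sum_(j < n) (f (Xn j w) (Xn j.+1 w) ^+ 2 -
       sq lambda (fun z => f (Xn j w) z * rp (Xn j w) z))| <=
    (c^-1 * M w ^+ 2 + c) / 2 + A w + B w.
  have A0 : 0 <= A w by apply: sumr_ge0 => j _; exact: tail_sqr_ge0.
  have B0 : 0 <= B w.
    apply: sumr_ge0 => j _; apply: Rintegral_ge0 => z _.
    by rewrite mulr_ge0 ?tail_sqr_ge0 ?(p_ge0 pd Tt).
  have -> : \sum_(j < n) (f (Xn j w) (Xn j.+1 w) ^+ 2 -
       sq lambda (fun z => f (Xn j w) z * rp (Xn j w) z)) = M w + A w - B w.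
    rewrite /M /A /B -big_split -sumrB/=; apply: eq_bigr => j _.
    by rewrite sq_kernel_split /rho; ring.
  apply: (le_trans (ler_normB _ _)); rewrite (ger0_norm B0) lerD2r.
  apply: (le_trans (ler_normD _ _)); rewrite (ger0_norm A0) lerD2r.
  have := @young_mul R (M w) 1 c^-1; rewrite invr_gt0 invrK mulr1 expr1n mulr1.
  by apply.
have msum (g : borel E -> borel E -> R) : jm g ->
    measurable_fun setT (fun w => \sum_(j < n) g (Xn j w) (Xn j.+1 w)).
  by move=> mg; apply: measurable_sum => j; exact: measurable_step.
have mA : measurable_fun setT A by apply: msum; exact: measurable_tail_sqr.
have mtk : measurable_fun setT tail_kernel.
  exact: measurable_integral_kernel measurable_tail_sqr.
have mtkX j : measurable_fun setT (fun w => tail_kernel (Xn j w)).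
  exact: (measurableT_comp mtk (measurable_funP (Xn j))).
have mB : measurable_fun setT B.
  by apply: measurable_sum => j.
have mf2 j : measurable_fun setT (fun w => (f (Xn j w) (Xn j.+1 w) ^+ 2)%:E).
  by apply/measurable_EFinP; apply: measurable_funX; exact: measurable_step.
have f20 j w : (0 <= (f (Xn j w) (Xn j.+1 w) ^+ 2)%:E)%E by rewrite lee_fin sqr_ge0.
have Ef : (\sum_(j < n) \int[Q]_w (f (Xn j w) (Xn j.+1 w) ^+ 2)%:E <= 1)%E.
  rewrite -(@integral_sum_EFin _ _ _ Q n (fun j w => f (Xn j w) (Xn j.+1 w) ^+ 2))//.
  by move=> j; apply: measurable_funX; exact: measurable_step.
have phi_le (j : 'I_n) : (\int[Q]_w (phi (Xn j w) (Xn j.+1 w) ^+ 2)%:E <=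
    (c ^+ 2)%:E * \int[Q]_w (f (Xn j w) (Xn j.+1 w) ^+ 2)%:E)%E.
  rewrite -ge0_integralZl//; last by rewrite lee_fin sqr_ge0.
  apply: ge0_le_integral => //.
  - by move=> w _; rewrite lee_fin sqr_ge0.
  - apply/measurable_EFinP; apply: measurable_funX.
    exact: (measurable_step j measurable_trunc_sqr).
  - by apply: emeasurable_funM.
  - by move=> w _; rewrite -EFinM lee_fin trunc_sqr_sqr.
have phi_fin (j : 'I_n) : (\int[Q]_w (phi (Xn j w) (Xn j.+1 w) ^+ 2)%:E < +oo)%E.
  apply: (le_lt_trans (phi_le j)); apply: lte_mul_pinfty => //.
    by rewrite lee_fin sqr_ge0.
  apply: (@le_lt_trans _ _ 1%E); last exact: ltry.
  apply: le_trans Ef; rewrite (bigD1 j)//= leeDl// sume_ge0// => i _.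
  exact: integral_ge0.
have [LM leM] := centered_sum_sq h0 mkv pd Tt measurable_trunc_sqr L2_trunc_sqr phi_fin.
have {}leM : sq Q M <= c ^+ 2.
  rewrite -lee_fin; apply: (le_trans leM).
  apply: (@le_trans _ _ (\sum_(j < n)
      ((c ^+ 2)%:E * \int[Q]_w (f (Xn j w) (Xn j.+1 w) ^+ 2)%:E))%E).
    by apply: lee_sum => j _; exact: phi_le.
  rewrite -ge0_sume_distrr; last by move=> j _; exact: integral_ge0.
  by rewrite -[leRHS]mule1; apply: lee_wpmul2l => //; rewrite lee_fin sqr_ge0.
pose T := (\int[Q]_w (\sum_(j < n) `|f (Xn j w) (Xn j.+1 w)| `^ a)%:E)%E.
have mrho j : measurable_fun setT (fun w => (rho (Xn j w) (Xn j.+1 w))%:E).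
  by apply/measurable_EFinP; exact: (measurable_step j measurable_tail_sqr).
have rho0 j w : (0 <= (rho (Xn j w) (Xn j.+1 w))%:E)%E by rewrite lee_fin tail_sqr_ge0.
have mpow j : measurable_fun setT (fun w => `|f (Xn j w) (Xn j.+1 w)| `^ a).
  apply: (measurableT_comp (measurable_powR _)).
  by apply: measurableT_comp => //; exact: measurable_step.
have mpowE j : measurable_fun setT (fun w => (`|f (Xn j w) (Xn j.+1 w)| `^ a)%:E).
  exact/measurable_EFinP.
have cpow0 : (0 <= (c `^ (2 - a))%:E)%E by rewrite lee_fin powR_ge0.
have pow0 j w : (0 <= (`|f (Xn j w) (Xn j.+1 w)| `^ a)%:E)%E by rewrite lee_fin powR_ge0.
have intA : (\int[Q]_w (A w)%:E <= (c `^ (2 - a))%:E * T)%E.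
  rewrite /T /A (@integral_sum_EFin _ _ _ Q n (fun j w => rho (Xn j w) (Xn j.+1 w)))//; last first.
    by move=> j; exact: (measurable_step j measurable_tail_sqr).
  rewrite (@integral_sum_EFin _ _ _ Q n (fun j w => `|f (Xn j w) (Xn j.+1 w)| `^ a))//.
  rewrite ge0_sume_distrr; last by move=> j _; apply: integral_ge0 => w _; rewrite lee_fin powR_ge0.
  apply: lee_sum => j _; rewrite -ge0_integralZl//.
  apply: ge0_le_integral => //.
    by apply: emeasurable_funM.
  by move=> w _; rewrite -EFinM lee_fin tail_sqr_le.
have tk0 y : 0 <= tail_kernel y.
  by apply: Rintegral_ge0 => z _; rewrite mulr_ge0 ?tail_sqr_ge0 ?(p_ge0 pd Tt).
have intB : (\int[Q]_w (B w)%:E = \int[Q]_w (A w)%:E)%E.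
  rewrite /B /A (@integral_sum_EFin _ _ _ Q n (fun j w => tail_kernel (Xn j w)))//.
  rewrite (@integral_sum_EFin _ _ _ Q n (fun j w => rho (Xn j w) (Xn j.+1 w)))//; last first.
    by move=> j; exact: (measurable_step j measurable_tail_sqr).
  apply: eq_bigr => j _; rewrite integral_step//.
  - exact: measurable_tail_sqr.
  - exact: tail_sqr_ge0.
  - exact: integrable_tail_kernel.
rewrite -/M in LM; have mM := LM.1.
have intM : (\int[Q]_w ((c^-1 * M w ^+ 2 + c) / 2)%:E <= c%:E)%E.
  have IM2 := LM.2.
  have I0 := integrableZl_EFin c^-1 IM2.
  have Ic := finite_measure_integrable_cst Q c measurableT.
  have I1 := integrableD_EFin I0 Ic.
  have I2 := integrableZl_EFin 2^-1 I1.
  under eq_integral do rewrite mulrC.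
  rewrite -[leLHS]fineK; last by apply: (integrable_fin_num _ I2).
  rewrite lee_fin -[fine _]/(\int[Q]_w (2^-1 * (c^-1 * M w ^+ 2 + cst c w))).
  rewrite (RintegralZl _ measurableT I1) (RintegralD measurableT I0 Ic).
  have -> : \int[Q]_w cst c w = c.
    rewrite Rintegral_cst// -[RHS]mulr1; congr (_ * _).
    by rewrite -[RHS]/(fine 1%E); congr fine; exact: probability_setT.
  rewrite (RintegralZl _ measurableT IM2) -/(sq Q M).
  have : c^-1 * sq Q M <= c by rewrite mulrC ler_pdivrMr// -expr2.
  lra.
have M20 w : 0 <= (c^-1 * M w ^+ 2 + c) / 2.
  by rewrite divr_ge0// addr_ge0 ?(ltW c0)// mulr_ge0 ?sqr_ge0// invr_ge0 ltW.
have A0 w : 0 <= A w by apply: sumr_ge0 => j _; exact: tail_sqr_ge0.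
have B0 w : 0 <= B w by apply: sumr_ge0 => j _; exact: tk0.
have mM2 : measurable_fun setT (fun w => (c^-1 * M w ^+ 2 + c) / 2).
  apply: measurable_funM => //; apply: measurable_funD => //.
  by apply: measurable_funM => //; exact: measurable_funX.
apply: (@le_trans _ _ (\int[Q]_w ((c^-1 * M w ^+ 2 + c) / 2 + A w + B w)%:E)%E).
  apply: ge0_le_integral => //.
  - apply/measurable_EFinP; apply: measurableT_comp => //.
    apply: measurable_sum => j; apply: measurable_funB.
      by apply: measurable_funX; exact: measurable_step.
    apply: (@measurableT_comp _ _ _ _ _ _
      (fun y : borel E => sq lambda (fun z => f y z * rp y z)) _ (Xn j)) => //.
    apply: (@measurable_fun_Rintegral _ _ (borel E) (borel E) R lambda
      (fun z => (f z.1 z.2 * rp z.1 z.2) ^+ 2)).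
    apply: measurable_funX; apply: measurable_funM => //.
    exact: (measurable_rootp pd Tt).
  - by apply/measurable_EFinP; apply: measurable_funD => //; exact: measurable_funD.
  - by move=> w _; rewrite lee_fin.
under eq_integral do rewrite !EFinD.
have mM2E : measurable_fun setT (fun w => ((c^-1 * M w ^+ 2 + c) / 2)%:E).
  exact/measurable_EFinP.
have mAE : measurable_fun setT (fun w => (A w)%:E) by exact/measurable_EFinP.
have mBE : measurable_fun setT (fun w => (B w)%:E) by exact/measurable_EFinP.
have mMAE : measurable_fun setT (fun w => ((c^-1 * M w ^+ 2 + c) / 2)%:E + (A w)%:E)%E.
  exact: emeasurable_funD.
have MA0 w : (0 <= ((c^-1 * M w ^+ 2 + c) / 2)%:E + (A w)%:E)%E.
  by rewrite adde_ge0// lee_fin.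
have A0E w : (0 <= (A w)%:E)%E by rewrite lee_fin.
have B0E w : (0 <= (B w)%:E)%E by rewrite lee_fin.
have M0E w : (0 <= ((c^-1 * M w ^+ 2 + c) / 2)%:E)%E by rewrite lee_fin.
rewrite ge0_integralD// ge0_integralD// intB -addeA.
apply: leeD => //.
rewrite -/T EFinM -muleA -[X in (_ <= X)%E]/(2%:E * _)%E -[2]/(1 + 1) EFinD.
by rewrite ge0_muleDl ?mul1e ?leeD.
Qed.

End truncation.
End chain_law.

(** * Limit of the log-likelihood ratio along an array *)

Lemma ge0_cvge0P (R : realType) (u : nat -> \bar R) :
  (forall n, 0 <= u n)%E ->
  (forall e : R, 0 < e -> \forall n \near \oo, (u n <= e%:E)%E) ->
  (u n @[n --> \oo] --> 0)%E.
Proof.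
move=> u0 ue; apply/fine_cvgP; split.
  have := ue 1 ltr01; apply: filterS => n un.
  by rewrite ge0_fin_numE// (le_lt_trans un)// ltry.
apply/cvgr0Pnorm_le => e e0; have := ue e e0; apply: filterS => n un /=.
rewrite ger0_norm ?fine_ge0// -lee_fin fineK//.
by rewrite ge0_fin_numE// (le_lt_trans un)// ltry.
Qed.

Lemma cvge0_lt (R : realType) (u : nat -> \bar R) :
  (u n @[n --> \oo] --> 0)%E ->
  forall e : R, 0 < e -> \forall n \near \oo, (u n < e%:E)%E.
Proof.
move=> /fine_cvgP[ufin /cvgr0Pnorm_lt uc] e e0; have := uc e e0.
apply: filterS2 ufin => n un /= ue.
by rewrite -(fineK un) lte_fin (le_lt_trans (ler_norm _)).
Qed.

Section array_limit.
Context (R : realType) (E : pointedMetricType R).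
Context dO (Omega : measurableType dO).
Variables (Theta : set R) (P : R -> E -> probability Omega R).
Variable X : R -> {mfun Omega >-> borel E}.
Variable lambda : {sigma_finite_measure set (borel E) -> \bar R}.
Variables (h : R) (p : R -> E -> E -> R).
Hypothesis h0 : 0 < h.
Hypothesis mkv : markov_family Theta P X.
Hypothesis pd : transition_density Theta P X lambda h p.
Variables (t : R) (x : E).
Hypothesis Tt : Theta t.

Local Notation Q := (P t x).
Local Notation Xn := (sample X h).
Local Notation rp := (rootp p t).
Local Notation L2l := (L2 lambda).
Local Notation jm f := (measurable_fun setT (fun z : borel E * borel E => f z.1 z.2)).
Local Notation F := (in_prob (P t x)).

(** The sums over the first [z.1] transitions, respectively states, of the chain, of the
    [z.1]-th function of an array, at the point [z.2]. *)
Definition step_sum (f : nat -> E -> E -> R) (z : nat * Omega) : R :=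
  \sum_(j < z.1) f z.1 (Xn j z.2) (Xn j.+1 z.2).
Definition state_sum (f : nat -> E -> R) (z : nat * Omega) : R :=
  \sum_(j < z.1) f z.1 (Xn j z.2).

Lemma measurable_step_sum f n : jm (f n) ->
  measurable_fun setT (fun w => step_sum f (n, w)).
Proof.
move=> mf; rewrite /step_sum/=; apply: measurable_sum => j.
exact: (measurable_step X h j mf).
Qed.

Lemma measurable_state_sum f n : measurable_fun setT (f n : borel E -> R) ->
  measurable_fun setT (fun w => state_sum f (n, w)).
Proof.
move=> mf; rewrite /state_sum/=; apply: measurable_sum => j.
exact: (measurableT_comp mf (measurable_funP (Xn j))).
Qed.

Lemma measurable_sq_section (f : borel E -> borel E -> R) : jm f ->
  measurable_fun setT (fun y : borel E => sq lambda (f y)).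
Proof.
move=> mf; apply: (@measurable_fun_Rintegral _ _ (borel E) (borel E) R lambda
  (fun z => f z.1 z.2 ^+ 2)).
exact: measurable_funX.
Qed.

Lemma in_prob_cvg_sq (M : nat * Omega -> R) :
  (\forall n \near \oo, measurable_fun setT (fun w => M (n, w))) ->
  (\int[Q]_w (M (n, w) ^+ 2)%:E @[n --> \oo] --> 0)%E ->
  M z @[z --> F] --> (0 : R).
Proof.
move=> mM cM; apply/cvgr0Pnorm_lt => e e0.
have e20 : 0 < e ^+ 2 by rewrite exprn_gt0.
have := @in_prob_markov _ _ _ Q (fun n w => (M (n, w) ^+ 2)%:E) _ _ cM _ e20.
have mM2 : \forall n \near \oo, measurable_fun setT (fun w => (M (n, w) ^+ 2)%:E).
  near=> n; apply/measurable_EFinP; apply: measurable_funX.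
  by near: n.
have M20 : \forall n \near \oo, forall w, (0 <= (M (n, w) ^+ 2)%:E)%E.
  by near=> n => w; rewrite lee_fin sqr_ge0.
move=> /(_ mM2 M20); apply: filterS => -[n w]; rewrite lte_fin.
by rewrite -(real_normK (num_real (M _))) ltr_sqr ?nnegrE ?normr_ge0 ?(ltW e0).
Unshelve. all: by end_near. Qed.

Lemma in_prob_cvg_ge0 (Y : nat * Omega -> R) :
  (\forall n \near \oo, measurable_fun setT (fun w => Y (n, w))) ->
  (\forall n \near \oo, forall w, 0 <= Y (n, w)) ->
  (\int[Q]_w (Y (n, w))%:E @[n --> \oo] --> 0)%E ->
  Y z @[z --> F] --> (0 : R).
Proof.
move=> mY Y0 cY.
apply: in_prob_cvg_L1 => //.
apply: cvg_trans cY; apply: near_eq_cvg; near=> n.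
apply: eq_integral => w _; rewrite ger0_norm//.
have Yn : forall w, 0 <= Y (n, w) by near: n.
exact: Yn.
Unshelve. all: by end_near. Qed.

(* [b] is the normalized score, and satisfies a Lyapunov condition of order [a]. *)
Variables (b : nat -> E -> E -> R) (a : R).
Hypothesis mb : forall n, jm (b n).
Hypothesis Lb : forall n y, L2l (fun z => b n y z * rp y z).
Hypothesis b2_le1 : \forall n \near \oo,
  (\int[Q]_w (step_sum (fun n y z => b n y z ^+ 2) (n, w))%:E <= 1)%E.
Hypothesis b2_cvg : step_sum (fun n y z => b n y z ^+ 2) z @[z --> F] --> (1 : R).
Hypothesis a2 : 2 < a.
Hypothesis ba_cvg :
  (\int[Q]_w (step_sum (fun n y z => `|b n y z| `^ a) (n, w))%:E @[n --> \oo] --> 0)%E.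

Local Notation sqb n y := (sq lambda (fun z => b n y z * rp y z)).

(** The sums of the squares of [b] and of their conditional means are close: the bound
    [cond_square_L1] is used at a small level and then for [n] large. *)
Lemma cond_square_diff :
  step_sum (fun n y z => b n y z ^+ 2) z - state_sum (fun n y => sqb n y) z
    @[z --> F] --> (0 : R).
Proof.
pose Y z := step_sum (fun n y z => b n y z ^+ 2) z -
  state_sum (fun n y => sqb n y) z.
have mY n : measurable_fun setT (fun w => Y (n, w)).
  apply: measurable_funB.
    apply: (@measurable_step_sum (fun n y z => b n y z ^+ 2)).
    exact: measurable_funX.
  apply: (@measurable_state_sum (fun n y => sqb n y)); apply: measurable_sq_section.
  by apply: measurable_funM => //; exact: (measurable_rootp pd Tt).
apply: (@in_prob_cvg_L1 _ _ _ Q Y); first by near=> n.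
have bound c : 0 < c -> \forall n \near \oo, (\int[Q]_w `|Y (n, w)|%:E <=
   c%:E + (2 * c `^ (2 - a))%:E *
     \int[Q]_w (step_sum (fun n y z => `|b n y z| `^ a) (n, w))%:E)%E.
  move=> c0; near=> n.
  have n1 : (\int[Q]_w (step_sum (fun n y z => b n y z ^+ 2) (n, w))%:E <= 1)%E by near: n.
  have := cond_square_L1 h0 mkv pd Tt (mb n) (Lb n) c0 a2 n1.
  by under eq_integral do rewrite sumrB.
apply: ge0_cvge0P => [n|e e0]; first exact: integral_ge0.
have e20 : 0 < e / 2 by rewrite divr_gt0.
pose K := 2 * (e / 2) `^ (2 - a).
have Kv : (K%:E * \int[Q]_w (step_sum (fun n y z => `|b n y z| `^ a) (n, w))%:E
    @[n --> \oo] --> 0)%E.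
  by rewrite -[X in _ --> X](mule0 K%:E); exact: cvgeZl.
have Ke : \forall n \near \oo, (K%:E *
    \int[Q]_w (step_sum (fun n y z => `|b n y z| `^ a) (n, w))%:E < (e / 2)%:E)%E.
  exact: cvge0_lt Kv _ e20.
have Bn := bound _ e20.
near=> n.
have Kn : (K%:E *
    \int[Q]_w (step_sum (fun n y z => `|b n y z| `^ a) (n, w))%:E < (e / 2)%:E)%E by near: n.
apply: (@le_trans _ _ ((e / 2)%:E + K%:E *
    \int[Q]_w (step_sum (fun n y z => `|b n y z| `^ a) (n, w))%:E)%E).
  by near: n.
by rewrite [leRHS](_ : _ = (e / 2)%:E + (e / 2)%:E)%E ?leeD2l ?ltW// -EFinD -splitr.
Unshelve. all: by end_near. Qed.

Lemma max_b_cvg e : 0 < e -> \forall z \near F,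
  forall j : 'I_z.1, `|b z.1 (Xn j z.2) (Xn j.+1 z.2)| < e.
Proof.
move=> e0.
have ea0 : 0 < e `^ a by rewrite powR_gt0.
have mba : \forall n \near \oo, measurable_fun setT
    (fun w => (step_sum (fun n y z => `|b n y z| `^ a) (n, w))%:E).
  near=> n; apply/measurable_EFinP.
  apply: measurable_step_sum; apply: (measurableT_comp (measurable_powR _)).
  by apply: measurableT_comp.
have ba0 : \forall n \near \oo, forall w,
    (0 <= (step_sum (fun n y z => `|b n y z| `^ a) (n, w))%:E)%E.
  by near=> n => w; rewrite lee_fin sumr_ge0// => j _; rewrite powR_ge0.
have := in_prob_markov mba ba0 ba_cvg ea0; apply: filterS => z.
rewrite lte_fin => lt_ea j; rewrite ltNge; apply/negP => leb.
move: lt_ea; rewrite ltNge => /negP; apply.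
rewrite /step_sum (bigD1 j)//=.
apply: (@le_trans _ _ (`|b z.1 (Xn j z.2) (Xn j.+1 z.2)| `^ a)).
  by rewrite ge0_ler_powR// ?nnegrE ?(ltW e0)// (le_trans _ (ltW a2)).
by rewrite lerDl sumr_ge0// => i _; rewrite powR_ge0.
Unshelve. all: by end_near. Qed.

(* [xi] is the relative increment of the root density, [dd] its increment, [b'] the
   normalized derivative of the root density and [D] the squared norm of the remainder. *)
Variables (u : R) (xi dd b' : nat -> E -> E -> R).
Local Notation eta n y z := (u / 2 * b n y z).
Local Notation zeta := (fun n y z => xi n y z - eta n y z).
Local Notation D n y := (sq lambda (fun z => dd n y z - u * b' n y z)).
Hypothesis mb' : forall n, jm (b' n).
Hypothesis Lb' : forall n y, L2l (b' n y).
Hypothesis sqb' : forall n y, sq lambda (b' n y) = sqb n y / 4.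
Hypothesis mxi : \forall n \near \oo, jm (xi n).
Hypothesis mdd : \forall n \near \oo, jm (dd n).
Hypothesis Ldd : \forall n \near \oo, forall y, L2l (dd n y).
Hypothesis Lzeta : \forall n \near \oo, forall y, L2l (fun z => zeta n y z * rp y z).
Hypothesis zeta_mean : \forall n \near \oo, forall y,
  cond_mean lambda p t (zeta n) y = - sq lambda (dd n y) / 2.
Hypothesis zeta_le : \forall n \near \oo, forall y,
  sq lambda (fun z => zeta n y z * rp y z) <= D n y.
Hypothesis D_cvg :
  (\int[Q]_w (state_sum (fun n y => D n y) (n, w))%:E @[n --> \oo] --> 0)%E.

Lemma near_mzeta : \forall n \near \oo, jm (zeta n).
Proof.
near=> n; apply: measurable_funB; first by near: n.
by apply: measurable_funM.
Unshelve. all: by end_near. Qed.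

Lemma near_mD : \forall n \near \oo,
  measurable_fun setT ((fun y => D n y) : borel E -> R).
Proof.
near=> n; apply: measurable_sq_section; apply: measurable_funB; first by near: n.
by apply: measurable_funM.
Unshelve. all: by end_near. Qed.

Lemma state_D_cvg : state_sum (fun n y => D n y) z @[z --> F] --> (0 : R).
Proof.
apply: in_prob_cvg_ge0; last exact: D_cvg.
  have := near_mD; apply: filterS => n mD.
  exact: (@measurable_state_sum (fun n y => D n y)).
by near=> n => w; apply: sumr_ge0 => j _; exact: sq_ge0.
Unshelve. all: by end_near. Qed.

Lemma integral_zeta_sqr_cvg :
  (\int[Q]_w (step_sum (fun n y z => zeta n y z ^+ 2) (n, w))%:E
    @[n --> \oo] --> 0)%E.
Proof.
apply: ge0_cvge0P => [n|e e0].
  by apply: integral_ge0 => w _; rewrite lee_fin sumr_ge0// => j _; exact: sqr_ge0.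
have De := cvge0_lt D_cvg e0.
have mz := near_mzeta; have mD := near_mD.
near=> n.
have De_n : (\int[Q]_w (state_sum (fun n y => D n y) (n, w))%:E < e%:E)%E by near: n.
have mzn : jm (zeta n) by near: n.
have mDn : measurable_fun setT ((fun y => D n y) : borel E -> R) by near: n.
have Lzn : forall y, L2l (fun z => zeta n y z * rp y z) by near: n.
have len : forall y, sq lambda (fun z => zeta n y z * rp y z) <= D n y by near: n.
apply: le_trans (ltW De_n).
rewrite /step_sum /state_sum /=.
rewrite (@integral_sum_EFin _ _ _ Q n
    (fun j w => zeta n (Xn j w) (Xn j.+1 w) ^+ 2)).
rewrite (@integral_sum_EFin _ _ _ Q n
    (fun j w => D n (Xn j w))).
- apply: lee_sum => j _.
  rewrite (integral_sqr_step h0 mkv pd x Tt j mzn Lzn).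
  apply: ge0_le_integral => //.
  + by move=> w _; rewrite lee_fin sq_ge0.
  + apply/measurable_EFinP.
    apply: (@measurableT_comp _ _ _ _ _ _
      (fun y : borel E => sq lambda (fun z => zeta n y z * rp y z)) _ (Xn j)) => //.
    apply: measurable_sq_section.
    by apply: measurable_funM => //; exact: (measurable_rootp pd Tt).
  + apply/measurable_EFinP.
    exact: (measurableT_comp mDn (measurable_funP (Xn j))).
  + by move=> w _; rewrite lee_fin.
- by move=> j; exact: (measurableT_comp mDn (measurable_funP (Xn j))).
- by move=> j w; exact: sq_ge0.
- move=> j; apply: measurable_funX.
  exact: (@measurable_step _ _ _ _ X h (fun y z => zeta n y z) j mzn).
- by move=> j w; exact: sqr_ge0.
Unshelve. all: by end_near. Qed.

Lemma step_zeta_sqr_cvg :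
  step_sum (fun n y z => zeta n y z ^+ 2) z @[z --> F] --> (0 : R).
Proof.
apply: in_prob_cvg_ge0; last exact: integral_zeta_sqr_cvg.
  have := near_mzeta; apply: filterS => n mz.
  by apply: measurable_step_sum; exact: measurable_funX.
by near=> n => w; apply: sumr_ge0 => j _; exact: sqr_ge0.
Unshelve. all: by end_near. Qed.

Lemma step_eta_sqr_cvg :
  step_sum (fun n y z => (eta n y z) ^+ 2) z @[z --> F] --> u ^+ 2 / 4.
Proof.
rewrite (_ : step_sum _ = fun z => u ^+ 2 / 4 * step_sum (fun n y z => b n y z ^+ 2) z).
  by rewrite -[X in _ --> X]mulr1; apply: cvgMr.
apply/funext => z; rewrite /step_sum mulr_sumr; apply: eq_bigr => j _.
by rewrite exprMn expr_div_n -natrX.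
Qed.

Lemma step_xi_sqr_cvg :
  step_sum (fun n y z => xi n y z ^+ 2) z @[z --> F] --> u ^+ 2 / 4.
Proof.
apply: (cvg_subr0 _ step_eta_sqr_cvg).
apply: (@cvg_young _ _ _ _ _ (step_sum (fun n y z => zeta n y z ^+ 2))
  (step_sum (fun n y z => (eta n y z) ^+ 2)) (u ^+ 2 / 4) 1).
- move=> c c0; near=> z.
  rewrite /step_sum -sumrB; apply: (le_trans (ler_norm_sum _ _ _)).
  rewrite !mulr_sumr -big_split/=; apply: ler_sum => j _; exact: young_sqr.
- exact: step_zeta_sqr_cvg.
- exact: step_eta_sqr_cvg.
Unshelve. all: by end_near. Qed.

(** Each |zeta| is controlled by the sum of the squares of the zeta. *)
Lemma max_xi_cvg e : 0 < e -> \forall z \near F,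
  forall j : 'I_z.1, `|xi z.1 (Xn j z.2) (Xn j.+1 z.2)| < e.
Proof.
move=> e0.
have e20 : 0 < e / 2 by rewrite divr_gt0.
have d0 : 0 < e / (2 * (`|u| + 1)) by rewrite divr_gt0// mulr_gt0// ltr_wpDl.
have Nb := max_b_cvg d0.
have e220 : 0 < (e / 2) ^+ 2 by rewrite exprn_gt0.
have Nz : \forall z \near F, step_sum (fun n y z => zeta n y z ^+ 2) z < (e / 2) ^+ 2.
  exact: cvgr_lt step_zeta_sqr_cvg _ e220.
near=> z => j.
have bz : `|b z.1 (Xn j z.2) (Xn j.+1 z.2)| < e / (2 * (`|u| + 1)).
  by move: j; near: z.
have zz : step_sum (fun n y z => zeta n y z ^+ 2) z < (e / 2) ^+ 2 by near: z.
have zj : `|zeta z.1 (Xn j z.2) (Xn j.+1 z.2)| < e / 2.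
  rewrite -ltr_sqr ?nnegrE ?normr_ge0 ?(ltW e20)// real_normK ?num_real//.
  apply: le_lt_trans zz; rewrite /step_sum (bigD1 j)//= lerDl.
  by apply: sumr_ge0 => i _; exact: sqr_ge0.
have ej : `|eta z.1 (Xn j z.2) (Xn j.+1 z.2)| < e / 2.
  rewrite normrM; have u1 : 0 < `|u| + 1 by rewrite ltr_wpDl.
  apply: (@le_lt_trans _ _ ((`|u| + 1) * (e / (2 * (`|u| + 1))) / 2)).
    rewrite normrM [X in _ * X * _]ger0_norm ?invr_ge0// mulrAC ler_pM2r ?invr_gt0//.
    by apply: ler_pM => //; [rewrite lerDl|exact: ltW].
  have -> : (`|u| + 1) * (e / (2 * (`|u| + 1))) / 2 = e / 4.
    by field; rewrite gt_eqF.
  by lra.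
rewrite [e]splitr -[X in `|X|](subrK (eta z.1 (Xn j z.2) (Xn j.+1 z.2))).
by apply: (le_lt_trans (ler_normD _ _)); exact: ltrD.
Unshelve. all: by end_near. Qed.

Lemma state_dd_cvg :
  state_sum (fun n y => sq lambda (dd n y)) z @[z --> F] --> u ^+ 2 / 4.
Proof.
have cB : state_sum (fun n y => sq lambda (fun z => u * b' n y z)) z @[z --> F] --> u ^+ 2 / 4.
  have H : state_sum (fun n y => sqb n y) z @[z --> F] --> (1 : R).
    exact: cvg_subr0l cond_square_diff b2_cvg.
  rewrite (_ : state_sum _ = fun z => u ^+ 2 / 4 * state_sum (fun n y => sqb n y) z).
    by rewrite -[X in _ --> X]mulr1; apply: cvgMr.
  apply/funext => z; rewrite /state_sum mulr_sumr; apply: eq_bigr => j _.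
  rewrite mulrAC -mulrA -sqb' /sq -RintegralZl//; last exact: (Lb' _ _).2.
  by apply: eq_Rintegral => y _; rewrite exprMn.
apply: (cvg_subr0 _ cB).
apply: (@cvg_young _ _ _ _ _ (state_sum (fun n y => D n y))
  (state_sum (fun n y => sq lambda (fun z => u * b' n y z))) (u ^+ 2 / 4) 1) => //.
- move=> c c0.
  have H : \forall n \near \oo, forall w,
     `|state_sum (fun n y => sq lambda (dd n y)) (n, w) -
       state_sum (fun n y => sq lambda (fun z => u * b' n y z)) (n, w)| <=
     (1 + c) * state_sum (fun n y => D n y) (n, w) +
     c^-1 * state_sum (fun n y => sq lambda (fun z => u * b' n y z)) (n, w).
    near=> n => w.
    have Ln : forall y, L2l (dd n y) by near: n.
    rewrite /state_sum/= -sumrB; apply: (le_trans (ler_norm_sum _ _ _)).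
    rewrite !mulr_sumr -big_split/=; apply: ler_sum => j _.
    by apply: (sq_young (Ln _) _ c0); exact: L2Z.
  have := near_in_prob Q H; apply: filterS => -[n w]; exact.
- exact: state_D_cvg.
Unshelve. all: by end_near. Qed.

(** The sum of zeta is a martingale minus half the sum of the squared norms of [dd]. *)
Lemma step_zeta_cvg : step_sum zeta z @[z --> F] --> - (u ^+ 2 / 8).
Proof.
pose M z := centered_sum X lambda h p t (zeta z.1) z.1 z.2.
have mz := near_mzeta.
have finz := cvge0_lt integral_zeta_sqr_cvg ltr01.
have ze0 n j w : (0 <= (zeta n (Xn j w) (Xn j.+1 w) ^+ 2)%:E)%E by rewrite lee_fin sqr_ge0.
have Mn : \forall n \near \oo, L2 Q (fun w => M (n, w)) /\ (\int[Q]_w (M (n, w) ^+ 2)%:E <=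
     \int[Q]_w (step_sum (fun n y z => zeta n y z ^+ 2) (n, w))%:E)%E.
  near=> n.
  have mzn : jm (zeta n) by near: n.
  have Lzn : forall y, L2l (fun z => zeta n y z * rp y z) by near: n.
  have fn : (\int[Q]_w (step_sum (fun n y z => zeta n y z ^+ 2) (n, w))%:E < 1)%E by near: n.
  have mz2 j : measurable_fun setT (fun w => zeta n (Xn j w) (Xn j.+1 w) ^+ 2).
    by apply: measurable_funX; exact: (@measurable_step _ _ _ _ X h (fun y z => zeta n y z) j mzn).
  rewrite /step_sum/= (@integral_sum_EFin _ _ _ Q n
    (fun j w => zeta n (Xn j w) (Xn j.+1 w) ^+ 2))// in fn *; last first.
    by move=> j w; exact: sqr_ge0.
  have fj (j : 'I_n) : (\int[Q]_w (zeta n (Xn j w) (Xn j.+1 w) ^+ 2)%:E < +oo)%E.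
    apply: (@lt_trans _ _ 1%E); last exact: ltry.
    apply: le_lt_trans fn; rewrite (bigD1 j)//= leeDl// sume_ge0// => i _.
    exact: integral_ge0.
  have [LM leM] := centered_sum_sq h0 mkv pd Tt mzn Lzn fj.
  by split => //; rewrite -(L2_sqE LM).
have cM : M z @[z --> F] --> (0 : R).
  apply: in_prob_cvg_sq.
    by apply: filterS Mn => n [[]].
  apply: ge0_cvge0P => [n|e e0].
    by apply: integral_ge0 => w _; rewrite lee_fin sqr_ge0.
  have := cvge0_lt integral_zeta_sqr_cvg e0.
  by apply: filterS2 Mn => n [_ le1] lt2; exact: le_trans le1 (ltW lt2).
have -> : - (u ^+ 2 / 8) = 0 - (u ^+ 2 / 4) / 2 by field.
have cH : M z - state_sum (fun n y => sq lambda (dd n y)) z / 2 @[z --> F] -->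
    0 - (u ^+ 2 / 4) / 2.
  by apply: cvgB => //; apply: cvgMl; exact: state_dd_cvg.
apply: cvg_trans cH; apply: near_eq_cvg.
have H : \forall n \near \oo, forall w,
    M (n, w) - state_sum (fun n y => sq lambda (dd n y)) (n, w) / 2 = step_sum zeta (n, w).
  near=> n => w.
  have zn : forall y, cond_mean lambda p t (zeta n) y = - sq lambda (dd n y) / 2 by near: n.
  rewrite /M /centered_sum /state_sum /step_sum/= mulr_suml -sumrB.
  by apply: eq_bigr => j _; rewrite zn; ring.
by have := near_in_prob Q H; apply: filterS => -[n w].
Unshelve. all: by end_near. Qed.

Lemma log_ratio_cvg :
  step_sum (fun n y z => 2 * ln (1 + xi n y z)) z - u * step_sum b z + u ^+ 2 / 2
    @[z --> F] --> (0 : R).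
Proof.
pose Rem z := step_sum (fun n y z => 2 * ln (1 + xi n y z) - 2 * xi n y z + xi n y z ^+ 2) z.
have cR : Rem z @[z --> F] --> (0 : R).
  apply/cvgr0Pnorm_lt => e e0.
  have K0 : 0 < u ^+ 2 / 4 + 1 by rewrite ltr_wpDl// divr_ge0// sqr_ge0.
  (* The level 1/2 allows the expansion of the logarithm, and the other one makes the
     cubic terms small compared with the sum of the squares. *)
  have d0 : 0 < Num.min 2^-1 (e / (4 * (u ^+ 2 / 4 + 1))).
    by rewrite lt_min invr_gt0 ltr0n/= divr_gt0// mulr_gt0.
  have N1 := max_xi_cvg d0.
  have lt1 : u ^+ 2 / 4 < u ^+ 2 / 4 + 1 by rewrite ltrDl.
  have N2 : \forall z \near F, step_sum (fun n y z => xi n y z ^+ 2) z < u ^+ 2 / 4 + 1.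
    exact: cvgr_lt step_xi_sqr_cvg _ lt1.
  near=> z.
  have x1 : forall j : 'I_z.1, `|xi z.1 (Xn j z.2) (Xn j.+1 z.2)| <
    Num.min 2^-1 (e / (4 * (u ^+ 2 / 4 + 1))) by near: z.
  have x2 : step_sum (fun n y z => xi n y z ^+ 2) z < u ^+ 2 / 4 + 1 by near: z.
  apply: (@le_lt_trans _ _ (e / (u ^+ 2 / 4 + 1) *
      step_sum (fun n y z => xi n y z ^+ 2) z)).
    apply: (le_trans (ler_norm_sum _ _ _)); rewrite mulr_sumr; apply: ler_sum => j _.
    have := x1 j; rewrite lt_min => /andP[xh xe].
    apply: (le_trans (ln1D_expansion (ltW xh))).
    rewrite ler_wpM2r ?sqr_ge0//.
    have -> : e / (u ^+ 2 / 4 + 1) = 4 * (e / (4 * (u ^+ 2 / 4 + 1))).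
      by move: K0; move: (u ^+ 2 / 4 + 1) => K K0; field; exact: lt0r_neq0.
    by rewrite ler_pM2l// ltW.
  by rewrite mulrAC ltr_pdivrMr// ltr_pM2l.
have cT : Rem z + 2 * step_sum zeta z - step_sum (fun n y z => xi n y z ^+ 2) z + u ^+ 2 / 2
    @[z --> F] --> 0 + 2 * (- (u ^+ 2 / 8)) - u ^+ 2 / 4 + u ^+ 2 / 2.
  apply: cvgD; last exact: cvg_cst.
  apply: cvgB; last exact: step_xi_sqr_cvg.
  apply: cvgD => //; apply: cvgMr; exact: step_zeta_cvg.
have E0 : 0 + 2 * (- (u ^+ 2 / 8)) - u ^+ 2 / 4 + u ^+ 2 / 2 = 0 by field.
rewrite E0 in cT.
apply: cvg_trans cT; apply: near_eq_cvg; near=> z.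
congr (_ + _); rewrite /Rem /step_sum !mulr_sumr -big_split -!sumrB/=.
by apply: eq_bigr => j _; field.
Unshelve. all: by end_near. Qed.

End array_limit.

(** * The local model at a fixed parameter *)

Lemma open_open_interval (R : realType) (a b : \bar R) : open (open_interval a b).
Proof.
have -> : open_interval a b = [set t : R | (a < t%:E)%E] `&` [set t : R | (t%:E < b)%E].
  by apply/seteqP; split => [t /andP[]|t [ta tb]] //; apply/andP.
apply: openI.
- case: a => [r| |].
  + rewrite (_ : [set _ | _] = [set t | r < t]); first exact: open_gt.
    by apply/seteqP; split => t /=; rewrite lte_fin.
  + rewrite (_ : [set _ | _] = set0); first exact: open0.
    by apply/seteqP; split => t.
  + rewrite (_ : [set _ | _] = setT); first exact: openT.
    by apply/seteqP; split => t //= _; rewrite ltNyr.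
- case: b => [r| |].
  + rewrite (_ : [set _ | _] = [set t | t < r]); first exact: open_lt.
    by apply/seteqP; split => t /=; rewrite lte_fin.
  + rewrite (_ : [set _ | _] = setT); first exact: openT.
    by apply/seteqP; split => t //= _; rewrite ltry.
  + rewrite (_ : [set _ | _] = set0); first exact: open0.
    by apply/seteqP; split => t.
Qed.

Lemma open_interval_convex (R : realType) (a b : \bar R) (t0 c v : R) :
  open_interval a b t0 -> open_interval a b (t0 + c) -> v \in `[0, 1] ->
  open_interval a b (t0 + v * c).
Proof.
rewrite in_itv/= => /andP[at0 t0b] /andP[ac cb] /andP[v0 v1].
rewrite /open_interval /=.
have [c0|c0] := leP 0 c.
- apply/andP; split.
    by apply: (lt_le_trans at0); rewrite lee_fin lerDl mulr_ge0.
  by apply: (le_lt_trans _ cb); rewrite lee_fin lerD2l ler_piMl.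
- apply/andP; split.
    by apply: (lt_le_trans ac); rewrite lee_fin lerD2l ler_niMl// ltW.
  by apply: (le_lt_trans _ t0b); rewrite lee_fin gerDl mulr_ge0_le0// ltW.
Qed.

Lemma measurable_inv_ge0 d (T : measurableType d) (R : realType) (f : T -> R) :
  measurable_fun setT f -> (forall x, 0 <= f x) ->
  measurable_fun setT (fun x => (f x)^-1).
Proof.
move=> mf f0; rewrite (_ : (fun x => _) = (fun x => f x `^ (-1))).
  exact: (measurableT_comp (measurable_powR _)).
by apply/funext => x; rewrite powR_inv1.
Qed.

Section local_model.
Context (R : realType) (E : pointedMetricType R).
Context dO (Omega : measurableType dO).
Variables (Theta : set R) (P : R -> E -> probability Omega R).
Variable X : R -> {mfun Omega >-> borel E}.
Variable lambda : {sigma_finite_measure set (borel E) -> \bar R}.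
Variables (h : R) (p q : R -> E -> E -> R).
Hypothesis pd : transition_density Theta P X lambda h p.
Hypothesis mq : jointly_measurable Theta q.
Hypothesis reg : forall y, regular lambda Theta (fun t => p t y) (fun t => q t y).
Hypothesis oTheta : open Theta.

Local Notation L2l := (L2 lambda).
Local Notation rp := (rootp p).
Local Notation jm f := (measurable_fun setT (fun z : borel E * borel E => f z.1 z.2)).

Lemma L2_q t y : Theta t -> L2l (q t y : borel E -> R).
Proof. by move=> Tt; apply: L2_Lfun; exact: (regular_L2 (reg y)). Qed.

Lemma rootp_derivative t y : Theta t ->
  sq lambda (fun z : borel E => (rp (t + d) y z - rp t y z) / d - q t y z)
    @[d --> 0^'] --> (0 : R).
Proof. by move=> Tt; have := regular_derivative (reg y) Tt => /fine_cvg. Qed.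

Lemma q_continuous t y : Theta t ->
  sq lambda (fun z : borel E => q t' y z - q t y z) @[t' --> t] --> (0 : R).
Proof. by move=> Tt; have := regular_derivative_continuous (reg y) Tt => /fine_cvg. Qed.

Variable t : R.
Hypothesis Tt : Theta t.
Local Notation sc := (score p q t).

(** The indicator on the right accounts for the score being 0 where the density is. *)
Lemma score_rootp y z : sc y z * rp t y z = 2 * ((rp t y z != 0)%:R * q t y z).
Proof.
rewrite /score /rootp; have p0 := p_ge0 pd Tt y z.
have [->|pn0] := eqVneq (p t y z) 0; first by rewrite sqrtr0 eqxx/= mul0r mul0r mulr0.
have s0 : Num.sqrt (p t y z) != 0 by rewrite sqrtr_eq0 -ltNge lt_neqAle eq_sym pn0.
by rewrite s0 mul1r divfK.
Qed.

Lemma measurable_score : jm sc.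
Proof.
have mp := measurable_p pd Tt; have ms := measurable_rootp pd Tt.
rewrite /score; apply: measurable_fun_ifT => //.
  exact: measurable_fun_eqr.
apply: measurable_funM.
  by apply: measurable_funM => //; exact: mq.
by apply: (measurable_inv_ge0 ms) => z; exact: sqrtr_ge0.
Qed.

Let sc_rp y : (fun z => sc y z * rp t y z) =
  (fun z => 2 * ((rp t y z != 0)%:R * q t y z)).
Proof. by apply/funext => z; rewrite score_rootp. Qed.

Lemma measurable_rootp_section u y : Theta u ->
  measurable_fun setT (rp u y : borel E -> R).
Proof. by move=> Tu; have [] := L2_rootp pd Tu y. Qed.

Lemma L2_support f y : L2l f -> L2l (fun z => (rp t y z != 0)%:R * f z).
Proof.
apply: L2_bounded_mul => [|z]; last by case: eqP => _; rewrite ?normr0 ?normr1.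
rewrite (_ : (fun z => _) = (fun z => 1 - (rp t y z == 0)%:R)).
  apply: measurable_funB => //; apply: measurable_fun_eq0.
  exact: measurable_rootp_section.
by apply/funext => z; case: eqP => _ /=; rewrite ?subrr ?subr0.
Qed.

Lemma L2_score y : L2l (fun z => sc y z * rp t y z).
Proof. by rewrite sc_rp; apply: L2Z; apply: L2_support; exact: L2_q. Qed.

Lemma sq_score y : sq lambda (fun z => sc y z * rp t y z) = 4 * sq lambda (q t y : borel E -> R).
Proof.
have -> : sq lambda (q t y : borel E -> R) =
    sq lambda (fun z : borel E => (rp t y z != 0)%:R * q t y z).
  apply: (@sq_derive_support _ _ _ lambda Theta (fun t => rp t y) (fun t => q t y)) => //.
  - by move=> u Tu; exact: (L2_rootp pd Tu).
  - by move=> u Tu; exact: L2_q.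
  - by move=> u Tu; exact: rootp_derivative.
  - by move=> u z _; exact: sqrtr_ge0.
rewrite sc_rp {1}/sq /sq -RintegralZl//; last first.
  exact: (L2_support y (L2_q y Tt)).2.
by apply: eq_Rintegral => z _; rewrite exprMn -natrX.
Qed.

Lemma ip_q_rootp y : ip lambda (q t y : borel E -> R) (rp t y) = 0.
Proof.
apply: (@ip_derive_unit _ _ _ lambda Theta (fun t => rp t y) (fun t => q t y)) => //.
- by move=> u Tu; exact: (L2_rootp pd Tu).
- by move=> u Tu; exact: L2_q.
- by move=> u Tu; exact: rootp_derivative.
- by move=> u Tu; exact: (sq_rootp pd Tu).
Qed.

(* [zeta] is the error of the linear approximation of [xi], at the local parameter
   [t + c], by the score. *)
Variable c : R.
Hypothesis Ttc : Theta (t + c).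
Local Notation xi := (fun y z => rp (t + c) y z / rp t y z - 1).
Local Notation zeta := (fun y z => xi y z - c / 2 * sc y z).
Local Notation dd := (fun y z => rp (t + c) y z - rp t y z).

Lemma measurable_xi : jm xi.
Proof.
apply: measurable_funB => //; apply: measurable_funM.
  exact: (measurable_rootp pd Ttc).
apply: (measurable_inv_ge0 (measurable_rootp pd Tt)) => z; exact: sqrtr_ge0.
Qed.

Lemma measurable_dd : jm dd.
Proof.
apply: measurable_funB; first exact: (measurable_rootp pd Ttc).
exact: (measurable_rootp pd Tt).
Qed.

Lemma L2_dd y : L2l (dd y).
Proof. exact: (L2B (L2_rootp pd Ttc y) (L2_rootp pd Tt y)). Qed.

Lemma L2_remainder y : L2l (fun z : borel E => dd y z - c * q t y z).
Proof. exact: (L2B (L2_dd y) (L2Z c (L2_q y Tt))). Qed.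

Lemma zeta_rootp y : (fun z => zeta y z * rp t y z) =
  (fun z => (rp t y z != 0)%:R * (dd y z - c * q t y z)).
Proof.
apply/funext => z; rewrite mulrBl -[X in _ - X]mulrA score_rootp.
have [->|s0] := eqVneq (rp t y z) 0; first by rewrite mul0r !mulr0 subr0 mul0r.
by rewrite !mul1r mulrBl mul1r divfK//; field.
Qed.

Lemma L2_zeta y : L2l (fun z => zeta y z * rp t y z).
Proof. by rewrite zeta_rootp; apply: L2_support; exact: L2_remainder. Qed.

Lemma sq_zeta_le y : sq lambda (fun z => zeta y z * rp t y z) <=
  sq lambda (fun z : borel E => dd y z - c * q t y z).
Proof.
rewrite zeta_rootp; apply: le_Rintegral => //.
- exact: (L2_support y (L2_remainder y)).2.
- exact: (L2_remainder y).2.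
- move=> z _; rewrite exprMn; case: eqP => _ /=.
    by rewrite expr0n/= mul0r sqr_ge0.
  by rewrite expr1n mul1r.
Qed.

(** For unit vectors v and v', the inner product of v' - v with v is - |v' - v|^2 / 2;
    the derivative [q t y] is orthogonal to the root density. *)
Lemma zeta_cond_mean y : cond_mean lambda p t zeta y = - sq lambda (dd y) / 2.
Proof.
have L1 := L2_rootp pd Ttc y; have L0 := L2_rootp pd Tt y.
have -> : cond_mean lambda p t zeta y =
    ip lambda (fun z : borel E => dd y z - c * q t y z) (rp t y).
  rewrite /cond_mean zeta_rootp; apply: eq_Rintegral => z _.
  by case: eqP => [->|_]; rewrite ?mulr0 ?mul1r.
rewrite (ipBl (L2_dd y) (L2Z c (L2_q y Tt)) L0) (ipZl c (L2_q y Tt) L0) ip_q_rootp.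
rewrite (ipBl L1 L0 L0) -sqE (sq_rootp pd Tt) (sqB L1 L0) (sq_rootp pd Tt) (sq_rootp pd Ttc).
by field.
Qed.

End local_model.

(** * The normalizing rate *)

Lemma expectationE d (T : measurableType d) (R : realType) (P : probability T R)
  (Y : T -> R) : ('E_P[Y] = \int[P]_w (Y w)%:E)%E.
Proof. by rewrite unlock. Qed.

Section rate.
Context (R : realType) (E : pointedMetricType R).
Context dO (Omega : measurableType dO).
Variables (Theta : set R) (P : R -> E -> probability Omega R).
Variable X : R -> {mfun Omega >-> borel E}.
Variable lambda : {sigma_finite_measure set (borel E) -> \bar R}.
Variables (h : R) (p q : R -> E -> E -> R).
Hypothesis h0 : 0 < h.
Hypothesis mkv : markov_family Theta P X.
Hypothesis pd : transition_density Theta P X lambda h p.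
Hypothesis mq : jointly_measurable Theta q.
Hypothesis reg : forall y, regular lambda Theta (fun t => p t y) (fun t => q t y).
Hypothesis oTheta : open Theta.
Variables (t : R) (x : E).
Hypothesis Tt : Theta t.

Local Notation Q := (P t x).
Local Notation Xn := (sample X h).
Local Notation r := (fun n => fisher_rate P X h p q x n t).
Local Notation g := (score_step X h p q t).
Local Notation F := (in_prob (P t x)).

Lemma measurable_score_step j : measurable_fun setT (g j).
Proof. exact: (@measurable_step _ _ _ _ X h (score p q t) j (measurable_score pd mq Tt)). Qed.

Lemma fisherE n : (fisher P X h p q x n t = \int[Q]_w (\sum_(j < n) g j w ^+ 2)%:E)%E.
Proof.
rewrite (@integral_sum_EFin _ _ _ Q n (fun j w => g j w ^+ 2)).
- by rewrite /fisher; apply: eq_bigr => j _; rewrite expectationE.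
- by move=> j; apply: measurable_funX; exact: measurable_score_step.
- by move=> j w; exact: sqr_ge0.
Qed.

Lemma fisher_rate_ge0 n : 0 <= r n.
Proof. by rewrite invr_ge0 sqrtr_ge0. Qed.

(** A positive rate forces a finite and positive information. *)
Lemma fisher_rateM n : 0 < r n -> ((r n ^+ 2)%:E * fisher P X h p q x n t = 1)%E.
Proof.
rewrite /fisher_rate; move: (fisher _ _ _ _ _ _ _ _) => I; rewrite invr_gt0 sqrtr_gt0.
case: I => [i| |] /=; rewrite ?ltxx// => i0.
by rewrite exprVn sqr_sqrtr ?(ltW i0)// -EFinM mulVf// gt_eqF.
Qed.

Hypothesis law_squares : cvg_in_probability (fun=> P t x)
  (fun n w => (r n ^+ 2 * \sum_(j < n) g j w ^+ 2)%:E) 1.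

(** Where the rate is 0, so is the normalized sum of squares, which is then far from 1. *)
Lemma fisher_rate_gt0 : \forall n \near \oo, 0 < r n.
Proof.
have half0 : 0 < 2^-1 :> R by rewrite invr_gt0.
have := cvge0_lt (law_squares half0) (@ltr01 R); apply: filterS => n Pn.
rewrite lt_neqAle fisher_rate_ge0 andbT; apply/eqP => r0.
move: Pn; rewrite -r0 [X in Q X](_ : _ = setT) ?probability_setT ?ltxx//.
apply/seteqP; split => // w _ /=.
rewrite lee_fin expr0n/= mul0r sub0r normrN normr1; lra.
Qed.

Variable a : R.
Hypothesis a2 : 2 < a.
Hypothesis lyapunov :
  ((r n `^ a)%:E * 'E_(P t x)[fun w => (\sum_(j < n) `|g j w| `^ a)%R]
      @[n --> \oo] --> 0)%E.

Local Notation M n := (\int[Q]_w (\sum_(j < n) `|g j w| `^ a)%:E)%E.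

Lemma moment_ge0 n : (0 <= M n)%E.
Proof. by apply: integral_ge0 => w _; rewrite lee_fin sumr_ge0// => j _; rewrite powR_ge0. Qed.

Lemma measurable_pow_score j : measurable_fun setT (fun w => `|g j w| `^ a).
Proof.
apply: (measurableT_comp (measurable_powR _)).
by apply: measurableT_comp => //; exact: measurable_score_step.
Qed.

Lemma moment_le m n : (m <= n)%N -> (M m <= M n)%E.
Proof.
move=> mn; apply: ge0_le_integral => //.
- by move=> w _; rewrite lee_fin sumr_ge0// => j _; rewrite powR_ge0.
- apply/measurable_EFinP; apply: measurable_sum => j; exact: measurable_pow_score.
- apply/measurable_EFinP; apply: measurable_sum => j; exact: measurable_pow_score.
- move=> w _; rewrite lee_fin.
  rewrite -!(big_mkord xpredT (fun j => `|g j w| `^ a)) [leRHS](big_cat_nat (leq0n m) mn)/= lerDl.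
  by rewrite sumr_ge0// => j _; rewrite powR_ge0.
Qed.

(** If the moments of order [a] vanish, the tail of the squared scores above any level
    [c] vanishes in mean, so that the information is at most [c^2 n] for all [c > 0],
    hence 0. *)
Lemma moment_gt0 : exists2 n, 0 < r n & (0 < M n)%E.
Proof.
have [n _ /(_ n (leqnn n)) rn] := fisher_rate_gt0.
exists n => //; rewrite lt_neqAle moment_ge0 andbT; apply/negP => /eqP M0.
have Mle c : 0 < c -> (fisher P X h p q x n t <= (c ^+ 2 * n%:R)%:E)%E.
  move=> c0; rewrite fisherE.
  apply: (@le_trans _ _ (\int[Q]_w ((c ^+ 2 * n%:R)%:E +
     (c `^ (2 - a))%:E * (\sum_(j < n) `|g j w| `^ a)%:E))%E).
    apply: ge0_le_integral => //.
    - by move=> w _; rewrite lee_fin sumr_ge0// => j _; rewrite sqr_ge0.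
    - apply/measurable_EFinP; apply: measurable_sum => j.
      by apply: measurable_funX; exact: measurable_score_step.
    - apply: emeasurable_funD => //; apply: emeasurable_funM => //.
      apply/measurable_EFinP; apply: measurable_sum => j; exact: measurable_pow_score.
    - move=> w _; rewrite -EFinM -EFinD lee_fin mulr_sumr.
      have -> : c ^+ 2 * n%:R = \sum_(j < n) c ^+ 2.
        by rewrite sumr_const card_ord mulr_natr.
      rewrite -big_split/=; apply: ler_sum => j _.
      have := @tail_sqr_le _ _ (score p q t) c a c0 a2 (Xn j w) (Xn j.+1 w).
      rewrite /tail_sqr lerBlDl => /le_trans; apply; rewrite lerD2r.
      rewrite /trunc_sqr; case: ifPn => [gc|_]; last exact: sqr_ge0.
      by rewrite -(real_normK (num_real (score _ _ _ _ _))) lerXn2r// ?nnegrE ?(ltW c0).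
  have pw0 w : (0 <= (\sum_(j < n) `|g j w| `^ a)%:E)%E.
    by rewrite lee_fin sumr_ge0// => j _; rewrite powR_ge0.
  have mpw : measurable_fun setT (fun w => (\sum_(j < n) `|g j w| `^ a)%:E).
    by apply/measurable_EFinP; apply: measurable_sum => j; exact: measurable_pow_score.
  have c20 : (0 <= (c `^ (2 - a))%:E)%E by rewrite lee_fin powR_ge0.
  have cn0 : (0 <= (c ^+ 2 * n%:R)%:E)%E by rewrite lee_fin mulr_ge0 ?sqr_ge0.
  rewrite ge0_integralD//; last 2 first.
  - by move=> w _; rewrite mule_ge0.
  - exact: emeasurable_funM.
  rewrite ge0_integralZl// -M0 mule0 adde0 integral_cst//.
  rewrite -[leRHS]mule1 lee_wpmul2l//; exact: probability_le1.
have n1 : 0 < n.+1%:R :> R by rewrite ltr0n.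
(* At this level the bound, multiplied by [r n ^+ 2], is less than 1. *)
have c0 : 0 < (r n * n.+1%:R)^-1 by rewrite invr_gt0 mulr_gt0.
have r20 : (0 <= (r n ^+ 2)%:E)%E by rewrite lee_fin sqr_ge0.
have := lee_wpmul2l r20 (Mle _ c0).
rewrite fisher_rateM// -EFinM lee_fin => le1.
have : r n ^+ 2 * ((r n * n.+1%:R)^-1 ^+ 2 * n%:R) < 1.
  have -> : r n ^+ 2 * ((r n * n.+1%:R)^-1 ^+ 2 * n%:R) = n%:R / n.+1%:R / n.+1%:R.
    by field; rewrite !gt_eqF.
  rewrite ltr_pdivrMr// mul1r ltr_pdivrMr//.
  by rewrite -natrM ltr_nat (leq_trans (ltnSn n))// leq_pmulr.
by rewrite ltNge le1.
Qed.

(** The normalized moments tend to 0, but the moments, which increase with [n], are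
    bounded from below by a positive number for [n] large. *)
Lemma rate_cvg0 : r n @[n --> \oo] --> 0.
Proof.
have [n0 rn0 Mn0] := moment_gt0.
have [tau tau0 tauM] : exists2 tau : R, 0 < tau & (tau%:E <= M n0)%E.
  move: Mn0; case: (M n0) => [m| |]//; first by rewrite lte_fin => m0; exists m.
  by exists 1 => //; rewrite leey.
apply/cvgr0Pnorm_lt => e e0.
have ea0 : 0 < e `^ a * tau by rewrite mulr_gt0// powR_gt0.
have := cvge0_lt lyapunov ea0 => L.
near=> n; rewrite ger0_norm ?fisher_rate_ge0// ltNge; apply/negP => er.
have Ln : ((r n `^ a)%:E * 'E_Q[(fun w => (\sum_(j < n) `|g j w| `^ a)%R)] < (e `^ a * tau)%:E)%E.
  by near: n.
move: Ln; rewrite expectationE ltNge => /negP; apply.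
have nn : (n0 <= n)%N by near: n; exact: nbhs_infty_ge.
rewrite EFinM; apply: lee_pmul; rewrite ?lee_fin ?powR_ge0 ?(ltW tau0)//.
- by rewrite ge0_ler_powR// ?nnegrE ?(ltW e0) ?fisher_rate_ge0// (le_trans _ (ltW a2)).
- exact: le_trans tauM (moment_le nn).
Unshelve. all: by end_near. Qed.

Lemma local_parameter (u : R) : \forall n \near \oo, Theta (t + r n * u).
Proof.
have cT : t + r n * u @[n --> \oo] --> t.
  rewrite -[X in _ --> X]addr0; apply: cvgD; first exact: cvg_cst.
  by rewrite -[X in _ --> X](mul0r u); apply: cvgMl; exact: rate_cvg0.
exact: (cT _ (open_nbhs_nbhs (conj oTheta Tt))).
Qed.

End rate.

(** * The remainder of the expansion of the root density *)

Section remainder.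
Context (R : realType) (E : pointedMetricType R).
Context dO (Omega : measurableType dO).
Variables (Theta : set R) (P : R -> E -> probability Omega R).
Variable X : R -> {mfun Omega >-> borel E}.
Variable lambda : {sigma_finite_measure set (borel E) -> \bar R}.
Variables (h : R) (p q : R -> E -> E -> R).
Hypothesis pd : transition_density Theta P X lambda h p.
Hypothesis mq : jointly_measurable Theta q.
Hypothesis reg : forall y, regular lambda Theta (fun t => p t y) (fun t => q t y).
Hypothesis oTheta : open Theta.
Variables (t : R) (x : E).
Hypothesis Tt : Theta t.

Local Notation Q := (P t x).
Local Notation Xn := (sample X h).
Local Notation rp := (rootp p).
Local Notation dq t' y := (sq lambda (fun z : borel E => q t' y z - q t y z)).

(* [D y] is the squared norm of the remainder of the first-order expansion at [y]. *)
Variables (c : R) (n : nat).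
Hypothesis segment : forall v, v \in `[0, 1] -> Theta (t + v * c).

Local Notation D y := (sq lambda (fun z => rp (t + c) y z - rp t y z - c * q t y z)).
Local Notation grid m k := (t + k%:R / m.+1%:R * c).

Lemma grid_in m (k : 'I_m.+1) : Theta (grid m k).
Proof.
apply: segment; rewrite in_itv/= divr_ge0//= ler_pdivrMr ?ltr0n// mul1r ler_nat.
exact: ltnW.
Qed.

Lemma Theta_end : Theta (t + c).
Proof. by rewrite -[c]mul1r; apply: segment; rewrite in_itv/= ler01 lexx. Qed.

Lemma remainder_le y e : 0 < e -> \forall m \near \oo,
  D y <= m.+1%:R^-1 * (\sum_(k < m.+1) c ^+ 2 * dq (grid m k) y) + e.
Proof.
move=> e0.
apply: (@sq_taylor _ _ _ lambda Theta (fun t => rp t y) (fun t => q t y)) => //.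
- by move=> u Tu; exact: (L2_rootp pd Tu).
- by move=> u Tu; exact: (L2_q reg).
- by move=> u Tu; exact: (rootp_derivative reg).
- by move=> u Tu; exact: (q_continuous reg).
Qed.

Lemma measurable_dq t' : Theta t' ->
  measurable_fun setT ((fun y => dq t' y) : borel E -> R).
Proof.
move=> Tt'; apply: (@measurable_sq_section _ E lambda (fun y z => q t' y z - q t y z)).
by apply: measurable_funB; exact: mq.
Qed.

Lemma dqE t' y : Theta t' ->
  (dq t' y)%:E = (\int[lambda]_z ((q t' y z - q t y z) ^+ 2)%:E)%E.
Proof. by move=> Tt'; apply: L2_sqE; exact: (L2B (L2_q reg y Tt') (L2_q reg y Tt)). Qed.

(** By [remainder_le] and Fatou's lemma. *)
Lemma integral_remainder_le (e : R) :
  (forall v, v \in `[0, 1] -> Theta (t + v * c) ->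
    ((c ^+ 2)%:E * (\int[Q]_w \sum_(j < n) \int[lambda]_z
      ((q (t + v * c)%R (Xn j w) z - q t (Xn j w) z) ^+ 2)%:E) <= e%:E)%E) ->
  (\int[Q]_w (\sum_(j < n) D (Xn j w))%:E <= e%:E)%E.
Proof.
move=> He.
pose B m (k : 'I_m.+1) w := \sum_(j < n) dq (grid m k) (Xn j w).
have B0 m k w : 0 <= @B m k w by apply: sumr_ge0 => j _; exact: sq_ge0.
have mB m k : measurable_fun setT (@B m k).
  apply: measurable_sum => j.
  exact: (measurableT_comp (measurable_dq (@grid_in m k)) (measurable_funP (Xn j))).
pose A m w := m.+1%:R^-1 * (\sum_(k < m.+1) c ^+ 2 * @B m k w).
have A0 m w : 0 <= A m w.
  by rewrite mulr_ge0 ?invr_ge0// sumr_ge0// => k _; rewrite mulr_ge0 ?sqr_ge0.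
have mA m : measurable_fun setT (A m).
  by apply: measurable_funM => //; apply: measurable_sum => k; exact: measurable_funM.
have DA w : ((\sum_(j < n) D (Xn j w))%:E <= limn_einf (fun m => (A m w)%:E))%E.
  apply: le_limn_einf => d d0.
  have dn0 : 0 < d / n.+1%:R by rewrite divr_gt0.
  near=> m.
  have Hm : forall j : 'I_n, D (Xn j w) <= m.+1%:R^-1 *
      (\sum_(k < m.+1) c ^+ 2 * dq (grid m k) (Xn j w)) + d / n.+1%:R.
    by near: m; apply: filter_forall => j; exact: remainder_le.
  apply: (le_trans (ler_sum _ (fun j _ => Hm j))).
  rewrite big_split/= sumr_const card_ord lerD//.
    rewrite /A -mulr_sumr exchange_big/= ler_wpM2l ?invr_ge0//.
    by apply: ler_sum => k _; rewrite mulr_sumr.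
  rewrite -[leLHS]mulr_natr mulrAC ler_pdivrMr ?ltr0n// ler_pM2l// ler_nat.
  exact: leqnSn.
(* [A m] is the Riemann sum on the grid with [m.+1] points. *)
apply: (@le_trans _ _ (\int[Q]_w limn_einf (fun m => (A m w)%:E))%E).
  apply: ge0_le_integral => //.
  - by move=> w _; rewrite lee_fin sumr_ge0// => j _; exact: sq_ge0.
  - apply/measurable_EFinP; apply: measurable_sum => j.
    suff mD : measurable_fun setT ((fun y => D y) : borel E -> R).
      exact: (measurableT_comp mD (measurable_funP (Xn j))).
    apply: (@measurable_sq_section _ E lambda
      (fun y z => rp (t + c) y z - rp t y z - c * q t y z)).
    apply: measurable_funB; last by apply: measurable_funM => //; exact: mq.
    exact: (measurable_dd pd Tt Theta_end).
  - rewrite /limn_einf; apply: measurableT_comp => //.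
    apply: measurable_fun_limn_esup => m; apply: measurableT_comp => //.
    exact/measurable_EFinP.
apply: (le_trans (fatou _ _ _ _)) => //.
- by move=> m; apply/measurable_EFinP.
- by move=> m w _; rewrite lee_fin.
apply: limn_einf_le => m.
rewrite /A; under eq_integral do rewrite EFinM.
rewrite ge0_integralZl_EFin ?invr_ge0//; last 2 first.
- by move=> w _; rewrite lee_fin sumr_ge0// => k _; rewrite mulr_ge0 ?sqr_ge0.
- apply/measurable_EFinP; apply: measurable_sum => k; exact: measurable_funM.
under eq_integral do rewrite -sumEFin.
rewrite ge0_integral_sum//; last 2 first.
- by move=> k; apply/measurable_EFinP; exact: measurable_funM.
- by move=> k w _; rewrite lee_fin mulr_ge0 ?sqr_ge0.
apply: (@le_trans _ _ ((m.+1%:R^-1)%:E * \sum_(k < m.+1) e%:E)%E).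
  apply: lee_wpmul2l; first by rewrite lee_fin invr_ge0.
  apply: lee_sum => k _; under eq_integral do rewrite EFinM.
  rewrite ge0_integralZl_EFin ?sqr_ge0//; last 2 first.
  - by move=> w _; rewrite lee_fin.
  - exact/measurable_EFinP.
  have k01 : (k%:R / m.+1%:R : R) \in `[0, 1].
    by rewrite in_itv/= divr_ge0//= ler_pdivrMr ?ltr0n// mul1r ler_nat ltnW.
  apply: le_trans (He _ k01 (grid_in k)); rewrite le_eqVlt; apply/orP; left; apply/eqP.
  congr (_ * _)%E; apply: eq_integral => w _; rewrite /B -sumEFin.
  by apply: eq_bigr => j _; rewrite dqE//; exact: grid_in.
rewrite sumEFin -EFinM lee_fin sumr_const card_ord -[X in _ * X]mulr_natl mulrA.
by rewrite mulVf ?mul1r// pnatr_eq0.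
Unshelve. all: by end_near. Qed.

End remainder.

(** * The log-likelihood ratio of the chain *)

Lemma sqZ d (T : measurableType d) (R : realType) (mu : {measure set T -> \bar R})
  (c : R) (f : T -> R) : L2 mu f -> sq mu (fun x => c * f x) = c ^+ 2 * sq mu f.
Proof.
move=> Lf; rewrite /sq -RintegralZl//; last exact: Lf.2.
by apply: eq_Rintegral => x _; rewrite exprMn.
Qed.

Section lan.
Context (R : realType) (E : pointedMetricType R).
Context dO (Omega : measurableType dO).
Variables (Theta : set R) (P : R -> E -> probability Omega R).
Variable X : R -> {mfun Omega >-> borel E}.
Variable lambda : {sigma_finite_measure set (borel E) -> \bar R}.
Variables (h : R) (p q : R -> E -> E -> R).
Hypothesis h0 : 0 < h.
Hypothesis mkv : markov_family Theta P X.
Hypothesis pd : transition_density Theta P X lambda h p.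
Hypothesis mq : jointly_measurable Theta q.
Hypothesis reg : forall y, regular lambda Theta (fun t => p t y) (fun t => q t y).
Hypothesis oTheta : open Theta.
Hypothesis convex_Theta : forall t c v, Theta t -> Theta (t + c) -> v \in `[0, 1] ->
  Theta (t + v * c).
Variables (t : R) (x : E).
Hypothesis Tt : Theta t.

Local Notation Q := (P t x).
Local Notation Xn := (sample X h).
Local Notation rp := (rootp p).
Local Notation r := (fun n => fisher_rate P X h p q x n t).
Local Notation sc := (score p q t).
Local Notation g := (score_step X h p q t).
Local Notation F := (in_prob (P t x)).

Hypothesis law_squares : cvg_in_probability (fun=> P t x)
  (fun n w => (r n ^+ 2 * \sum_(j < n) g j w ^+ 2)%:E) 1.
Variable a : R.
Hypothesis a2 : 2 < a.
Hypothesis lyapunov :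
  ((r n `^ a)%:E * 'E_(P t x)[fun w => (\sum_(j < n) `|g j w| `^ a)%R]
      @[n --> \oo] --> 0)%E.
Hypothesis smooth : forall N : R, 0 < N ->
    (ereal_sup [set (r n ^+ 2)%:E *
        \int[P t x]_w \sum_(j < n) \int[lambda]_y
          ((q (t + r n * v) (sample X h j w) y
            - q t (sample X h j w) y) ^+ 2)%:E
      | v in [set v | `|v| < N /\ Theta (t + r n * v)]%R]
      @[n --> \oo] --> 0)%E.

Section local.
Variable u : R.
Let near_Theta : \forall n \near \oo, Theta (t + r n * u).
Proof. exact: (local_parameter pd mq oTheta Tt law_squares a2 lyapunov). Qed.

Lemma remainder_cvg :
  (\int[Q]_w (state_sum X h (fun n y => sq lambda (fun z => rp (t + r n * u) y z - rp t y z -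
    u * (r n * q t y z))) (n, w))%:E @[n --> \oo] --> 0)%E.
Proof.
apply: ge0_cvge0P => [n|e e0].
  by apply: integral_ge0 => w _; rewrite lee_fin sumr_ge0// => j _; exact: sq_ge0.
have u1 : 0 < u ^+ 2 + 1 by rewrite ltr_wpDl// sqr_ge0.
have N0 : 0 < `|u| + 1 by rewrite ltr_wpDl.
have d0 : 0 < e / (u ^+ 2 + 1) by rewrite divr_gt0.
have := cvge0_lt (smooth N0) d0; apply: filterS2 near_Theta => n Tn Sn.
rewrite /state_sum/=.
have -> : (fun w => (\sum_(j < n) sq lambda (fun z : borel E =>
      rp (t + r n * u) (Xn j w) z - rp t (Xn j w) z - u * (r n * q t (Xn j w) z)))%:E) =
    (fun w => (\sum_(j < n) sq lambda (fun z : borel E =>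
      rp (t + r n * u) (Xn j w) z - rp t (Xn j w) z - (r n * u) * q t (Xn j w) z))%:E).
  apply/funext => w; congr (_%:E); apply: eq_bigr => j _; congr (sq _ _).
  by apply/funext => z; rewrite mulrCA mulrA.
apply: (@integral_remainder_le _ _ _ _ Theta P X lambda h p q pd mq reg oTheta t x Tt
   (r n * u) n) => v v01.
  exact: convex_Theta.
rewrite mulrCA => Tv; rewrite exprMn mulrC EFinM -muleA.
apply: (@le_trans _ _ ((u ^+ 2)%:E * (e / (u ^+ 2 + 1))%:E)%E); last first.
  by rewrite -EFinM lee_fin mulrC mulrAC ler_pdivrMr// ler_pM2l// lerDl.
apply: lee_wpmul2l; first by rewrite lee_fin sqr_ge0.
apply: le_trans (ltW Sn); apply: ereal_sup_ubound; exists (v * u) => //=; split => //.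
move: v01; rewrite in_itv/= => /andP[v0 v1].
rewrite normrM ger0_norm//; apply: (@le_lt_trans _ _ `|u|); last by rewrite ltrDl.
by rewrite ler_piMl.
Qed.

(** The limit theorem for arrays, applied at the local parameters [t + r n * u]. *)
Lemma local_log_ratio :
  (forall e : R, 0 < e -> \forall z \near F, forall j : 'I_z.1,
    `|rp (t + r z.1 * u) (Xn j z.2) (Xn j.+1 z.2) / rp t (Xn j z.2) (Xn j.+1 z.2) - 1| < e) /\
  (step_sum X h (fun n y z => 2 * ln (1 + (rp (t + r n * u) y z / rp t y z - 1))) z
    - u * step_sum X h (fun n y z => r n * sc y z) z + u ^+ 2 / 2 @[z --> F] --> (0 : R)).
Proof.
have rgt0 := fisher_rate_gt0 law_squares.
have ms := measurable_score pd mq Tt.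
have mb n : measurable_fun setT (fun z : borel E * borel E => r n * sc z.1 z.2).
  exact: measurable_funM.
have mb' n : measurable_fun setT (fun z : borel E * borel E => r n * q t z.1 z.2).
  by apply: measurable_funM => //; exact: mq.
have Lb n y : L2 lambda (fun z : borel E => r n * sc y z * rp t y z).
  rewrite (_ : (fun z => _) = (fun z => r n * (sc y z * rp t y z))); last first.
    by apply/funext => z; rewrite mulrA.
  by apply: L2Z; exact: (L2_score pd reg Tt).
have Lb' n y : L2 lambda (fun z : borel E => r n * q t y z).
  by apply: L2Z; exact: (L2_q reg).
have sumb2 n w : step_sum X h (fun n y z => (r n * sc y z) ^+ 2) (n, w) =
    r n ^+ 2 * \sum_(j < n) g j w ^+ 2.
  by rewrite /step_sum mulr_sumr; apply: eq_bigr => j _; rewrite exprMn.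
have sumba n w : step_sum X h (fun n y z => `|r n * sc y z| `^ a) (n, w) =
    r n `^ a * \sum_(j < n) `|g j w| `^ a.
  rewrite /step_sum mulr_sumr; apply: eq_bigr => j _.
  by rewrite normrM ger0_norm ?fisher_rate_ge0// powRM ?fisher_rate_ge0.
have b2_le1 : \forall n \near \oo,
    (\int[Q]_w (step_sum X h (fun n y z => (r n * sc y z) ^+ 2) (n, w))%:E <= 1)%E.
  apply: filterS rgt0 => n rn.
  rewrite -(fisher_rateM rn) (fisherE pd mq x Tt).
  rewrite -ge0_integralZl_EFin ?sqr_ge0//; last 2 first.
  - by move=> w _; rewrite lee_fin sumr_ge0// => j _; exact: sqr_ge0.
  - apply/measurable_EFinP; apply: measurable_sum => j; apply: measurable_funX.
    exact: (measurable_score_step pd mq Tt).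
  rewrite le_eqVlt; apply/orP; left; apply/eqP.
  by apply: eq_integral => w _; rewrite sumb2 EFinM.
have b2_cvg : step_sum X h (fun n y z => (r n * sc y z) ^+ 2) z @[z --> F] --> (1 : R).
  apply: (@cvg_in_probability_cvg _ _ _ Q
    (fun n w => step_sum X h (fun n y z => (r n * sc y z) ^+ 2) (n, w)) 1).
    apply: nearW => n; apply: measurable_step_sum; exact: measurable_funX.
  move=> e e0; apply: cvg_trans (law_squares e0).
  by apply: near_eq_cvg; apply: nearW => n; under [in RHS]eq_set do rewrite sumb2.
have ba_cvg : (\int[Q]_w (step_sum X h (fun n y z => `|r n * sc y z| `^ a) (n, w))%:E
    @[n --> \oo] --> 0)%E.
  apply: cvg_trans lyapunov; apply: near_eq_cvg; apply: nearW => n.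
  rewrite expectationE -ge0_integralZl_EFin ?powR_ge0//; last 2 first.
  - by move=> w _; rewrite lee_fin sumr_ge0// => j _; rewrite powR_ge0.
  - apply/measurable_EFinP; apply: measurable_sum => j.
    exact: (measurable_pow_score pd mq Tt).
  by apply: eq_integral => w _; rewrite sumba EFinM.
have sqb' n y : sq lambda (fun z : borel E => r n * q t y z) =
    sq lambda (fun z : borel E => r n * sc y z * rp t y z) / 4.
  rewrite (_ : (fun z => r n * sc y z * _) = (fun z => r n * (sc y z * rp t y z))); last first.
    by apply/funext => z; rewrite mulrA.
  rewrite (sqZ _ (L2_q reg y Tt)) (sqZ _ (L2_score pd reg Tt y)).
  by rewrite (sq_score pd reg oTheta Tt); field.
pose xi n y z := rp (t + r n * u) y z / rp t y z - 1.
pose dd n y z := rp (t + r n * u) y z - rp t y z.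
have etaE n y z : u / 2 * (r n * sc y z) = r n * u / 2 * sc y z by ring.
have mxi : \forall n \near \oo, measurable_fun setT (fun z : borel E * borel E => xi n z.1 z.2).
  by apply: filterS near_Theta => n Tn; exact: (measurable_xi pd Tt Tn).
have mdd : \forall n \near \oo, measurable_fun setT (fun z : borel E * borel E => dd n z.1 z.2).
  by apply: filterS near_Theta => n Tn; exact: (measurable_dd pd Tt Tn).
have Ldd : \forall n \near \oo, forall y, L2 lambda (fun z : borel E => dd n y z).
  by apply: filterS near_Theta => n Tn y; exact: (L2_dd pd Tt Tn).
have zetaE n y : (fun z : borel E => (xi n y z - u / 2 * (r n * sc y z)) * rp t y z) =
    (fun z => (xi n y z - r n * u / 2 * sc y z) * rp t y z).
  by apply/funext => z; rewrite etaE.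
have Lzeta : \forall n \near \oo, forall y, L2 lambda
    (fun z : borel E => (xi n y z - u / 2 * (r n * sc y z)) * rp t y z).
  by apply: filterS near_Theta => n Tn y; rewrite zetaE; exact: (L2_zeta pd reg Tt Tn).
have zeta_mean : \forall n \near \oo, forall y,
    cond_mean lambda p t (fun y z => xi n y z - u / 2 * (r n * sc y z)) y =
    - sq lambda (fun z : borel E => dd n y z) / 2.
  apply: filterS near_Theta => n Tn y; rewrite /cond_mean zetaE.
  exact: (zeta_cond_mean pd reg oTheta Tt Tn).
have zeta_le : \forall n \near \oo, forall y,
    sq lambda (fun z : borel E => (xi n y z - u / 2 * (r n * sc y z)) * rp t y z) <=
    sq lambda (fun z : borel E => dd n y z - u * (r n * q t y z)).
  apply: filterS near_Theta => n Tn y; rewrite zetaE.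
  rewrite (_ : (fun z => dd n y z - _) = (fun z => dd n y z - r n * u * q t y z)).
    exact: (sq_zeta_le pd reg Tt Tn).
  by apply/funext => z; rewrite mulrCA mulrA.
split.
- exact: (max_xi_cvg h0 mkv pd Tt mb a2 ba_cvg mb' mxi mdd Lzeta zeta_le remainder_cvg).
- exact: (log_ratio_cvg h0 mkv pd Tt mb Lb b2_le1 b2_cvg a2 ba_cvg mb' Lb' sqb' mxi mdd Ldd
    Lzeta zeta_mean zeta_le remainder_cvg).
Qed.

End local.
End lan.

(** * The likelihood ratio as a function of the observation *)

Lemma measurable_lne d (T : measurableType d) (R : realType) (f : T -> R) :
  measurable_fun setT f -> measurable_fun setT (fun x => lne (f x)%:E).
Proof.
move=> mf; apply: measurable_fun_ifT => //; first exact: measurable_fun_ler.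
by apply/measurable_EFinP; exact: measurableT_comp (@measurable_ln R) mf.
Qed.

Lemma ln_prod (R : realType) n (f : 'I_n -> R) : (forall j, 0 < f j) ->
  0 < \prod_(j < n) f j /\ ln (\prod_(j < n) f j) = \sum_(j < n) ln (f j).
Proof.
move=> f0; apply: (big_ind2 (fun a b => 0 < a /\ ln a = b)) => [|a b c d [a0 <-] [c0 <-]|j _].
- by rewrite ltr01 ln1.
- by rewrite mulr_gt0// lnM.
- by [].
Qed.

Section likelihood.
Context (R : realType) (E : pointedMetricType R).
Context dO (Omega : measurableType dO).
Variables (Theta : set R) (P : R -> E -> probability Omega R).
Variable X : R -> {mfun Omega >-> borel E}.
Variable lambda : {sigma_finite_measure set (borel E) -> \bar R}.
Variables (h : R) (p q : R -> E -> E -> R).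
Hypothesis mkv : markov_family Theta P X.
Hypothesis pd : transition_density Theta P X lambda h p.
Hypothesis mq : jointly_measurable Theta q.
Variables (t : R) (x : E).
Hypothesis Tt : Theta t.

Local Notation Q := (P t x).
Local Notation Xn := (sample X h).
Local Notation rp := (rootp p).
Local Notation sc := (score p q t).
Local Notation jm f := (measurable_fun setT (fun z : borel E * borel E => f z.1 z.2)).
Local Notation obs := (@observation R E dO Omega X h).

(** For j = 0 the first argument is the starting point, and for j > 0 it is the previous
    component of the tuple. *)
Lemma measurable_tuple_step n (f : borel E -> borel E -> R) (j : 'I_n) : jm f ->
  measurable_fun setT (fun y : n.-tuple (borel E) => f (nth x (x :: y) j) (tnth y j)).
Proof.
move=> mf; apply: (@measurable_fun_comp2 _ _ _ _ (n.-tuple (borel E)) (borel E) (borel E) _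
  f (fun y : n.-tuple (borel E) => nth x (x :: y) j) (fun y => tnth y j) mf).
- case: j => -[|k] kn //=.
  rewrite (_ : (fun y => _) = (fun y : n.-tuple (borel E) => tnth y (Ordinal (ltnW kn)))).
    exact: measurable_tnth.
  by apply/funext => y; rewrite (tnth_nth x).
- exact: measurable_tnth.
Qed.

Lemma measurable_observation_density n t' : Theta t' ->
  measurable_fun setT (@observation_density R E p x n t').
Proof.
move=> Tt'; apply: measurable_prod => j _.
exact: (measurable_tuple_step j (measurable_p pd Tt')).
Qed.

Lemma observation_density_ge0 n t' y : Theta t' -> 0 <= @observation_density R E p x n t' y.
Proof. by move=> Tt'; apply: prodr_ge0 => j _; exact: (p_ge0 pd Tt'). Qed.

(** If the chain starts from [x], then [x] followed by the observation lists its states. *)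
Lemma observation_step (f : E -> E -> R) n (j : 'I_n) w : Xn 0 w = x ->
  f (nth x (x :: obs n w) j) (tnth (obs n w) j) = f (Xn j w) (Xn j.+1 w).
Proof.
move=> X0; rewrite tnth_mktuple; congr f.
case: j => -[|k] kn //=.
by rewrite -(tnth_nth x (obs n w) (Ordinal (ltnW kn))) tnth_mktuple.
Qed.

Lemma measurable_start : measurable [set w | Xn 0 w = x].
Proof.
rewrite (_ : [set w | _] = setT `&` Xn 0 @^-1` [set x]); last by rewrite setTI.
have mx : measurable ([set x] : set (borel E)).
  rewrite -[X in measurable X]setCK; apply: measurableC; apply: sub_sigma_algebra.
  apply: closed_openC; apply: accessible_closed_set1; apply: hausdorff_accessible.
  exact: metric_hausdorff.
have mX : measurable_fun setT (Xn 0 : Omega -> borel E) by exact: measurable_funP.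
exact: (mX measurableT _ mx).
Qed.

Lemma start_as : Q [set w | Xn 0 w = x] = 1%E.
Proof. by have := markov_start mkv x Tt; rewrite /sample mulr0. Qed.

(** The derivative of the log-likelihood, as a function of the observation. *)
Definition score_sum n (y : n.-tuple (borel E)) : R :=
  \sum_(j < n) sc (nth x (x :: y) j) (tnth y j).

Lemma measurable_score_sum n : measurable_fun setT (@score_sum n).
Proof.
apply: measurable_sum => j; exact: (measurable_tuple_step j (measurable_score pd mq Tt)).
Qed.

Lemma score_sum_observation n w : Xn 0 w = x ->
  score_sum (obs n w) = \sum_(j < n) score_step X h p q t j w.
Proof. by move=> X0; apply: eq_bigr => j _; rewrite (observation_step sc). Qed.

Variables (c u : R).

(** The logarithm of the likelihood ratio minus its quadratic approximation.  It is -oo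
    where the likelihood ratio is 0, and is set to 0 if [t + c * u] is not a parameter. *)
Definition log_remainder n (y : n.-tuple (borel E)) : \bar R :=
  if `[< Theta (t + c * u) >] then
    (lne (observation_density p x (t + c * u) y / observation_density p x t y)%:E
      - (c * score_sum y * u - u ^+ 2 / 2)%:E)%E
  else 0%E.

Lemma measurable_log_remainder n : measurable_fun setT (@log_remainder n).
Proof.
rewrite /log_remainder; case: asboolP => // Tu.
apply: emeasurable_funB.
- apply: measurable_lne; apply: measurable_funM; first exact: measurable_observation_density.
  apply: measurable_inv_ge0 => [|y]; first exact: measurable_observation_density.
  exact: observation_density_ge0.
- apply/measurable_EFinP; apply: measurable_funB => //.
  by apply: measurable_funM => //; apply: measurable_funM => //; exact: measurable_score_sum.
Qed.

Lemma likelihood_ratioE n (y : n.-tuple (borel E)) : Theta (t + c * u) ->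
  ((observation_density p x (t + c * u) y / observation_density p x t y)%:E =
   expeR ((c * score_sum y * u - u ^+ 2 / 2)%:E + log_remainder y))%E.
Proof.
move=> Tu; rewrite /log_remainder asboolT// addeC subeK//.
apply/esym/eqP; rewrite lneK_eq lee_fin divr_ge0//; exact: observation_density_ge0.
Qed.

Lemma log_remainder_observation n w : Theta (t + c * u) -> Xn 0 w = x ->
  (forall j : 'I_n, `|rp (t + c * u) (Xn j w) (Xn j.+1 w) / rp t (Xn j w) (Xn j.+1 w) - 1| < 1) ->
  log_remainder (obs n w) =
  (\sum_(j < n) 2 * ln (1 + (rp (t + c * u) (Xn j w) (Xn j.+1 w) / rp t (Xn j w) (Xn j.+1 w) - 1))
   - u * \sum_(j < n) c * sc (Xn j w) (Xn j.+1 w) + u ^+ 2 / 2)%:E.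
Proof.
move=> Tu X0 H; rewrite /log_remainder asboolT// score_sum_observation//.
pose s (j : 'I_n) := rp (t + c * u) (Xn j w) (Xn j.+1 w) / rp t (Xn j w) (Xn j.+1 w).
have s0 j : 0 < s j.
  by have := H j; rewrite -/(s j) ltr_norml => /andP[+ _]; rewrite ltrBrDr addrC subrr.
have -> : observation_density p x (t + c * u) (obs n w) / observation_density p x t (obs n w) =
    \prod_(j < n) s j ^+ 2.
  rewrite /observation_density -prodf_div; apply: eq_bigr => j _.
  rewrite (observation_step (p (t + c * u)))// (observation_step (p t))//.
  by rewrite -(rootpK pd Tu) -(rootpK pd Tt) /s expr2 invfM mulrACA.
have s20 j : 0 < s j ^+ 2 by rewrite exprn_gt0.
have [pos lnE] := ln_prod s20.
rewrite lne_EFin// lnE -EFinB; congr (_%:E).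
under eq_bigr do rewrite lnXn//.
under [in RHS]eq_bigr do rewrite -/(s _) addrC subrK mulr_natl.
by rewrite -mulr_sumr /score_step; ring.
Qed.

End likelihood.

(** * Local asymptotic normality *)

Lemma near_eq_cvg_in_law d (T : measurableType d) (R : realType) (P : probability T R)
    (Y Z : nat -> T -> R) (nu : probability (measurableTypeR R) R) :
  (\forall n \near \oo, Y n = Z n) -> cvg_in_law (fun=> P) Y nu -> cvg_in_law (fun=> P) Z nu.
Proof.
move=> YZ cY phi cphi bphi; apply: cvg_trans (cY phi cphi bphi).
by apply: near_eq_cvg; apply: filterS YZ => n ->.
Qed.

Section observation_limit.
Context (R : realType) (E : pointedMetricType R).
Context dO (Omega : measurableType dO).
Variables (Theta : set R) (P : R -> E -> probability Omega R).
Variable X : R -> {mfun Omega >-> borel E}.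
Variable lambda : {sigma_finite_measure set (borel E) -> \bar R}.
Variables (h : R) (p q : R -> E -> E -> R).
Hypothesis mkv : markov_family Theta P X.
Hypothesis pd : transition_density Theta P X lambda h p.
Hypothesis mq : jointly_measurable Theta q.
Variables (t : R) (x : E).
Hypothesis Tt : Theta t.
Variable c : nat -> R.

(** Under the law of the observation, the starting point is [x] almost surely. *)
Lemma cvg_in_law_observation (nu : probability (measurableTypeR R) R) :
  cvg_in_law (fun=> P t x) (fun n w => c n * \sum_(j < n) score_step X h p q t j w) nu ->
  cvg_in_law (fun n => observation_law P X h x n t)
    (fun n y => c n * score_sum p q t x y) nu.
Proof.
move=> cS phi cphi bphi; have [M phiM] := bphi.
apply: cvg_trans (cS phi cphi bphi); apply: near_eq_cvg; apply: nearW => n.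
have mphi : measurable_fun setT phi by exact: continuous_measurable_fun.
pose Y y := phi (c n * @score_sum R E p q t x n y).
have mY : measurable_fun setT Y.
  apply: measurableT_comp => //; apply: measurable_funM => //.
  exact: (measurable_score_sum pd mq).
have mYo : measurable_fun setT (Y \o @observation _ _ _ _ X h n).
  by apply: measurableT_comp => //; exact: measurable_observation.
rewrite !expectationE.
rewrite (@integral_distribution _ _ _ _ _ (P t x) (@observation _ _ _ _ X h n) (EFin \o Y)).
- apply: ae_eq_integral => //.
  + apply/measurable_EFinP; apply: measurableT_comp => //; apply: measurable_funM => //.
    apply: measurable_sum => j; exact: (measurable_score_step pd mq Tt).
  + exact/measurable_EFinP.
  + exists (~` [set w | sample X h 0 w = x]); split.
    * by apply: measurableC; exact: measurable_start.
    * apply: etrans (probability_setC (P t x) (measurable_start X h x)) _.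
      by rewrite (start_as h mkv)// subee.
    * move=> w /= H X0; apply: H => _; congr (phi (_ * _))%:E.
      by rewrite score_sum_observation.
- exact/measurable_EFinP.
- apply: (measurable_bounded_integrable measurableT) => //.
    by apply: (@le_lt_trans _ _ 1%E); [exact: probability_le1|exact: ltry].
  exists M; split; first exact: num_real.
  by move=> N MN w _ /=; apply: le_trans (ltW MN); exact: phiM.
Qed.

End observation_limit.

Section lan_main.
Context (R : realType) (E : pointedMetricType R).
Context dO (Omega : measurableType dO).
Variables (Theta : set R) (P : R -> E -> probability Omega R).
Variable X : R -> {mfun Omega >-> borel E}.
Variable lambda : {sigma_finite_measure set (borel E) -> \bar R}.
Variables (h : R) (p q : R -> E -> E -> R).
Hypothesis h0 : 0 < h.
Hypothesis mkv : markov_family Theta P X.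
Hypothesis pd : transition_density Theta P X lambda h p.
Hypothesis mq : jointly_measurable Theta q.
Hypothesis reg : forall y, regular lambda Theta (fun t => p t y) (fun t => q t y).
Hypothesis oTheta : open Theta.
Hypothesis convex_Theta : forall t c v, Theta t -> Theta (t + c) -> v \in `[0, 1] ->
  Theta (t + v * c).
Variables (t : R) (x : E).
Hypothesis Tt : Theta t.

Local Notation Q := (P t x).
Local Notation Xn := (sample X h).
Local Notation rp := (rootp p).
Local Notation r := (fun n => fisher_rate P X h p q x n t).
Local Notation sc := (score p q t).
Local Notation g := (score_step X h p q t).
Local Notation F := (in_prob (P t x)).
Local Notation obs := (@observation R E dO Omega X h).

Hypothesis law_squares : cvg_in_probability (fun=> P t x)
  (fun n w => (r n ^+ 2 * \sum_(j < n) g j w ^+ 2)%:E) 1.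
Variable a : R.
Hypothesis a2 : 2 < a.
Hypothesis lyapunov :
  ((r n `^ a)%:E * 'E_(P t x)[fun w => (\sum_(j < n) `|g j w| `^ a)%R]
      @[n --> \oo] --> 0)%E.
Hypothesis smooth : forall N : R, 0 < N ->
    (ereal_sup [set (r n ^+ 2)%:E *
        \int[P t x]_w \sum_(j < n) \int[lambda]_y
          ((q (t + r n * v) (sample X h j w) y
            - q t (sample X h j w) y) ^+ 2)%:E
      | v in [set v | `|v| < N /\ Theta (t + r n * v)]%R]
      @[n --> \oo] --> 0)%E.

(** The normalizing sequence, modified for the finitely many [n] where it vanishes. *)
Definition positive_rate n : R := if 0 < r n then r n else 1.

Lemma positive_rate_gt0 n : 0 < positive_rate n.
Proof. by rewrite /positive_rate; case: ifPn. Qed.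

Lemma near_positive_rate : \forall n \near \oo, positive_rate n = r n.
Proof.
by apply: filterS (fisher_rate_gt0 law_squares) => n rn; rewrite /positive_rate rn.
Qed.

(** On the event where all |xi| < 1 and the chain starts from [x], the remainder is the
    finite quantity of [local_log_ratio]. *)
Lemma log_remainder_cvg u : cvg_in_probability (fun n => observation_law P X h x n t)
  (fun n => @log_remainder R E Theta p q t x (positive_rate n) u n) 0.
Proof.
move=> e e0.
pose A n : set (n.-tuple (borel E)) :=
  [set y | (e%:E <= `|log_remainder Theta p q t x (positive_rate n) u y - 0%:E|)%E].
apply: (@in_prob_cvg0 _ _ _ Q (fun n => obs n @^-1` A n)).
  apply: nearW => n; rewrite -[X in measurable X]setTI.
  apply: (@measurable_observation R E dO Omega X h n) => //.
  rewrite -[X in measurable X]setTI; apply: emeasurable_fun_c_infty => //.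
  apply: measurableT_comp => //; apply: emeasurable_funB => //.
  exact: (measurable_log_remainder pd mq x Tt).
have [xi_cvg ratio_cvg] := local_log_ratio h0 mkv pd mq reg oTheta convex_Theta Tt
  law_squares a2 lyapunov smooth u.
have near1 := xi_cvg 1 ltr01.
have nearT := near_in_prob Q (S := fun n _ => Theta (t + r n * u) /\ positive_rate n = r n).
have near2 : \forall z \near F, Theta (t + r z.1 * u) /\ positive_rate z.1 = r z.1.
  apply: (nearT _).
  have nT := local_parameter pd mq oTheta Tt law_squares a2 lyapunov u.
  by apply: filterS2 nT near_positive_rate => n.
have near3 : \forall z \near F, Xn 0 z.2 = x.
  apply: (@as_near_in_prob _ _ _ Q [set w | Xn 0 w = x] (fun=> [set w | Xn 0 w = x])).
  - exact: measurable_start.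
  - exact: (start_as h mkv).
  - by move=> _ w.
have near4 := (cvgr0Pnorm_lt _).1 ratio_cvg e e0.
near=> z.
have z1 : forall j : 'I_z.1, `|rp (t + r z.1 * u) (Xn j z.2) (Xn j.+1 z.2) /
  rp t (Xn j z.2) (Xn j.+1 z.2) - 1| < 1 by near: z.
have [z2 z2'] : Theta (t + r z.1 * u) /\ positive_rate z.1 = r z.1 by near: z.
have z3 : Xn 0 z.2 = x by near: z.
rewrite /A/= z2' (log_remainder_observation q pd Tt z2 z3 z1) sube0 lee_fin.
apply/negP; rewrite -ltNge; near: z; exact: near4.
Unshelve. all: by end_near. Qed.

Lemma markov_LAN :
  cvg_in_law (fun=> P t x) (fun n w => r n * \sum_(j < n) g j w) (normal_prob 0 1) ->
  LAN Theta (observation_law P X h x) (observation_density p x) t.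
Proof.
move=> law_sum.
exists positive_rate, (fun n y => positive_rate n * score_sum p q t x y),
  (fun n u y => log_remainder Theta p q t x (positive_rate n) u y); split.
- exact: positive_rate_gt0.
- by move=> n; apply: measurable_funM => //; exact: (measurable_score_sum pd mq).
- apply: (cvg_in_law_observation mkv pd mq Tt).
  apply: near_eq_cvg_in_law law_sum; apply: filterS near_positive_rate => n rn.
  by rewrite rn.
move=> u.
have nT : \forall n \near \oo, Theta (t + positive_rate n * u).
  apply: filterS2 (local_parameter pd mq oTheta Tt law_squares a2 lyapunov u)
    near_positive_rate => n Tn rn.
  by rewrite rn.
split => //.
- apply: filterS nT => n Tn; apply: aeW => y; exact: (likelihood_ratioE _ pd).
- by move=> n; exact: (measurable_log_remainder pd mq x Tt).
- exact: log_remainder_cvg.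
Qed.

End lan_main.

Theorem theorem1 (R : realType) (E : pointedMetricType R)
    (dO : measure_display) (Omega : measurableType dO)
    (theta1 theta2 : \bar R) (P : R -> E -> probability Omega R)
    (X : R -> {mfun Omega >-> borel E})
    (lambda : {sigma_finite_measure set (borel E) -> \bar R})
    (h : R) (p q : R -> E -> E -> R) (x : E) (theta0 : R) :
  let Theta := open_interval theta1 theta2 in
  let r n := fisher_rate P X h p q x n theta0 in
  let g := score_step X h p q theta0 in
  locally_compact [set: E] ->
  0 < h ->
  Theta theta0 ->
  markov_family Theta P X ->
  transition_density Theta P X lambda h p ->
  jointly_measurable Theta q ->
  (* 1 *)
  (forall y, regular lambda Theta (fun t => p t y) (fun t => q t y)) ->
  (forall y n, (1 <= n)%N -> experiment_regular Theta lambda p y n) ->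
  (\forall n \near \oo, (0 < fisher P X h p q x n theta0)%E) ->
  (* 2 *)
  cvg_in_law (fun=> P theta0 x) (fun n w => r n * \sum_(j < n) g j w)
    (normal_prob 0 1) ->
  (* 3 *)
  cvg_in_probability (fun=> P theta0 x)
    (fun n w => (r n ^+ 2 * \sum_(j < n) g j w ^+ 2)%:E) 1 ->
  (* 4 *)
  (exists2 a : R, 2 < a &
    ((r n `^ a)%:E * 'E_(P theta0 x)[fun w => (\sum_(j < n) `|g j w| `^ a)%R]
      @[n --> \oo] --> 0)%E) ->
  (* 5 *)
  (forall N : R, 0 < N ->
    (ereal_sup [set (r n ^+ 2)%:E *
        \int[P theta0 x]_w \sum_(j < n) \int[lambda]_y
          ((q (theta0 + r n * v) (sample X h j w) y
            - q theta0 (sample X h j w) y) ^+ 2)%:E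
      | v in [set v | `|v| < N /\ Theta (theta0 + r n * v)]%R]
      @[n --> \oo] --> 0)%E) ->
  LAN Theta (observation_law P X h x) (observation_density p x) theta0.
Proof.
move=> Theta r g _ h0 Tt mkv pd mq reg _ _ law_sum law_squares [a a2 lyapunov] smooth.
apply: (markov_LAN h0 mkv pd mq reg _ _ Tt law_squares a2 lyapunov smooth law_sum).
- exact: open_open_interval.
- exact: open_interval_convex.
Qed.
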